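(* Let $g\in L^2(\mathbb{R}^d)$ and let $\alpha,\beta>0$ with $\alpha\beta=p/q$, where $p,q\in\mathbb{N}$ are positive integers with $p/q\le1$. For $x,\xi\in\mathbb{R}^d$ let $\mathcal{Q}(x,\xi)$ be the matrix with entries $$\mathcal{Q}(x,\xi)_{r,s}=Z_{\frac1\beta}g\big(x+\tfrac{p}{\beta q}r,\ \beta\xi+\tfrac{\beta s}{p}\big),\qquad r\in E_q,\ s\in E_p .$$ Then $\mathcal{G}(g,\alpha,\beta)$ is a frame for $L^2(\mathbb{R}^d)$ if and only if there is an interval $[A^{1/2},B^{1/2}]\subseteq(0,\infty)$ such that the singular values of $\mathcal{Q}(x,\xi)$ are contained in $[A^{1/2},B^{1/2}]$ for almost all $x,\xi\in\mathbb{R}^d$.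
   Context: For $z=(x,\xi)\in\mathbb{R}^{2d}$ the time-frequency shift is $\pi(z)f(t)=e^{2\pi i\xi\cdot t}f(t-x)$, and $\mathcal{G}(g,\alpha,\beta)=\{\pi(\lambda)g:\lambda\in\alpha\mathbb{Z}^d\times\beta\mathbb{Z}^d\}$. It is a frame for $L^2(\mathbb{R}^d)$ if there are $A,B>0$ with $A\|f\|^2\le\sum_{\lambda\in\alpha\mathbb{Z}^d\times\beta\mathbb{Z}^d}|\langle f,\pi(\lambda)g\rangle|^2\le B\|f\|^2$ for all $f\in L^2(\mathbb{R}^d)$. The Zak transform with parameter $a>0$ is $Z_af(x,\xi)=\sum_{k\in\mathbb{Z}^d}f(x-ak)e^{2\pi i ak\cdot\xi}$ (for $f\in L^2(\mathbb{R}^d)$ and a.e. $x$, the series is the Fourier series of a square-summable sequence, converging in $L^2$ over a period in $\xi$). Index sets: $E_n=\{0,1,\dots,n-1\}^d$. The singular values of the $q^d\times p^d$ matrix $\mathcal{Q}$ (with $q^d\ge p^d$) are the square roots of the $p^d$ eigenvalues of $\mathcal{Q}^*\mathcal{Q}$. *)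

(* Defs.v *)
From HB Require Import structures.
From mathcomp Require Import all_boot all_order all_algebra finmap.
From mathcomp Require Import complex.
From mathcomp Require Import all_classical all_reals all_analysis.

Set Implicit Arguments.
Unset Strict Implicit.
Unset Printing Implicit Defensive.
Import Order.TTheory GRing.Theory Num.Theory.
Import numFieldNormedType.Exports.
Local Open Scope classical_set_scope.
Local Open Scope ring_scope.

Notation vec R d := (d.-tuple (measurableTypeR R)).

Section lebesgue_step.
Context (R : realType) (d : nat).
Variable mu : {sigma_finite_measure set (vec R d) -> \bar R}.

Definition vcons (xy : measurableTypeR R * vec R d) : vec R d.+1 :=
  [the d.+1.-tuple (measurableTypeR R) of xy.1 :: xy.2].

Lemma measurable_vcons : measurable_fun [set: measurableTypeR R * vec R d] vcons.
Proof. exact: measurable_cons. Qed.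

Definition lebesgue_step : set (vec R d.+1) -> \bar R :=
  pushforward (@lebesgue_measure R \x mu)%E vcons.

HB.instance Definition _ := isMeasurableFun.Build _ _ _ _ vcons measurable_vcons.

Let ls0 : lebesgue_step set0 = 0%E.
Proof. exact: measure0. Qed.

Let ls_ge0 A : (0 <= lebesgue_step A)%E.
Proof. exact: measure_ge0. Qed.

Let ls_sigma_additive : semi_sigma_additive lebesgue_step.
Proof. exact: measure_semi_sigma_additive. Qed.

HB.instance Definition _ := isMeasure.Build _ _ _ lebesgue_step
  ls0 ls_ge0 ls_sigma_additive.

Let ls_sigma_finite : sigma_finite [set: vec R d.+1] lebesgue_step.
Proof.
have /sigma_finiteP[F [TF ndF Foo]] := sigma_finiteT (@lebesgue_measure R).
have /sigma_finiteP[G [TG ndG Goo]] := sigma_finiteT mu.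
pose g (t : vec R d.+1) : measurableTypeR R * vec R d :=
  (thead t, [tuple of behead t]).
have vK : cancel vcons g.
  by move=> [x y]; rewrite /g /vcons theadE; congr pair; apply/val_inj.
have mg : measurable_fun [set: vec R d.+1] g.
  apply/measurable_fun_pairP; split; first exact: measurable_tnth.
  exact: measurable_behead.
have FGT : \bigcup_n (F n `*` G n) = [set: measurableTypeR R * vec R d].
  rewrite -setXTT TF TG predeqE => -[x y]; split.
    by move=> [n _ []/= ? ?]; split; exists n.
  move=> [/= [n _ Fnx] [k _ Gky]]; exists (maxn n k) => //; split.
  - by move: x Fnx; exact/subsetPset/ndF/leq_maxl.
  - by move: y Gky; exact/subsetPset/ndG/leq_maxr.
exists (fun i => g @^-1` (F i `*` G i)).
  by rewrite -preimage_bigcup FGT preimage_setT.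
move=> i; have [mF Fi] := Foo i; have [mG Gi] := Goo i; split.
  by rewrite -[X in measurable X]setTI; apply: mg => //; exact: measurableX.
rewrite /lebesgue_step /pushforward -comp_preimage.
rewrite (_ : g \o vcons = id) ?preimage_id; last by apply/funext => x; exact: vK.
by rewrite product_measure1E// lte_mul_pinfty// ge0_fin_numE.
Qed.

HB.instance Definition _ := Measure_isSigmaFinite.Build _ _ _ lebesgue_step
  ls_sigma_finite.

End lebesgue_step.

(* Lebesgue measure on the Borel sets of R^d; see lebesgue_rect. *)
Fixpoint lebesgue (R : realType) (d : nat) :
    {sigma_finite_measure set (vec R d) -> \bar R} :=
  if d is d'.+1 then lebesgue_step (lebesgue R d') else dirac [tuple].

Lemma lebesgue_rect (R : realType) (d : nat) (A : 'I_d -> set (measurableTypeR R)) :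
  (forall i, measurable (A i)) ->
  lebesgue R d [set x : vec R d | forall i, A i (tnth x i)] =
  (\big[*%E/1]_(i < d) lebesgue_measure (A i))%E.
Proof.
elim: d => [|d IH] in A * => mA.
  by rewrite big_ord0 /= diracE mem_set //= => -[].
rewrite big_ord_recl -IH//= /lebesgue_step /pushforward.
rewrite -product_measure1E//=; last first.
  rewrite (_ : mkset _ =
    \bigcap_(i in [set: 'I_d]) ((@tnth d _)^~ i @^-1` A (lift ord0 i))).
    apply: fin_bigcap_measurable => // i _.
    by rewrite -[X in measurable X]setTI; exact: measurable_tnth.
  by apply/seteqP; split => x /= Ax i; [move=> _|]; exact: Ax.
congr product_measure1; apply/seteqP; split => -[x y] /=.
  move=> Axy; split; first exact: (Axy ord0).
  by move=> i; have := Axy (lift ord0 i); rewrite tnthS.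
by move=> [Ax Ay] i; case: (unliftP ord0 i) => [j|] ->; rewrite ?tnthS.
Qed.

Section vectors.
Context (R : realType) (d : nat).
Implicit Types (x y : vec R d) (k : d.-tuple int).

Definition vadd x y : vec R d := [tuple tnth x i + tnth y i | i < d].
Definition vopp x : vec R d := [tuple - tnth x i | i < d].
Definition vscale (a : R) x : vec R d := [tuple a * tnth x i | i < d].
Definition vdot x y : R := \sum_(i < d) tnth x i * tnth y i.
Definition vint k : vec R d := [tuple (tnth k i)%:~R | i < d].
Definition vord n (r : d.-tuple 'I_n) : vec R d :=
  [tuple (tnth r i : nat)%:R | i < d].

(* The half-open cube c + [0, l[^d. *)
Definition cube (c : vec R d) (l : R) : set (vec R d) :=
  [set x | forall i, tnth c i <= tnth x i < tnth c i + l].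

End vectors.

Section complex_functions.
Context (R : realType).

(* e^{2 pi i t} *)
Definition expi2pi (t : R) : R[i] :=
  (cos (2 * pi * t) +i* sin (2 * pi * t))%C.

Definition cmeasurable disp (T : measurableType disp) (f : T -> R[i]) : Prop :=
  measurable_fun [set: T] (fun x => complex.Re (f x) : measurableTypeR R) /\
  measurable_fun [set: T] (fun x => complex.Im (f x) : measurableTypeR R).

Definition cintegral disp (T : measurableType disp)
    (mu : {measure set T -> \bar R}) (f : T -> R[i]) : R[i] :=
  ((\int[mu]_x complex.Re (f x)) +i* (\int[mu]_x complex.Im (f x)))%C.

End complex_functions.

Section gabor.
Context (R : realType) (d : nat).
Implicit Types (f g h : vec R d -> R[i]) (a : R).

Definition sqnorm_on (D : set (vec R d)) f : \bar R :=
  (\int[lebesgue R d]_(x in D) ((Normc.normc (f x)) ^+ 2)%:E)%E.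

Definition sqnorm f : \bar R := sqnorm_on [set: vec R d] f.

(* Square-integrable functions; elements of L^2(R^d) are represented by Borel
   functions, not by classes modulo a.e. equality. *)
Definition L2 f : Prop := cmeasurable f /\ (sqnorm f < +oo)%E.

(* <f, h>, linear in f *)
Definition inner f h : R[i] :=
  cintegral (lebesgue R d) (fun x => f x * (h x)^*).

(* pi(x, xi) f *)
Definition tfshift (x xi : vec R d) f : vec R d -> R[i] :=
  fun t => expi2pi (vdot xi t) * f (vadd t (vopp x)).

Definition gabor_frame g (alpha beta : R) : Prop :=
  exists A B : R, [/\ 0 < A, 0 < B &
    forall f, L2 f ->
      let S := \esum_(l in [set: d.-tuple int * d.-tuple int])
        ((Normc.normc (inner f (tfshift (vscale alpha (vint R l.1))
                                        (vscale beta (vint R l.2)) g))) ^+ 2)%:E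
      in (A%:E * sqnorm f <= S <= B%:E * sqnorm f)%E].

(* Finite partial sums of the series defining the Zak transform. *)
Definition zak_sum a f (F : {fset d.-tuple int}) (x xi : vec R d) : R[i] :=
  \sum_(k <- F) f (vadd x (vopp (vscale a (vint R k))))
                * expi2pi (a * vdot (vint R k) xi).

(* Z is a representative of the Zak transform Z_a f: for a.e. x, the series
   converges to Z (x, .) in L^2 of every period cell (the series is a^-1-periodic
   in each coordinate of xi), unconditionally, i.e., along the finite subsets of
   Z^d ordered by inclusion. *)
Definition is_zak a f (Z : vec R d * vec R d -> R[i]) : Prop :=
  cmeasurable Z /\
  {ae lebesgue R d, forall x, forall c : vec R d,
    forall eps : R, 0 < eps ->
    exists F0 : {fset d.-tuple int}, forall F : {fset d.-tuple int},
      (F0 `<=` F)%fset ->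
      (sqnorm_on (cube c a^-1) (fun xi => Z (x, xi) - zak_sum a f F x xi)%R
         < eps%:E)%E}.

(* The Zak transform is only determined almost everywhere: this picks one
   jointly measurable representative. *)
Definition zak a f : vec R d * vec R d -> R[i] := xget (fun=> 0) (is_zak a f).

(* The index sets E_q = {0, ..., q - 1}^d and E_p are enumerated, which turns the
   matrix indexed by E_q x E_p into a q^d x p^d matrix. *)
Definition zak_matrix g (beta : R) (p q : nat) (x xi : vec R d) :
    'M[R[i]]_(#|{: d.-tuple 'I_q}|, #|{: d.-tuple 'I_p}|) :=
  \matrix_(r, s)
    zak beta^-1 g
      (vadd x (vscale (p%:R / (beta * q%:R)) (vord R (enum_val r))),
       vadd (vscale beta xi) (vscale (beta / p%:R) (vord R (enum_val s)))).

End gabor.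

Local Open Scope sesquilinear_scope.

Definition singular_values (C : numClosedFieldType) m n (M : 'M[C]_(m, n)) :
    set C :=
  [set sqrtC a | a in [set a | eigenvalue (M ^t* *m M) a]].

(* Main.v *)
(* Put a = 1/beta and let Zf be the Zak transform of f with parameter a, as a
   function of x and eta = beta * xi. Up to a constant, the inner product of f with
   the (k, l)-th time-frequency shift of g, where k = -(r + q m) and 0 <= r < q, is
   the (l, m)-th Fourier coefficient on a box of sides a and beta/p of
     H_r = sum_s F_s * conj Q_{r,s},   F_s (x, eta) = Zf (x, eta + (beta/p) s).
   Parseval's identity on the box gives sum_{k,l} |<f, g_{k,l}>|^2 = C sum_r |H_r|^2
   and |f|^2 = C' sum_s |F_s|^2, the norms on the right being L^2 norms over the
   box. Hence bounds for v |-> sum_r |sum_s v_s conj Q_{r,s}|^2 valid at almost every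
   point, that is bounds for the singular values of Q, yield frame bounds.
   Conversely, for every measurable part E of a box and every vector v, some f has
   fibers F_s = v_s on E and 0 off E; the frame inequality for f bounds the average
   of the quadratic form over E. As E is arbitrary the form is bounded almost
   everywhere, first for all v in a countable dense set, then for all v by
   continuity. *)
Require Import Defs.
From HB Require Import structures.
From mathcomp Require Import all_boot all_order all_algebra finmap.
From mathcomp Require Import complex.
From mathcomp Require Import all_classical all_reals all_analysis.
From mathcomp Require Import measurable_realfun.
From mathcomp Require Import ring lra.

Import Order.TTheory GRing.Theory Num.Theory.
Import numFieldNormedType.Exports.
Local Open Scope classical_set_scope.
Local Open Scope ring_scope.

Set Implicit Arguments.
Unset Strict Implicit.
Unset Printing Implicit Defensive.

(** A Zak transform is determined only almost everywhere, and [zak] picks a jointly measurable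
    representative, so everything rests on one existing. Convergence in L^2 of the frequency cell
    for each fixed x says nothing about joint measurability; the representative is therefore a
    pointwise limit along partial sums whose length depends on x. The converse prescribes the fibers
    and must produce f. The full [is_zak] speaks of almost every x and of every frequency cell,
    while the prescribed data live on one cell; hence the identities for f are stated for the weaker
    relation [zak_pair], which fixes Fourier coefficients over a single cell. Only norm identities
    are proved directly, from Parseval on cubes; inner products follow by polarization, which avoids
    exchanging double series. Parseval itself is built from dimension one: explicit trigonometric
    polynomials converge boundedly to indicators of arcs, and tensor products raise the dimension.
    The exponentials are left unnormalized. All volume factors together amount to (a/p)^d, the ratio
    between the frame bounds and the bounds for the squared singular values. *)

Local Notation cRe := complex.Re.
Local Notation cIm := complex.Im.

(** * Complex-valued square-integrable functions *)

Section complex_basics.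
Context {R : realType}.
Implicit Types z w : R[i].

(** The squared modulus as a polynomial in the real and imaginary parts, so that identities close by
    [ring] and the square root in [Normc.normc] disappears. *)
Definition sqc z : R := cRe z ^+ 2 + cIm z ^+ 2.

Lemma ReD z w : cRe (z + w) = cRe z + cRe w. Proof. by case: z; case: w. Qed.
Lemma ImD z w : cIm (z + w) = cIm z + cIm w. Proof. by case: z; case: w. Qed.
Lemma ReN z : cRe (- z) = - cRe z. Proof. by case: z. Qed.
Lemma ImN z : cIm (- z) = - cIm z. Proof. by case: z. Qed.
Lemma ReM z w : cRe (z * w) = cRe z * cRe w - cIm z * cIm w.
Proof. by case: z; case: w. Qed.
Lemma ImM z w : cIm (z * w) = cRe z * cIm w + cIm z * cRe w.
Proof. by case: z => a b; case: w. Qed.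
Lemma ReJ z : cRe z^* = cRe z. Proof. by case: z. Qed.
Lemma ImJ z : cIm z^* = - cIm z. Proof. by case: z. Qed.
Definition ReImE := (ReD, ImD, ReN, ImN, ReM, ImM, ReJ, ImJ).
Lemma ceqP z w : cRe z = cRe w -> cIm z = cIm w -> z = w.
Proof. by case: z => a b; case: w => c d /= -> ->. Qed.

Lemma normc_sqr z : Normc.normc z ^+ 2 = sqc z.
Proof. by case: z => a b; rewrite /sqc /= sqr_sqrtr// addr_ge0// sqr_ge0. Qed.
Lemma sqc_ge0 z : 0 <= sqc z. Proof. by rewrite addr_ge0// sqr_ge0. Qed.
Lemma sqc0 : sqc 0 = 0. Proof. by rewrite /sqc/= expr0n addr0. Qed.
Lemma sqc1 : sqc 1 = 1. Proof. by rewrite /sqc/= expr0n addr0 expr1n. Qed.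
Lemma sqcM z w : sqc (z * w) = sqc z * sqc w.
Proof. by rewrite /sqc !ReImE; ring. Qed.
Lemma sqcJ z : sqc z^* = sqc z. Proof. by rewrite /sqc !ReImE; ring. Qed.
Lemma sqcN z : sqc (- z) = sqc z. Proof. by rewrite /sqc !ReImE; ring. Qed.
Lemma sqcR (r : R) : sqc r%:C%C = r ^+ 2.
Proof. by rewrite /sqc/= expr0n addr0. Qed.
Lemma sqc_parallelogram z w : sqc (z + w) + sqc (z - w) = 2 * sqc z + 2 * sqc w.
Proof. by rewrite /sqc !ReImE; ring. Qed.
Lemma Re_mulJ z w : cRe (z * w^*) = (sqc (z + w) - sqc (z - w)) / 4.
Proof. by rewrite /sqc !ReImE; field. Qed.
Lemma Im_mulJ z w :
  cIm (z * w^*) = (sqc (z + 'i%C * w) - sqc (z - 'i%C * w)) / 4.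
Proof. by rewrite /sqc !ReImE /=; field. Qed.
Lemma absRe_mul_le z w : `|cRe (z * w)| <= sqc z + sqc w.
Proof.
rewrite ReM /sqc; case: z => a b; case: w => c d /=.
have := (sqr_ge0 (a - c), sqr_ge0 (a + c), sqr_ge0 (b - d), sqr_ge0 (b + d)).
by move=> [[[]]]; rewrite ler_norml !sqrrD !sqrrN !mulrN => *; apply/andP; split; nra.
Qed.
Lemma absIm_mul_le z w : `|cIm (z * w)| <= sqc z + sqc w.
Proof.
rewrite ImM /sqc; case: z => a b; case: w => c d /=.
have := (sqr_ge0 (a - d), sqr_ge0 (a + d), sqr_ge0 (b - c), sqr_ge0 (b + c)).
by move=> [[[]]]; rewrite ler_norml !sqrrD !sqrrN !mulrN => *; apply/andP; split; nra.
Qed.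

Lemma expi2piD (s t : R) : expi2pi (s + t) = expi2pi s * expi2pi t.
Proof.
by apply: ceqP; rewrite /expi2pi !ReImE/= mulrDr ?cosD ?sinD; ring.
Qed.
Lemma expi2piN (t : R) : expi2pi (- t) = (expi2pi t)^*.
Proof. by apply: ceqP; rewrite /expi2pi !ReImE/= mulrN ?cosN ?sinN. Qed.
Lemma expi2pi0 : expi2pi (0 : R) = 1.
Proof. by apply: ceqP; rewrite /= mulr0 ?cos0 ?sin0. Qed.
Lemma sqc_expi2pi (t : R) : sqc (expi2pi t) = 1.
Proof. by rewrite /sqc/= cos2Dsin2. Qed.
Lemma expi2pi_int (k : int) : expi2pi (k%:~R : R) = 1.
Proof.
have H (n : nat) : expi2pi (n%:R : R) = 1.
  elim: n => [|n IH]; first exact: expi2pi0.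
  rewrite -natr1 expi2piD IH mul1r; apply: ceqP; rewrite /= mulr1.
    by rewrite mulr_natl cos2pi.
  by rewrite mulr_natl sin2pi.
case: k => n; first exact: H.
by rewrite NegzE mulrNz expi2piN -pmulrn H; apply: ceqP; rewrite !ReImE/= ?oppr0.
Qed.
End complex_basics.

Section cmeasurable.
Context {R : realType} d (T : measurableType d).
Implicit Types f g : T -> R[i].

Lemma cmeasurable_cst (c : R[i]) : cmeasurable (fun _ : T => c).
Proof. by split; exact: measurable_cst. Qed.
Lemma cmeasurableD f g : cmeasurable f -> cmeasurable g ->
  cmeasurable (fun x => f x + g x).
Proof.
move=> [? ?] [? ?]; split.
  by under eq_fun do rewrite ReD; exact: measurable_funD.
by under eq_fun do rewrite ImD; exact: measurable_funD.
Qed.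
Lemma cmeasurableN f : cmeasurable f -> cmeasurable (fun x => - f x).
Proof.
move=> [? ?]; split.
  by under eq_fun do rewrite ReN; exact: measurableT_comp.
by under eq_fun do rewrite ImN; exact: measurableT_comp.
Qed.
Lemma cmeasurableB f g : cmeasurable f -> cmeasurable g ->
  cmeasurable (fun x => f x - g x).
Proof. by move=> mf mg; apply: cmeasurableD => //; exact: cmeasurableN. Qed.
Lemma cmeasurableM f g : cmeasurable f -> cmeasurable g ->
  cmeasurable (fun x => f x * g x).
Proof.
move=> [? ?] [? ?]; split.
  by under eq_fun do rewrite ReM; apply: measurable_funB; exact: measurable_funM.
by under eq_fun do rewrite ImM; apply: measurable_funD; exact: measurable_funM.
Qed.
Lemma cmeasurableJ f : cmeasurable f -> cmeasurable (fun x => (f x)^*).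
Proof.
move=> [? ?]; split.
  by under eq_fun do rewrite ReJ.
by under eq_fun do rewrite ImJ; exact: measurableT_comp.
Qed.
Lemma cmeasurableR (f : T -> measurableTypeR R) : measurable_fun setT f ->
  cmeasurable (fun x => (f x)%:C%C).
Proof. by move=> mf; split => //; exact: measurable_cst. Qed.
Lemma cmeasurable_sum (I : Type) (r : seq I) (P : pred I) (F : I -> T -> R[i]) :
  (forall i, cmeasurable (F i)) -> cmeasurable (fun x => \sum_(i <- r | P i) F i x).
Proof.
move=> mF; elim: r => [|i r IH].
  by under eq_fun do rewrite big_nil; exact: cmeasurable_cst.
under eq_fun do rewrite big_cons.
by case: (P i) => //; apply: cmeasurableD.
Qed.
Lemma cmeasurable_comp d' (U : measurableType d') (f : T -> R[i]) (h : U -> T) :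
  cmeasurable f -> measurable_fun setT h -> cmeasurable (fun x => f (h x)).
Proof.
move=> [m1 m2] mh; split; first exact: (measurableT_comp m1 mh).
exact: (measurableT_comp m2 mh).
Qed.
Lemma cmeasurable_expi2pi (h : T -> measurableTypeR R) : measurable_fun setT h ->
  cmeasurable (fun x => expi2pi (h x)).
Proof.
move=> mh; have mh2 : measurable_fun setT (fun x => 2 * pi * h x : measurableTypeR R).
  exact: measurable_funM.
split => /=.
  apply: measurableT_comp mh2; apply: continuous_measurable_fun; exact: continuous_cos.
apply: measurableT_comp mh2; apply: continuous_measurable_fun; exact: continuous_sin.
Qed.
Lemma measurable_sqc f : cmeasurable f ->
  measurable_fun setT (fun x => sqc (f x) : measurableTypeR R).
Proof.
by move=> [? ?]; apply: measurable_funD; exact: measurable_funX.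
Qed.
Lemma emeasurable_sqc f : cmeasurable f ->
  measurable_fun setT (fun x => (sqc (f x))%:E).
Proof. by move=> /measurable_sqc; move/measurable_EFinP. Qed.
End cmeasurable.

Section cintegral.
Context {R : realType} d (T : measurableType d) (mu : {measure set T -> \bar R}).
Implicit Types f g : T -> R[i].

Definition cintegrable f :=
  mu.-integrable setT (fun x => (cRe (f x))%:E) /\
  mu.-integrable setT (fun x => (cIm (f x))%:E).

Lemma cintegrable_cmeas f : cintegrable f -> cmeasurable f.
Proof.
by move=> [/measurable_int/measurable_EFinP m1 /measurable_int/measurable_EFinP m2].
Qed.

Lemma cintegrableD f g : cintegrable f -> cintegrable g ->
  cintegrable (fun x => f x + g x).
Proof.
move=> [? ?] [? ?]; split.
  by under eq_fun do rewrite ReD EFinD; exact: integrableD.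
by under eq_fun do rewrite ImD EFinD; exact: integrableD.
Qed.
Lemma cintegralD f g : cintegrable f -> cintegrable g ->
  cintegral mu (fun x => f x + g x) = cintegral mu f + cintegral mu g.
Proof.
move=> [? ?] [? ?]; rewrite /cintegral; apply: ceqP => /=.
  by under eq_Rintegral do rewrite ReD; rewrite RintegralD.
by under eq_Rintegral do rewrite ImD; rewrite RintegralD.
Qed.
Lemma cintegrableZ (c : R[i]) f : cintegrable f -> cintegrable (fun x => c * f x).
Proof.
move=> [if1 if2]; split.
  under eq_fun do rewrite ReM EFinB !EFinM.
  by apply: integrableB => //; exact: integrableZl.
under eq_fun do rewrite ImM EFinD !EFinM.
by apply: integrableD => //; exact: integrableZl.
Qed.
Lemma cintegralZ (c : R[i]) f : cintegrable f ->
  cintegral mu (fun x => c * f x) = c * cintegral mu f.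
Proof.
move=> [if1 if2].
have iZ (r : R) (u : T -> R) : mu.-integrable setT (fun x => (u x)%:E) ->
    mu.-integrable setT (EFin \o (fun x => r * u x)).
  by move=> /(integrableZl measurableT r); apply: eq_integrable.
rewrite /cintegral; apply: ceqP; rewrite !ReImE/=.
  under eq_Rintegral do rewrite ReM.
  by rewrite RintegralB ?RintegralZl//; exact: iZ.
under eq_Rintegral do rewrite ImM.
by rewrite RintegralD ?RintegralZl//; exact: iZ.
Qed.
Lemma cintegrableN f : cintegrable f -> cintegrable (fun x => - f x).
Proof. by move/(@cintegrableZ (-1)); under eq_fun do rewrite mulN1r. Qed.
Lemma cintegralN f : cintegrable f ->
  cintegral mu (fun x => - f x) = - cintegral mu f.
Proof.
move=> fi; rewrite -mulN1r -cintegralZ//; congr cintegral.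
by apply/funext => x; rewrite mulN1r.
Qed.
Lemma cintegralB f g : cintegrable f -> cintegrable g ->
  cintegral mu (fun x => f x - g x) = cintegral mu f - cintegral mu g.
Proof. by move=> fi gi; rewrite cintegralD ?cintegralN//; exact: cintegrableN. Qed.

Lemma cintegrable_le f (g : T -> R) : cmeasurable f ->
  mu.-integrable setT (EFin \o g) ->
  (forall x, `|cRe (f x)| <= g x) -> (forall x, `|cIm (f x)| <= g x) ->
  cintegrable f.
Proof.
move=> [m1 m2] ig h1 h2; split; apply: le_integrable ig => //=;
  try exact/measurable_EFinP; move=> x _; rewrite lee_fin.
  by apply: (le_trans (h1 x)); exact: ler_norm.
by apply: (le_trans (h2 x)); exact: ler_norm.
Qed.

Definition nrm2 f : \bar R := (\int[mu]_x (sqc (f x))%:E)%E.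
Definition L2m f := cmeasurable f /\ (nrm2 f < +oo)%E.

Lemma nrm2_ge0 f : (0 <= nrm2 f)%E.
Proof. by apply: integral_ge0 => x _; rewrite lee_fin sqc_ge0. Qed.
Lemma nrm2_fin f : L2m f -> nrm2 f \is a fin_num.
Proof. by move=> [_ ?]; rewrite ge0_fin_numE// nrm2_ge0. Qed.
Lemma L2m_integrable f : L2m f -> mu.-integrable setT (fun x => (sqc (f x))%:E).
Proof.
move=> [mf fi]; apply/integrableP; split; first exact: emeasurable_sqc.
by under eq_integral do rewrite gee0_abs ?lee_fin ?sqc_ge0//.
Qed.
Lemma eq_nrm2 f g : (forall x, sqc (f x) = sqc (g x)) -> nrm2 f = nrm2 g.
Proof. by move=> h; apply: eq_integral => x _; rewrite h. Qed.
Lemma le_nrm2 f g : cmeasurable f -> cmeasurable g ->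
  (forall x, sqc (f x) <= sqc (g x)) -> (nrm2 f <= nrm2 g)%E.
Proof.
move=> mf mg h; apply: ge0_le_integral => //.
- by move=> x _; rewrite lee_fin sqc_ge0.
- exact: emeasurable_sqc.
- exact: emeasurable_sqc.
- by move=> x _; rewrite lee_fin.
Qed.
Lemma L2m_le f g : cmeasurable f -> (forall x, sqc (f x) <= sqc (g x)) ->
  L2m g -> L2m f.
Proof. by move=> mf h [mg gi]; split => //; apply: le_lt_trans gi; exact: le_nrm2. Qed.
Lemma nrm2Z (c : R[i]) f : cmeasurable f ->
  nrm2 (fun x => c * f x) = ((sqc c)%:E * nrm2 f)%E.
Proof.
move=> mf; rewrite /nrm2; under eq_integral do rewrite sqcM EFinM.
rewrite ge0_integralZl// ?lee_fin ?sqc_ge0//; first exact: emeasurable_sqc.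
by move=> x _; rewrite lee_fin sqc_ge0.
Qed.
Lemma L2mZ (c : R[i]) f : L2m f -> L2m (fun x => c * f x).
Proof.
move=> [mf fi]; split; first by apply: cmeasurableM => //; exact: cmeasurable_cst.
by rewrite nrm2Z// lte_mul_pinfty// ?lee_fin ?sqc_ge0.
Qed.
(** Stated in the extended reals for all measurable functions, so that it also shows that sums of
    square-integrable functions are square-integrable. *)
Lemma nrm2_parallelogram f g : cmeasurable f -> cmeasurable g ->
  (nrm2 (fun x => f x + g x)%R + nrm2 (fun x => f x - g x)%R =
   2%:E * nrm2 f + 2%:E * nrm2 g)%E.
Proof.
move=> mf mg.
rewrite /nrm2 -!ge0_integralZl//; try exact: emeasurable_sqc;
  try by move=> x _; rewrite lee_fin sqc_ge0.
rewrite -!ge0_integralD//; try (by move=> x _; rewrite ?lee_fin ?sqc_ge0//;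
    rewrite mule_ge0// lee_fin sqc_ge0).
- by apply: eq_integral => x _; rewrite -!EFinM -!EFinD sqc_parallelogram.
- by move=> x _; rewrite mule_ge0// lee_fin sqc_ge0.
- by apply: measurable_funeM; exact: emeasurable_sqc.
- by move=> x _; rewrite mule_ge0// lee_fin sqc_ge0.
- by apply: measurable_funeM; exact: emeasurable_sqc.
- by apply: emeasurable_sqc; exact: cmeasurableD.
- by apply: emeasurable_sqc; exact: cmeasurableB.
Qed.
Lemma L2mD f g : L2m f -> L2m g -> L2m (fun x => f x + g x).
Proof.
move=> [mf fi] [mg gi]; split; first exact: cmeasurableD.
apply: (@le_lt_trans _ _ (2%:E * nrm2 f + 2%:E * nrm2 g)%E); last first.
  by rewrite lte_add_pinfty// lte_mul_pinfty// lee_fin.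
by rewrite -nrm2_parallelogram// leeDl// nrm2_ge0.
Qed.
Lemma L2mN f : L2m f -> L2m (fun x => - f x).
Proof. by move=> /(@L2mZ (-1)); under eq_fun do rewrite mulN1r. Qed.
Lemma L2mB f g : L2m f -> L2m g -> L2m (fun x => f x - g x).
Proof. by move=> fi gi; apply: L2mD => //; exact: L2mN. Qed.
Lemma L2mJ f : L2m f -> L2m (fun x => (f x)^*).
Proof.
move=> h; apply: (@L2m_le _ f) => //; last by move=> x; rewrite sqcJ.
by apply: cmeasurableJ; case: h.
Qed.
Lemma L2m0 : L2m (fun=> 0).
Proof.
split; first exact: cmeasurable_cst.
by rewrite /nrm2; under eq_integral do rewrite sqc0; rewrite integral0.
Qed.
Lemma L2m_sum (I : Type) (r : seq I) (P : pred I) (F : I -> T -> R[i]) :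
  (forall i, L2m (F i)) -> L2m (fun x => \sum_(i <- r | P i) F i x).
Proof.
move=> mF; elim: r => [|i r IH].
  by under eq_fun do rewrite big_nil; exact: L2m0.
under eq_fun do rewrite big_cons.
by case: (P i) => //; apply: L2mD.
Qed.
Lemma L2mM_cintegrable f g : L2m f -> L2m g -> cintegrable (fun x => f x * g x).
Proof.
move=> fi gi; have [mf _] := fi; have [mg _] := gi.
apply: (@cintegrable_le _ (fun x => sqc (f x) + sqc (g x))).
- exact: cmeasurableM.
- apply: (@eq_integrable _ _ _ mu _ measurableT
    (fun x => (sqc (f x))%:E + (sqc (g x))%:E)%E) => //.
  by apply: integrableD => //; exact: L2m_integrable.
- by move=> x; exact: absRe_mul_le.
- by move=> x; exact: absIm_mul_le.
Qed.

(* Polarization turns an identity between norms into one between inner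
   products. *)
Lemma cintegral_polar f g : L2m f -> L2m g ->
  cintegral mu (fun x => f x * (g x)^*) =
  (((fine (nrm2 (fun x => f x + g x)) - fine (nrm2 (fun x => f x - g x))) / 4) +i*
   ((fine (nrm2 (fun x => f x + 'i%C * g x)) -
     fine (nrm2 (fun x => f x - 'i%C * g x))) / 4))%C.
Proof.
move=> fi gi; rewrite /cintegral; congr Complex.
  under eq_Rintegral do rewrite Re_mulJ mulrC.
  have hD := L2mD fi gi; have hB := L2mB fi gi.
  rewrite RintegralZl// ?RintegralB//; last 3 first.
  - exact: L2m_integrable.
  - exact: L2m_integrable.
  - apply: eq_integrable (integrableB measurableT (L2m_integrable hD)
      (L2m_integrable hB)) => // x _ /=.
  by rewrite mulrC.
under eq_Rintegral do rewrite Im_mulJ mulrC.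
have gi' := L2mZ 'i%C gi; have hD := L2mD fi gi'; have hB := L2mB fi gi'.
rewrite RintegralZl// ?RintegralB//; last 3 first.
- exact: L2m_integrable.
- exact: L2m_integrable.
- apply: eq_integrable (integrableB measurableT (L2m_integrable hD)
    (L2m_integrable hB)) => // x _ /=.
by rewrite mulrC.
Qed.
End cintegral.

Section complex_indicator.
Context {R : realType} d (T : measurableType d) (mu : {measure set T -> \bar R}).

Definition cind (A : set T) (x : T) : R[i] := (\1_A x)%:C%C.

Lemma sqc_cind A x : sqc (cind A x) = \1_A x.
Proof. by rewrite /cind sqcR indicE; case: (_ \in _); rewrite ?expr1n ?expr0n. Qed.
Lemma cmeasurable_cind A : measurable A -> cmeasurable (cind A).
Proof. by move=> mA; apply: cmeasurableR; exact: measurable_indic. Qed.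
Lemma nrm2_indic (f : T -> R[i]) A : measurable A ->
  (forall x, sqc (f x) = \1_A x) -> nrm2 mu f = mu A.
Proof.
move=> mA h; rewrite /nrm2; under eq_integral do rewrite h.
by rewrite integral_indic// setIT.
Qed.
Lemma L2m_indic (f : T -> R[i]) A : measurable A -> (mu A < +oo)%E ->
  cmeasurable f -> (forall x, sqc (f x) = \1_A x) -> L2m mu f.
Proof. by move=> mA fA mf h; split => //; rewrite (nrm2_indic mA h). Qed.
Lemma cindT A x : A x -> cind A x = 1.
Proof. by move=> Ax; rewrite /cind indicE mem_set. Qed.
Lemma cindF A x : ~ A x -> cind A x = 0.
Proof. by move=> Ax; rewrite /cind indicE memNset. Qed.
Lemma ae_eq_cintegral (f g : T -> R[i]) : cmeasurable f -> cmeasurable g ->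
  {ae mu, forall x, f x = g x} -> cintegral mu f = cintegral mu g.
Proof.
move=> [f1 f2] [g1 g2] h; rewrite /cintegral; congr Complex; rewrite /Rintegral;
  congr fine; apply: ae_eq_integral => //; try exact/measurable_EFinP;
  by apply: filterS h => x -> _.
Qed.
End complex_indicator.

(** * Unordered sums over countable types and their exchange with integrals *)

Section esum_countable.
Context {R : realType}.
Local Open Scope ereal_scope.

(** Enumerating the index type by its codes, with value 0 at numbers that code nothing, turns an
    unordered sum into a series, for which measurability and monotone convergence are known. *)
Lemma esum_nneseries (I : countType) (a : I -> \bar R) : (forall i, 0 <= a i) ->
  \esum_(i in [set: I]) a i = \sum_(n <oo) oapp a 0 (pickle_inv n).
Proof.
move=> a0; rewrite nneseries_esumT; last first.
  by move=> n; case: (pickle_inv n) => //=.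
transitivity (\esum_(n in (@choice.pickle I) @` [set: I]) oapp a 0 (pickle_inv n)).
  rewrite esum_image; last by move=> x y _ _; exact: (pcan_inj (@choice.pickleK I)).
  by apply: eq_esum => i _; rewrite pickleK_inv.
rewrite esum_mkcond; apply: eq_esum => n _; case: ifPn => //.
rewrite notin_setE => hn; case E : (pickle_inv n) => [i|]//=.
exfalso; apply: hn; exists i => //.
by have := @pickle_invK I n; rewrite /ocancel E.
Qed.

Lemma emeasurable_esum d (T : measurableType d) (I : countType)
    (f : I -> T -> \bar R) :
  (forall i, measurable_fun setT (f i)) -> (forall i x, 0 <= f i x) ->
  measurable_fun setT (fun x => \esum_(i in [set: I]) f i x).
Proof.
move=> mf f0; under eq_fun do rewrite esum_nneseries//.
apply: ge0_emeasurable_sum => [n x _ _|n _]; case: (pickle_inv n) => //=.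
Qed.

Lemma integral_esum d (T : measurableType d) (mu : {measure set T -> \bar R})
    (I : countType) (f : I -> T -> \bar R) :
  (forall i, measurable_fun setT (f i)) -> (forall i x, 0 <= f i x) ->
  \int[mu]_x (\esum_(i in [set: I]) f i x) =
  \esum_(i in [set: I]) (\int[mu]_x f i x).
Proof.
move=> mf f0; under eq_integral do rewrite esum_nneseries//.
rewrite esum_nneseries; last by move=> i; apply: integral_ge0 => x _.
rewrite integral_nneseries//; last 2 first.
- by move=> n; case: (pickle_inv n).
- by move=> n x _; case: (pickle_inv n) => //=.
apply: eq_eseriesr => n _; case: (pickle_inv n) => //=.
by rewrite integral0.
Qed.

Lemma esum_seqP (I : choiceType) (a : I -> \bar R) M : (forall i, 0 <= a i) ->
  (forall s : seq I, uniq s -> \sum_(i <- s) a i <= M) ->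
  \esum_(i in [set: I]) a i <= M.
Proof.
move=> a0 h; apply: ge_ereal_sup => _ [X [finX _]] <-.
by rewrite fsbig_finite//=; apply: h; exact: fset_uniq.
Qed.

Lemma ge_esum_seq (I : choiceType) (a : I -> \bar R) (s : seq I) :
  (forall i, 0 <= a i) -> uniq s ->
  \sum_(i <- s) a i <= \esum_(i in [set: I]) a i.
Proof.
move=> a0 us; apply: esum_ge; exists [set` s].
  by split => //; exact: finite_seq.
by rewrite fsbig_seq.
Qed.

Lemma ge0_esumZ (I : countType) (a : I -> \bar R) (k : R) :
  (0 <= k)%R -> (forall i, 0 <= a i) ->
  \esum_(i in [set: I]) (k%:E * a i) = k%:E * \esum_(i in [set: I]) a i.
Proof.
move=> k0 a0; rewrite !esum_nneseries//; last by move=> i; rewrite mule_ge0.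
rewrite -nneseriesZl//; last by move=> n _; case: (pickle_inv n) => //=.
by apply: eq_eseriesr => n _; case: (pickle_inv n) => //=; rewrite mule0.
Qed.

End esum_countable.

(** * Parseval systems *)

Section orthogonal_system.
Context {R : realType} d (T : measurableType d) (mu : {measure set T -> \bar R}).
Variables (W : set T) (v : R) (I : countType) (e : I -> T -> R[i]).
Hypothesis (mW : measurable W) (muW : mu W = v%:E) (v0 : 0 < v).
Hypothesis me : forall i, cmeasurable (e i).
Hypothesis e1 : forall i x, sqc (e i x) = \1_W x.

(** Unnormalized coefficients: each [e i] has squared norm v = mu W, so Bessel and Parseval carry a
    factor v. *)
Definition fcoef (h : T -> R[i]) i := cintegral mu (fun x => h x * (e i x)^*).
Definition fsum h : \bar R := \esum_(i in [set: I]) (sqc (fcoef h i))%:E.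

Lemma L2m_e i : L2m mu (e i).
Proof.
split => //; rewrite /nrm2; under eq_integral do rewrite e1.
by rewrite integral_indic// setIT muW ltry.
Qed.
Lemma nrm2_e i : nrm2 mu (e i) = v%:E.
Proof.
rewrite /nrm2; under eq_integral do rewrite e1.
by rewrite integral_indic// setIT muW.
Qed.
Lemma cintegrable_coef h i : L2m mu h -> cintegrable mu (fun x => h x * (e i x)^*).
Proof. by move=> hi; apply: L2mM_cintegrable => //; apply: L2mJ; exact: L2m_e. Qed.
Lemma fcoefD f g i : L2m mu f -> L2m mu g ->
  fcoef (fun x => f x + g x) i = fcoef f i + fcoef g i.
Proof.
move=> fi gi; rewrite -cintegralD//; try exact: cintegrable_coef.
by congr cintegral; apply/funext => x; rewrite mulrDl.
Qed.
Lemma fcoefZ c f i : L2m mu f -> fcoef (fun x => c * f x) i = c * fcoef f i.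
Proof.
move=> fi; rewrite -cintegralZ//; last exact: cintegrable_coef.
by congr cintegral; apply/funext => x; rewrite mulrA.
Qed.
Lemma fcoefB f g i : L2m mu f -> L2m mu g ->
  fcoef (fun x => f x - g x) i = fcoef f i - fcoef g i.
Proof.
move=> fi gi; rewrite -cintegralB//; try exact: cintegrable_coef.
by congr cintegral; apply/funext => x; rewrite mulrBl.
Qed.
Lemma fcoef_ee i : fcoef (e i) i = v%:C%C.
Proof.
rewrite /fcoef /cintegral; apply: ceqP => /=.
  under eq_Rintegral => x _.
    have -> : cRe (e i x * (e i x)^*) = sqc (e i x).
      by rewrite /sqc !ReImE; ring.
    over.
  by have := nrm2_e i; rewrite /nrm2 /Rintegral => ->.
under eq_Rintegral => x _.
  have -> : cIm (e i x * (e i x)^*) = 0 by rewrite !ReImE; ring.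
  over.
by rewrite Rintegral_cst// mul0r.
Qed.
Lemma fsum_ge0 h : (0 <= fsum h)%E.
Proof. by apply: esum_ge0 => i _; rewrite lee_fin sqc_ge0. Qed.
Lemma fsum_parallelogram f g : L2m mu f -> L2m mu g ->
  (fsum (fun x => f x + g x)%R + fsum (fun x => f x - g x)%R =
   2%:E * fsum f + 2%:E * fsum g)%E.
Proof.
move=> fi gi; rewrite /fsum -!ge0_esumZ//; try by move=> i; rewrite lee_fin sqc_ge0.
rewrite -!esumD//; try (by move=> i _; rewrite ?mule_ge0// lee_fin sqc_ge0).
apply: eq_esum => i _; rewrite fcoefD// fcoefB// -!EFinM -!EFinD.
by rewrite sqc_parallelogram.
Qed.
Lemma fsumZ c f : L2m mu f -> fsum (fun x => c * f x) = ((sqc c)%:E * fsum f)%E.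
Proof.
move=> fi; rewrite /fsum -ge0_esumZ//; last 2 first.
- exact: sqc_ge0.
- by move=> i; rewrite lee_fin sqc_ge0.
by apply: eq_esum => i _; rewrite fcoefZ// sqcM EFinM.
Qed.

Hypothesis orth : forall i j, i != j -> fcoef (e i) j = 0.

Lemma nrm2_sub_proj h i : L2m mu h ->
  nrm2 mu (fun x => h x - v^-1%:C%C * fcoef h i * e i x) =
  (nrm2 mu h - (v^-1 * sqc (fcoef h i))%:E)%E.
Proof.
move=> hi; set k := (v^-1%:C%C * fcoef h i).
have ki : L2m mu (fun x => k * e i x) by apply: L2mZ; exact: L2m_e.
have fi : cintegrable mu (fun x => - 2%:R * k^* * (h x * (e i x)^*)).
  by apply: cintegrableZ; exact: cintegrable_coef.
have E x : sqc (h x - k * e i x) = sqc (h x) + sqc (k * e i x)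
    + cRe (- 2%:R * k^* * (h x * (e i x)^*)).
  by rewrite /sqc !ReImE /=; ring.
rewrite -(fineK (nrm2_fin (L2mB hi ki))) -(fineK (nrm2_fin hi)) -EFinB.
congr EFin.
have -> : fine (nrm2 mu (fun x => h x - k * e i x)) =
    \int[mu]_x (sqc (h x) + sqc (k * e i x) + cRe (- 2%:R * k^* * (h x * (e i x)^*))).
  by rewrite /Rintegral; congr fine; apply: eq_integral => x _; rewrite E.
have i1 := L2m_integrable hi; have i2 := L2m_integrable ki.
have i12 : mu.-integrable setT (EFin \o (fun x => sqc (h x) + sqc (k * e i x))).
  by apply: eq_integrable (integrableD measurableT i1 i2).
rewrite RintegralD//; last by case: fi.
rewrite RintegralD//.
have -> : \int[mu]_x sqc (k * e i x) = sqc k * v.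
  have := nrm2Z mu k (me i); rewrite nrm2_e /nrm2 /Rintegral => ->.
  by rewrite -EFinM.
have -> : \int[mu]_x cRe (- 2%:R * k^* * (h x * (e i x)^*)) =
    cRe (- 2%:R * k^* * fcoef h i).
  by rewrite /fcoef -cintegralZ//; exact: cintegrable_coef.
have -> : \int[mu]_x sqc (h x) = fine (nrm2 mu h) by [].
rewrite -addrA; congr (_ + _); rewrite /k sqcM sqcR /sqc !ReImE/= ; field.
by rewrite gt_eqF.
Qed.

(** Induction on a finite list of indices: subtracting the projection onto [e i] lowers the squared
    norm by the i-th term and, by orthogonality, leaves the remaining coefficients unchanged. *)
Lemma bessel h : L2m mu h -> (fsum h <= v%:E * nrm2 mu h)%E.
Proof.
move=> hi; apply: esum_seqP; first by move=> i; rewrite lee_fin sqc_ge0.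
move=> s; elim: s h hi => [|i s IH] h hi.
  by rewrite big_nil mule_ge0 ?lee_fin ?nrm2_ge0// ltW.
move=> /= /andP[nis us]; rewrite big_cons.
set k := (v^-1%:C%C * fcoef h i).
have ki : L2m mu (fun x => k * e i x) by apply: L2mZ; exact: L2m_e.
have := IH _ (L2mB hi ki) us; rewrite nrm2_sub_proj//.
have -> : (\sum_(j <- s) (sqc (fcoef (fun x => h x - k * e i x)%R j))%:E =
    \sum_(j <- s) (sqc (fcoef h j))%:E)%E.
  rewrite big_seq [RHS]big_seq; apply: eq_bigr => j js.
  rewrite fcoefB// fcoefZ; last exact: L2m_e.
  by rewrite orth ?mulr0 ?subr0//; apply: contraNneq nis => ->.
move: (fineK (nrm2_fin hi)) => <-; rewrite -EFinB -!EFinM sumEFin -EFinD !lee_fin.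
rewrite mulrBr mulrA divff ?gt_eqF// mul1r.
by rewrite lerBrDr addrC.
Qed.

Lemma fsum_fin h : L2m mu h -> fsum h \is a fin_num.
Proof.
move=> hi; rewrite ge0_fin_numE ?fsum_ge0//; apply: le_lt_trans (bessel hi) _.
by rewrite lte_mul_pinfty// ?lee_fin ?ltW//; case: hi.
Qed.

(* The defect in Bessel's inequality is a nonnegative quadratic form, so its zero
   set is a closed subspace. *)
Definition defect h : R := v * fine (nrm2 mu h) - fine (fsum h).

Lemma defect_ge0 h : L2m mu h -> 0 <= defect h.
Proof.
move=> hi; rewrite subr_ge0 -lee_fin EFinM !fineK; first exact: bessel.
  exact: nrm2_fin.
exact: fsum_fin.
Qed.
Lemma defect_parallelogram f g : L2m mu f -> L2m mu g ->
  defect (fun x => f x + g x) + defect (fun x => f x - g x) =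
  2 * defect f + 2 * defect g.
Proof.
move=> fi gi; have [mf _] := fi; have [mg _] := gi.
have fD := L2mD fi gi; have fB := L2mB fi gi.
have := nrm2_parallelogram mu mf mg; have := fsum_parallelogram fi gi.
move: (fineK (fsum_fin fi)) (fineK (fsum_fin gi)) (fineK (fsum_fin fD))
  (fineK (fsum_fin fB)) => <- <- <- <-.
move: (fineK (nrm2_fin fi)) (fineK (nrm2_fin gi)) (fineK (nrm2_fin fD))
  (fineK (nrm2_fin fB)) => <- <- <- <-.
rewrite -!EFinM -!EFinD => -[h1] -[h2]; rewrite /defect.
move: h1 h2; do 8 move: (fine _) => ?.
by move=> /(canRL (addrK _)) -> /(canRL (addrK _)) ->; ring.
Qed.
Lemma defectZ c f : L2m mu f -> defect (fun x => c * f x) = sqc c * defect f.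
Proof.
move=> fi; have [mf _] := fi; rewrite /defect nrm2Z// fsumZ//.
move: (fineK (fsum_fin fi)) (fineK (nrm2_fin fi)) => <- <-; rewrite -!EFinM/=.
by ring.
Qed.
Lemma defect_e i : defect (e i) = 0.
Proof.
have ei := L2m_e i.
suff E : fsum (e i) = (v ^+ 2)%:E by rewrite /defect E nrm2_e/=; ring.
rewrite /fsum; apply/eqP; rewrite eq_le; apply/andP; split.
  by have := bessel ei; rewrite nrm2_e -EFinM.
have := @ge_esum_seq R I (fun j => (sqc (fcoef (e i) j))%:E) [:: i].
rewrite big_cons big_nil fcoef_ee sqcR adde0; apply => //.
by move=> j; rewrite lee_fin sqc_ge0.
Qed.

Definition complete_at h := L2m mu h /\ defect h = 0.

(** The defects of f + g and f - g are nonnegative and add up to 0 by the parallelogram identity. *)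
Lemma complete_atD f g : complete_at f -> complete_at g ->
  complete_at (fun x => f x + g x).
Proof.
move=> [fi f0] [gi g0]; have fgi := L2mD fi gi; split => //.
have := defect_parallelogram fi gi; rewrite f0 g0.
rewrite mulr0 addr0 => /eqP; rewrite paddr_eq0 ?defect_ge0//; last exact: L2mB.
by move=> /andP[/eqP].
Qed.
Lemma complete_atZ c f : complete_at f -> complete_at (fun x => c * f x).
Proof. by move=> [fi f0]; split; [exact: L2mZ|rewrite defectZ// f0 mulr0]. Qed.
Lemma complete_atB f g : complete_at f -> complete_at g ->
  complete_at (fun x => f x - g x).
Proof.
move=> fi /(@complete_atZ (-1)) gi; have := complete_atD fi gi.
by under eq_fun do rewrite mulN1r.
Qed.
Lemma complete_at0 : complete_at (fun=> 0).
Proof.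
split; first exact: L2m0.
have := defectZ 0 (@L2m0 _ _ _ mu); under eq_fun do rewrite mul0r.
by rewrite sqc0 mul0r.
Qed.
Lemma complete_at_sum (J : Type) (r : seq J) (P : pred J) (F : J -> T -> R[i]) :
  (forall j, P j -> complete_at (F j)) -> complete_at (fun x => \sum_(j <- r | P j) F j x).
Proof.
move=> mF; elim: r => [|i r IH].
  by under eq_fun do rewrite big_nil; exact: complete_at0.
under eq_fun do rewrite big_cons.
by case E : (P i) => //; apply: complete_atD => //; exact: mF.
Qed.
Lemma complete_at_e i : complete_at (e i).
Proof. by split; [exact: L2m_e|exact: defect_e]. Qed.

Lemma complete_at_closed h : L2m mu h ->
  (forall eps, 0 < eps -> exists2 g, complete_at g &
     fine (nrm2 mu (fun x => h x - g x)) < eps) ->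
  complete_at h.
Proof.
move=> hi H; split => //; apply/eqP; rewrite eq_le defect_ge0// andbT.
apply/ler_addgt0Pl => eps eps0; rewrite addr0.
(* Writing h = (h - g) + g, the parallelogram identity gives defect h <= 2 defect (h - g) <= 2 v |h
   - g|^2, whence the tolerance eps / (2 v). *)
have [|g [gi g0] hg] := H (eps / (2 * v)); first by rewrite divr_gt0// mulr_gt0.
have hgi := L2mB hi gi.
have := defect_parallelogram hgi gi; rewrite g0.
rewrite (_ : (fun x => h x - g x + g x) = h); last first.
  by apply/funext => x; rewrite subrK.
have := defect_ge0 (L2mB hgi gi).
have : defect (fun x => h x - g x) <= v * fine (nrm2 mu (fun x => h x - g x)).
  by rewrite /defect gerBl fine_ge0// fsum_ge0.
have : v * fine (nrm2 mu (fun x => h x - g x)) <= eps / 2.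
  rewrite (_ : eps / 2 = v * (eps / (2 * v))); last by field; rewrite gt_eqF.
  by rewrite ler_pM2l// ltW.
do 3 (move: (defect _) => ?); move: (fine _) => ?.
by lra.
Qed.

(** Dominated convergence supplies the L^2 approximations that [complete_at_closed] asks for. *)
Lemma complete_at_cvg h (h_ : nat -> T -> R[i]) (G : T -> R) : L2m mu h ->
  (forall k, complete_at (h_ k)) ->
  (forall x, sqc (h x - h_ k x) @[k --> \oo] --> (0 : R)) ->
  (forall k x, sqc (h x - h_ k x) <= G x) ->
  mu.-integrable setT (EFin \o G) ->
  complete_at h.
Proof.
move=> hi hk cvgh leG iG; apply: complete_at_closed => // eps eps0.
have L k := L2mB hi (proj1 (hk k)).
have cvE : {ae mu, forall x, setT x ->
    (sqc (h x - h_ k x))%:E @[k --> \oo] --> (0 : R)%:E}.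
  by apply: aeW => x _; apply: cvg_EFin (cvgh x); exact: nearW.
have leE : {ae mu, forall x k, setT x -> (`|(sqc (h x - h_ k x))%:E| <= (G x)%:E)%E}.
  by apply: aeW => x k _; rewrite gee0_abs lee_fin ?sqc_ge0.
have [_ _] := @dominated_convergence _ T R mu setT measurableT
  (fun k x => (sqc (h x - h_ k x))%:E) (fun=> 0%E) (EFin \o G)
  (fun k => emeasurable_sqc (proj1 (L k))) (measurable_cst _) cvE iG leE.
rewrite integral0 => /fine_cvgP[_ cv'].
have /cvgr0Pnorm_lt /(_ eps eps0) [N _ /(_ N (leqnn N))] := cv'.
rewrite /= ger0_norm ?fine_ge0 ?nrm2_ge0// => ?.
by exists (h_ N).
Qed.

Lemma complete_at_parseval h : complete_at h -> fsum h = (v%:E * nrm2 mu h)%E.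
Proof.
move=> [hi h0]; have e0 : v * fine (nrm2 mu h) = fine (fsum h).
  by apply/eqP; rewrite -subr_eq0; apply/eqP.
by rewrite -(fineK (fsum_fin hi)) -e0 EFinM fineK// nrm2_fin.
Qed.
End orthogonal_system.

(** An orthogonal basis of L^2(W), realized by functions on the whole space that vanish off W and
    have modulus 1 on W. This form passes to products and through changes of variables without
    restricting measures. *)
Record parseval_system {R : realType} d (T : measurableType d)
    (mu : {measure set T -> \bar R}) (W : set T) (v : R) (I : countType)
    (e : I -> T -> R[i]) : Prop := ParsevalSystem {
  ps_gt0 : 0 < v ;
  ps_measurable : measurable W ;
  ps_measure : mu W = v%:E ;
  ps_cmeasurable : forall i, cmeasurable (e i) ;
  ps_sqc : forall i x, sqc (e i x) = \1_W x ;
  ps_eq : forall h, L2m mu h -> (forall x, ~ W x -> h x = 0) ->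
    fsum mu e h = (v%:E * nrm2 mu h)%E }.

(** * Fubini for complex functions, and tensor products of Parseval systems *)

Section complex_fubini.
Context {R : realType} d1 d2 (T1 : measurableType d1) (T2 : measurableType d2).
Variables (m1 : {sigma_finite_measure set T1 -> \bar R})
          (m2 : {sigma_finite_measure set T2 -> \bar R}).

Lemma Rintegral_fubini (f : T1 * T2 -> R) :
  (m1 \x m2)%E.-integrable setT (EFin \o f) ->
  m1.-integrable setT (fun x => (\int[m2]_y f (x, y))%:E) /\
  \int[(m1 \x m2)%E]_z f z = \int[m1]_x \int[m2]_y f (x, y).
Proof.
move=> fi; have Fi := integrable_fubini_F fi.
have mF := measurable_int _ Fi.
have mf : measurable_fun setT (fun x => (\int[m2]_y f (x, y))%:E).
  apply/measurable_EFinP; exact: (measurableT_comp (fine_measurable _) mF).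
split.
  apply: le_integrable Fi => // x _; rewrite /Rintegral /fubini_F/=.
  by case: (integral _ _ _) => [r||]//=; rewrite ?normr0 ?leey.
rewrite [LHS]/Rintegral -(integral12_prod_meas1 fi); congr fine.
(* Taking [fine] of the inner integral is harmless: the section is integrable for almost every x,
   and there the integral is finite. *)
apply: ae_eq_integral => //.
apply: filterS (ae_integrable1 fi) => x ix _.
by rewrite /Rintegral fineK//; exact: integrable_fin_num.
Qed.

Lemma cintegral_fubini (F : T1 * T2 -> R[i]) : cintegrable (m1 \x m2)%E F ->
  cintegrable m1 (fun x => cintegral m2 (fun y => F (x, y))) /\
  cintegral (m1 \x m2)%E F = cintegral m1 (fun x => cintegral m2 (fun y => F (x, y))).
Proof.
move=> [/Rintegral_fubini[h1 h2] /Rintegral_fubini[h3 h4]]; split; first by split.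
by rewrite [LHS]/cintegral h2 h4.
Qed.

Lemma nrm2_fubini (h : T1 * T2 -> R[i]) : cmeasurable h ->
  nrm2 (m1 \x m2)%E h = (\int[m1]_x nrm2 m2 (fun y => h (x, y)))%E.
Proof.
move=> mh; rewrite /nrm2 fubini_tonelli1//; last by move=> x; rewrite lee_fin sqc_ge0.
exact: emeasurable_sqc.
Qed.

Lemma cmeasurable_pair1 (h : T1 * T2 -> R[i]) x : cmeasurable h ->
  cmeasurable (fun y => h (x, y)).
Proof. by move=> mh; apply: cmeasurable_comp mh _; exact: measurable_pair1. Qed.

Lemma emeasurable_nrm2_fubini (h : T1 * T2 -> R[i]) : cmeasurable h ->
  measurable_fun setT (fun x => nrm2 m2 (fun y => h (x, y))).
Proof.
move=> mh; apply: (@measurable_fun_fubini_tonelli_F _ _ _ _ _ m2 (fun z => (sqc (h z))%:E)).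
  exact: emeasurable_sqc.
by move=> x; rewrite lee_fin sqc_ge0.
Qed.

Lemma L2m_fubini (h : T1 * T2 -> R[i]) : L2m (m1 \x m2)%E h ->
  {ae m1, forall x, L2m m2 (fun y => h (x, y))}.
Proof.
move=> [mh hi]; have mN := emeasurable_nrm2_fubini mh.
have iN : m1.-integrable setT (fun x => nrm2 m2 (fun y => h (x, y))).
  apply/integrableP; split => //.
  by under eq_integral do rewrite gee0_abs ?nrm2_ge0//; rewrite -nrm2_fubini.
apply: filterS (integrable_ae measurableT iN) => x /(_ I) hx.
split; first exact: cmeasurable_pair1.
by rewrite ltey_eq hx.
Qed.

End complex_fubini.

Section tensor.
Context {R : realType} d1 d2 (T1 : measurableType d1) (T2 : measurableType d2).
Variables (m1 : {sigma_finite_measure set T1 -> \bar R})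
          (m2 : {sigma_finite_measure set T2 -> \bar R}).
Variables (W1 : set T1) (v1 : R) (I1 : countType) (e1 : I1 -> T1 -> R[i]).
Variables (W2 : set T2) (v2 : R) (I2 : countType) (e2 : I2 -> T2 -> R[i]).
Hypotheses (P1 : parseval_system m1 W1 v1 e1) (P2 : parseval_system m2 W2 v2 e2).

Let e (k : I1 * I2) (z : T1 * T2) : R[i] := e1 k.1 z.1 * e2 k.2 z.2.

(** Expanding the sections h(x, .) in the second system gives functions H_j of x whose squared norms
    sum to v2 |h|^2. Each H_j is then expanded in the first system, and Fubini identifies the
    resulting coefficients with those of the product system. *)
Lemma parseval_tensor :
  parseval_system (m1 \x m2)%E (W1 `*` W2) (v1 * v2) e.
Proof.
have [v10 mW1 m1W1 me1 e11 eq1] := P1; have [v20 mW2 m2W2 me2 e21 eq2] := P2.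
have mW : measurable (W1 `*` W2) by exact: measurableX.
have muW : (m1 \x m2)%E (W1 `*` W2) = (v1 * v2)%:E.
  by rewrite product_measure1E// m1W1 m2W2.
have me k : cmeasurable (e k).
  apply: cmeasurableM.
    by apply: cmeasurable_comp (me1 k.1) _; exact: measurable_fst.
  by apply: cmeasurable_comp (me2 k.2) _; exact: measurable_snd.
have e1E k z : sqc (e k z) = \1_(W1 `*` W2) z.
  by rewrite /e sqcM e11 e21 !indicE in_setX; case: (_ \in _); case: (_ \in _);
    rewrite ?mulr0 ?mul0r ?mulr1.
have v0 : 0 < v1 * v2 by rewrite mulr_gt0.
split => // h hi hW.
have [mh _] := hi.
have L2e k := L2m_e mW muW me e1E k.
pose H j x := fcoef m2 e2 (fun y => h (x, y)) j.
(* A function of the second variable alone need not be square-integrable on the product. Cutting the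
   first variable to W1 repairs this and changes nothing against h, which vanishes off W1 x W2. *)
have L2e2 j : L2m (m1 \x m2)%E (fun z => cind W1 z.1 * e2 j z.2).
  apply: (L2m_indic mW); first by move: (ltry (v1 * v2)); rewrite -muW.
    apply: cmeasurableM.
      by apply: cmeasurable_comp (cmeasurable_cind mW1) _; exact: measurable_fst.
    by apply: cmeasurable_comp (me2 j) _; exact: measurable_snd.
  move=> z; rewrite sqcM sqc_cind e21 !indicE in_setX.
  by case: (_ \in _); case: (_ \in _); rewrite ?mulr0 ?mul0r ?mulr1.
have iH j : cintegrable (m1 \x m2)%E (fun z => h z * (e2 j z.2)^*).
  have : cintegrable (m1 \x m2)%E (fun z => h z * (cind W1 z.1 * e2 j z.2)^*).
    by apply: L2mM_cintegrable => //; exact: L2mJ.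
  rewrite (_ : (fun z => _) = (fun z => h z * (e2 j z.2)^*))//.
  apply/funext => z; have [zW|zW] := pselect (W1 z.1); last first.
    by rewrite hW ?mul0r// => -[].
  by rewrite cindT// mul1r.
have mH j : cmeasurable (H j) by apply: cintegrable_cmeas (cintegral_fubini (iH j)).1.
have HW j x : ~ W1 x -> H j x = 0.
  move=> nW; rewrite /H /fcoef.
  rewrite (_ : (fun y => _) = (fun=> 0)); last first.
    by apply/funext => y; rewrite hW ?mul0r// => -[].
  by rewrite /cintegral !Rintegral_cst//= !mul0r.
have sumH : {ae m1, forall x, \esum_(j in [set: I2]) (sqc (H j x))%:E =
    (v2%:E * nrm2 m2 (fun y => h (x, y)))%E}.
  apply: filterS (L2m_fubini hi) => x hx; apply: eq2 => // y nW.
  by apply: hW => -[].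
have intH : (\esum_(j in [set: I2]) nrm2 m1 (H j) = v2%:E * nrm2 (m1 \x m2)%E h)%E.
  rewrite /nrm2 -integral_esum; last 2 first.
  - by move=> j; exact: emeasurable_sqc.
  - by move=> j x; rewrite lee_fin sqc_ge0.
  rewrite (@ge0_ae_eq_integral _ _ _ m1 setT _
    (fun x => v2%:E * nrm2 m2 (fun y => h (x, y))))%E//; first last.
  - by apply: filterS sumH => x ->.
  - by move=> x _; apply: mule_ge0; [rewrite lee_fin ltW|exact: nrm2_ge0].
  - by move=> x _; apply: esum_ge0 => j _; rewrite lee_fin sqc_ge0.
  - by apply: measurable_funeM; exact: emeasurable_nrm2_fubini.
  - apply: emeasurable_esum => j; first exact: emeasurable_sqc.
    by move=> x; rewrite lee_fin sqc_ge0.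
  rewrite ge0_integralZl//; last 3 first.
  - exact: emeasurable_nrm2_fubini.
  - by move=> x _; exact: nrm2_ge0.
  - by rewrite lee_fin ltW.
  by rewrite -[in RHS]/(nrm2 _ _) nrm2_fubini.
have L2H j : L2m m1 (H j).
  split => //; apply: (@le_lt_trans _ _ (\esum_(j in [set: I2]) nrm2 m1 (H j))%E).
    have := @ge_esum_seq R I2 (fun j => nrm2 m1 (H j)) [:: j].
    rewrite big_cons big_nil adde0; apply => //.
    by move=> i; exact: nrm2_ge0.
  by rewrite intH lte_mul_pinfty// ?lee_fin ?ltW//; case: hi.
have coefE i j : fcoef (m1 \x m2)%E e h (i, j) = fcoef m1 e1 (H j) i.
  rewrite /fcoef.
  have /cintegral_fubini[i1 ->] : cintegrable (m1 \x m2)%E (fun z => h z * (e (i, j) z)^*).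
    exact: (cintegrable_coef mW muW me e1E).
  apply: ae_eq_cintegral.
  - exact: (cintegrable_cmeas i1).
  - by apply: cmeasurableM => //; exact: cmeasurableJ.
  apply: filterS (L2m_fubini hi) => x hx; rewrite /H /fcoef mulrC -cintegralZ.
    by congr cintegral; apply/funext => y; rewrite /e/= rmorphM/=; ring.
  exact: (cintegrable_coef mW2 m2W2 me2 e21).
rewrite /fsum.
(* The index of the second system goes outside, so that the inner sum is Parseval's sum for H_j in
   the first system. *)
rewrite (reindex_esum [set: I2 * I1] _ (fun k => (k.2, k.1))); last first.
  split => //; first by move=> [i j] [i' j'] _ _ /= [-> ->].
  by move=> [i j] _; exists (j, i).
have -> : [set: I2 * I1] = [set: I2] `*`` (fun=> [set: I1]) by apply/seteqP; split.
rewrite -(@esum_esum R I2 I1 setT (fun=> setT)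
  (fun j i => (sqc (fcoef (m1 \x m2)%E e h (i, j)))%:E)); last first.
  by move=> j i _ _; rewrite lee_fin sqc_ge0.
under eq_esum => j _.
  under eq_esum => i _ do rewrite coefE.
  rewrite -/(fsum m1 e1 (H j)) eq1//; last by move=> x; exact: HW.
  over.
rewrite ge0_esumZ ?ltW//; last by move=> j; exact: nrm2_ge0.
by rewrite intH muleA -EFinM.
Qed.
End tensor.

(** * Transport of integrals and Parseval systems along measurable bijections *)

Section pushforward.
Context {R : realType} d1 d2 (T1 : measurableType d1) (T2 : measurableType d2).
Variables (mu : {measure set T1 -> \bar R}) (nu : {measure set T2 -> \bar R}).
Variables (phi : T1 -> T2) (psi : T2 -> T1).
Hypotheses (mphi : measurable_fun setT phi) (mpsi : measurable_fun setT psi).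
Hypotheses (phiK : cancel phi psi) (psiK : cancel psi phi).
Hypothesis nuE : forall A, measurable A -> nu A = pushforward mu phi A.

Lemma ge0_integral_transport (f : T2 -> \bar R) : measurable_fun setT f ->
  (forall y, (0 <= f y)%E) -> (\int[nu]_y f y = \int[mu]_x f (phi x))%E.
Proof.
move=> mf f0; rewrite (eq_measure_integral (pushforward mu phi)); last first.
  by move=> A mA _; exact: nuE.
by rewrite ge0_integral_pushforward.
Qed.

Lemma Rintegral_transport (f : T2 -> R) : measurable_fun setT f ->
  \int[nu]_y f y = \int[mu]_x f (phi x).
Proof.
move=> mf; have mf' : measurable_fun setT (EFin \o f) by exact/measurable_EFinP.
rewrite /Rintegral integralE [in RHS]integralE; congr (fine (_ - _)).
  transitivity (\int[mu]_x ((EFin \o f)^\+ (phi x)))%E;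
    last by apply: eq_integral => x _; rewrite !funeposE.
  by apply: ge0_integral_transport => //; exact: measurable_funepos.
transitivity (\int[mu]_x ((EFin \o f)^\- (phi x)))%E;
  last by apply: eq_integral => x _; rewrite !funenegE.
by apply: ge0_integral_transport => //; exact: measurable_funeneg.
Qed.

Lemma cintegral_transport (f : T2 -> R[i]) : cmeasurable f ->
  cintegral nu f = cintegral mu (fun x => f (phi x)).
Proof. by move=> [m1 m2]; rewrite /cintegral !Rintegral_transport. Qed.

Lemma nrm2_transport (f : T2 -> R[i]) : cmeasurable f ->
  nrm2 nu f = nrm2 mu (fun x => f (phi x)).
Proof.
move=> mf; rewrite /nrm2 ge0_integral_transport//; first exact: emeasurable_sqc.
by move=> x; rewrite lee_fin sqc_ge0.
Qed.

(** Used to pass from R x R^d to tuples of length d + 1; there [u] splits a tuple of frequencies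
    into head and tail. *)
Lemma parseval_transport W v (I J : countType) (e : I -> T1 -> R[i])
    (u : J -> I) : bijective u ->
  parseval_system mu W v e ->
  parseval_system nu (psi @^-1` W) v (fun j y => e (u j) (psi y)).
Proof.
move=> [u' uK u'K] [v0 mW muW me e1 eq].
have me' j : cmeasurable (fun y => e (u j) (psi y)) by exact: cmeasurable_comp.
have mpW : measurable (psi @^-1` W) by rewrite -[X in measurable X]setTI; exact: mpsi.
split => //.
  rewrite nuE// /pushforward (_ : phi @^-1` _ = W)//.
  by apply/seteqP; split => x /=; rewrite phiK.
move=> h hi hW; have [mh hfin] := hi.
rewrite nrm2_transport//.
have hi' : L2m mu (fun x => h (phi x)).
  by split; [exact: cmeasurable_comp|rewrite -nrm2_transport].
rewrite -eq//; last by move=> x nW; apply: hW; rewrite /preimage/= phiK.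
rewrite /fsum [RHS](reindex_esum [set: J] _ u); last first.
  split => //; first by move=> x y _ _ /(can_inj uK).
  by move=> i _; exists (u' i).
apply: eq_esum => j _; congr (sqc _)%:E; rewrite /fcoef cintegral_transport//.
  by under eq_fun do rewrite phiK.
by apply: cmeasurableM => //; exact: cmeasurableJ.
Qed.
End pushforward.

(** * From completeness at indicators to completeness on all of L^2(W) *)

Section complete_from_indicators.
Context {R : realType} d (T : measurableType d) (mu : {measure set T -> \bar R}).
Variables (W : set T) (v : R) (I : countType) (e : I -> T -> R[i]).
Hypothesis (mW : measurable W) (muW : mu W = v%:E) (v0 : 0 < v).
Hypothesis me : forall i, cmeasurable (e i).
Hypothesis e1 : forall i x, sqc (e i x) = \1_W x.
Hypothesis orth : forall i j, i != j -> fcoef mu e (e i) j = 0.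
Hypothesis indic_complete : forall A, measurable A ->
  complete_at mu v e (cind (W `&` A)).

Let cD f g := complete_atD mW muW v0 me e1 orth (f := f) (g := g).
Let cZ c f := complete_atZ mW muW v0 me e1 orth c (f := f).
Let cB f g := complete_atB mW muW v0 me e1 orth (f := f) (g := g).

Import HBNNSimple.

Lemma complete_at_sfun (g : {nnsfun T >-> R}) :
  complete_at mu v e (fun x => cind W x * (g x)%:C%C).
Proof.
pose s : seq R := fset_set (range g).
have E : (fun x => cind W x * (g x)%:C%C) = (fun x : T =>
    \sum_(r <- s) (r%:C%C * cind (W `&` (g @^-1` [set r])) x : R[i])).
  apply/funext => x; rewrite {1}fimfunE fsbig_finite//= rmorph_sum mulr_sumr.
  apply: eq_bigr => r _; rewrite rmorphM/= mulrCA; congr (_ * _).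
  by rewrite /cind -rmorphM/= indicI.
rewrite E; apply: (complete_at_sum mW muW v0 me e1 orth) => r _; apply: cZ.
exact: indic_complete.
Qed.

Lemma complete_at_ge0 (h : T -> R) : measurable_fun setT h -> (forall x, 0 <= h x) ->
  (forall x, ~ W x -> h x = 0) -> L2m mu (fun x => (h x)%:C%C) ->
  complete_at mu v e (fun x => (h x)%:C%C).
Proof.
move=> mh h0 hW hi; have mh' : measurable_fun setT (EFin \o h) by exact/measurable_EFinP.
pose g := nnsfun_approx measurableT mh'.
have cg x : g ^~ x @ \oo --> h x.
  have /fine_cvgP[_] := cvg_nnsfun_approx measurableT mh' (fun y _ => h0 y) (x := x) Logic.I.
  exact.
have gh k x : g k x <= h x.
  have nd : nondecreasing_seq (g ^~ x).
    by move=> m n mn; exact/lefP/nd_nnsfun_approx.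
  rewrite -(cvg_lim (@Rhausdorff R) (cg x)).
  by apply: (nondecreasing_cvgn_le nd); apply/cvg_ex; exists (h x); exact: cg.
have E k x : sqc ((h x)%:C%C - cind W x * (g k x)%:C%C) = (h x - g k x) ^+ 2.
  have [xW|xW] := pselect (W x); first by rewrite cindT// mul1r -rmorphB/= sqcR.
  rewrite cindF// mul0r subr0 sqcR hW//; congr (_ ^+ 2); apply/eqP; rewrite eq_sym subr_eq0 eq_sym.
  by rewrite eq_le fun_ge0 andbT -(hW _ xW) gh.
apply: (complete_at_cvg mW muW v0 me e1 orth (h_ := fun k x => cind W x * (g k x)%:C%C)
    (G := fun x => sqc (h x)%:C%C)) => //.
- by move=> k; exact: complete_at_sfun.
- move=> x; under eq_fun do rewrite E.
  have cv : h x - g k x @[k --> \oo] --> h x - h x.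
    by apply: cvgB => //; exact: cvg_cst.
  by have := cvgM cv cv; rewrite subrr mulr0; exact.
- move=> k x; rewrite E sqcR ler_pXn2r ?nnegrE ?subr_ge0//.
  by rewrite gerBl fun_ge0.
- exact: L2m_integrable.
Qed.

Lemma complete_at_real (h : T -> R) : measurable_fun setT h ->
  (forall x, ~ W x -> h x = 0) -> L2m mu (fun x => (h x)%:C%C) ->
  complete_at mu v e (fun x => (h x)%:C%C).
Proof.
move=> mh hW hi.
have -> : (fun x => (h x)%:C%C) = (fun x => (Num.max (h x) 0)%:C%C - (Num.max (- h x) 0)%:C%C).
  apply/funext => x; rewrite -rmorphB/=; congr (_%:C)%C.
  have [h0|h0] := leP 0 (h x); first by rewrite max_r ?oppr_le0// subr0.
  by rewrite max_l ?sub0r ?opprK// oppr_ge0 ltW.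
have m1 : measurable_fun setT (fun x => Num.max (h x) 0) by apply: measurable_maxr.
have m2 : measurable_fun setT (fun x => Num.max (- h x) 0).
  by apply: measurable_maxr => //; exact: measurableT_comp.
apply: cB; apply: complete_at_ge0 => //.
- by move=> x; rewrite le_max lexx orbT.
- by move=> x xW; rewrite hW// maxxx.
- apply: (L2m_le (g := fun x => (h x)%:C%C)) => //.
  move=> x; rewrite !sqcR; have [h0|h0] := leP 0 (h x); first by [].
  by rewrite expr0n sqr_ge0.
- by move=> x; rewrite le_max lexx orbT.
- by move=> x xW; rewrite hW// oppr0 maxxx.
- apply: (L2m_le (g := fun x => (h x)%:C%C)) => //.
  move=> x; rewrite !sqcR; have [h0|h0] := leP 0 (h x).
    by rewrite max_r ?oppr_le0// expr0n sqr_ge0.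
  by rewrite max_l ?sqrrN// oppr_ge0 ltW.
Qed.

Lemma complete_at_all (h : T -> R[i]) :
  (forall x, ~ W x -> h x = 0) -> L2m mu h -> complete_at mu v e h.
Proof.
move=> hW hi; have [[m1 m2] _] := hi.
have -> : h = (fun x => (cRe (h x))%:C%C + 'i%C * (cIm (h x))%:C%C).
  by apply/funext => x; rewrite [LHS]complexE.
apply: cD; last apply: cZ; apply: complete_at_real => //.
- by move=> x xW; rewrite hW.
- apply: (L2m_le (g := h)) => //.
  by move=> x; rewrite sqcR lerDl sqr_ge0.
- by move=> x xW; rewrite hW.
- apply: (L2m_le (g := h)) => //.
  by move=> x; rewrite sqcR lerDr sqr_ge0.
Qed.

Lemma parseval_of_indicators : parseval_system mu W v e.
Proof.
split => // h hi hW; apply: (complete_at_parseval mW muW v0 me e1 orth).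
exact: complete_at_all.
Qed.
End complete_from_indicators.

(** * Completeness of the trigonometric system on a period *)

Section bump_sequence.
Context {R : realType}.
Implicit Types (y t z : R).

Lemma bernoulli_ineq z n : -1 <= z -> 1 + n%:R * z <= (1 + z) ^+ n.
Proof.
move=> z1; elim: n => [|n IH]; first by rewrite mul0r addr0 expr0.
rewrite exprS; apply: le_trans (_ : (1 + z) * (1 + n%:R * z) <= _); last first.
  by rewrite ler_wpM2l// -lerBlDl sub0r.
have : 0 <= n%:R * z ^+ 2 by rewrite mulr_ge0// sqr_ge0.
by rewrite -natr1 => h; nra.
Qed.

(** By Bernoulli, (1 - z)^n (1 + n z) <= (1 - z)^n (1 + z)^n = (1 - z^2)^n <= 1. *)
Lemma expr_le_inv z n : 0 <= z <= 1 -> (1 - z) ^+ n <= (1 + n%:R * z)^-1.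
Proof.
move=> /andP[z0 z1].
have h : 0 < 1 + n%:R * z by rewrite ltr_pwDl// mulr_ge0.
rewrite -(ler_pM2r h) mulVf ?gt_eqF//.
apply: (@le_trans _ _ ((1 - z) ^+ n * (1 + z) ^+ n)).
  rewrite ler_wpM2l ?exprn_ge0 ?subr_ge0//; apply: bernoulli_ineq.
  by apply: le_trans z0; rewrite lerN10.
rewrite -exprMn; apply: exprn_ile1; first by apply: mulr_ge0; lra.
by have := sqr_ge0 z; rewrite expr2; nra.
Qed.

(** With w the square root of z, Bernoulli at w^-1 - 1 bounds k w^k by C = w / (1 - w); hence k z^k
    = (k w^k) w^k <= C w^k. *)
Lemma cvg_natr_expr z : 0 <= z < 1 -> k%:R * z ^+ k @[k --> \oo] --> (0 : R).
Proof.
move=> /andP[z0 z1]; pose w := Num.sqrt z.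
have w0 : 0 <= w by exact: sqrtr_ge0.
have w1 : w < 1 by rewrite -sqrtr1 ltr_sqrt.
have zE : z = w ^+ 2 by rewrite sqr_sqrtr.
have [w00|wn0] := eqVneq w 0.
  apply: cvg_near_cst; exists 1%N => // k /= k1.
  by rewrite zE w00 expr0n/= expr0n; case: k k1 => // k _; rewrite mulr0.
have w_gt0 : 0 < w by rewrite lt_neqAle eq_sym wn0.
pose C := w / (1 - w).
have C0 : 0 <= C by rewrite divr_ge0// subr_ge0 ltW.
have kw k : k%:R * w ^+ k <= C.
  have h0 : -1 <= w^-1 - 1 by rewrite -lerBlDr subrr invr_ge0.
  have := @bernoulli_ineq (w^-1 - 1) k h0; rewrite [1 + (_ - 1)]addrC subrK exprVn.
  set u := w ^+ k => h.
  have u0 : 0 < u by rewrite exprn_gt0.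
  have {}h : k%:R * (w^-1 - 1) <= u^-1 by lra.
  have e : C * (w^-1 - 1) = 1.
    by rewrite /C; field; rewrite wn0/= subr_eq0 eq_sym lt_eqF.
  have p0 : 0 < w^-1 - 1 by rewrite subr_gt0 invf_gt1.
  rewrite -(ler_pM2r p0) e mulrAC.
  by have := ler_wpM2r (ltW u0) h; rewrite mulVf ?gt_eqF.
apply: (@squeeze_cvgr _ _ _ _ (fun=> 0) (fun k => C * w ^+ k)).
- near=> k; rewrite mulr_ge0 ?exprn_ge0//= zE -exprM mulnC mulnS muln1 exprD mulrA.
  by rewrite ler_wpM2r// exprn_ge0.
- exact: cvg_cst.
- rewrite -(mulr0 C); apply: cvgM; first exact: cvg_cst.
  by apply: cvg_expr; rewrite ger0_norm.
Unshelve. all: by end_near. Qed.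

(** The polynomials (1 - y^k)^n familiar from proofs of the Stone-Weierstrass theorem. With n close
    to k / t^k, the product n y^k tends to 0 for y < t and is at least k for y >= t; the factor k
    settles the value at y = t itself. *)
Definition bump_exp t k : nat := (Num.trunc (k%:R / t ^+ k)).+1.
Definition bump t k y := (1 - y ^+ k) ^+ bump_exp t k.

Lemma bump_itv t k y : 0 <= y <= 1 -> 0 <= bump t k y <= 1.
Proof.
move=> /andP[y0 y1]; have h : 0 <= 1 - y ^+ k by rewrite subr_ge0 exprn_ile1.
by rewrite exprn_ge0//= exprn_ile1// gerBl exprn_ge0.
Qed.

Lemma cvg_bump t y : 0 < t < 1 -> 0 <= y <= 1 ->
  bump t k y @[k --> \oo] --> ((y < t)%R%:R : R).
Proof.
move=> /andP[t0 t1] yi; have /andP[y0 y1] := yi.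
have tk k : 0 < t ^+ k by rewrite exprn_gt0.
have yk k : 0 <= y ^+ k <= 1 by rewrite exprn_ge0//= exprn_ile1.
have m1 k : k%:R / t ^+ k <= (bump_exp t k)%:R.
  by rewrite /bump_exp ltW// Num.Theory.truncnS_gt.
have m2 k : (bump_exp t k)%:R <= k%:R / t ^+ k + 1.
  by rewrite /bump_exp -natr1 lerD2r Num.Theory.truncn_le// divr_ge0// ltW.
case: (ltP y t) => yt /=.
  apply: (@squeeze_cvgr _ _ _ _ (fun k => 1 - (k%:R * (y / t) ^+ k + y ^+ k)) (fun=> 1)).
  - near=> k; have /andP[_ ->] := bump_itv t k yi; rewrite andbT.
    apply: (@le_trans _ _ (1 + (bump_exp t k)%:R * (- y ^+ k))); last first.
      by apply: bernoulli_ineq; have /andP[_] := yk k; rewrite lerN2.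
    rewrite mulrN lerD2l lerN2 expr_div_n mulrA mulrAC -[X in _ + X]mul1r -mulrDl.
    by rewrite ler_wpM2r//; have /andP[] := yk k.
  - rewrite -[X in _ --> X]subr0 -[X in _ - X]addr0; apply: cvgB; first exact: cvg_cst.
    apply: cvgD.
      apply: cvg_natr_expr; apply/andP; split; first by rewrite divr_ge0// ltW.
      by rewrite ltr_pdivrMr// mul1r.
    by apply: cvg_expr; rewrite ger0_norm// (lt_trans yt).
  - exact: cvg_cst.
(* Here n y^k >= k for n = [bump_exp t k], so [expr_le_inv] bounds the bump by 1 / (k + 1). *)
apply: (@squeeze_cvgr _ _ _ _ (fun=> 0) (fun k => harmonic k)).
- near=> k; have /andP[-> _] := bump_itv t k yi; rewrite /=.
  apply: le_trans (expr_le_inv _ (yk k)) _.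
  rewrite /harmonic/= lef_pV2 ?posrE ?ltr0n//; last first.
    by rewrite ltr_pwDl// mulr_ge0//; have /andP[] := yk k.
  rewrite -natr1 addrC lerD2l.
  apply: (@le_trans _ _ (k%:R / t ^+ k * y ^+ k)); last first.
    by rewrite ler_wpM2r//; have /andP[] := yk k.
  rewrite -mulrA ler_peMr// mulrC ler_pdivlMr// mul1r lerXn2r// nnegrE; lra.
- exact: cvg_cst.
- exact: cvg_harmonic.
Unshelve. all: by end_near. Qed.
End bump_sequence.

(** * The exponentials over one period in dimension one *)

Section circle.
Context {R : realType}.
Variables (c a : R).
Hypothesis (a0 : 0 < a).
Local Notation mu := (@lebesgue_measure R).
Local Notation T := (measurableTypeR R).

Definition period : set T := `[c, c + a[%classic.
Definition expW (n : int) (x : T) : R[i] := cind period x * expi2pi (n%:~R * x / a).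

Lemma measurable_period : measurable period.
Proof. exact: measurable_itv. Qed.
Lemma lebesgue_period : mu period = a%:E.
Proof.
by rewrite /period lebesgue_measure_itv/= lte_fin ltrDl a0 -EFinB addrAC subrr add0r.
Qed.
Lemma cmeasurable_expW n : cmeasurable (expW n).
Proof.
apply: cmeasurableM; first by apply: cmeasurable_cind; exact: measurable_period.
by apply: cmeasurable_expi2pi; apply: measurable_funM => //; apply: measurable_funM.
Qed.
Lemma sqc_expW n x : sqc (expW n x) = \1_period x.
Proof. by rewrite sqcM sqc_cind sqc_expi2pi mulr1. Qed.

Lemma integrable_period : mu.-integrable setT (EFin \o (fun x : T => \1_period x)).
Proof.
have h : L2m mu (expW 0).
  exact: (L2m_e measurable_period lebesgue_period cmeasurable_expW sqc_expW).
by apply: eq_integrable (L2m_integrable h) => // x _; rewrite /= sqc_expW.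
Qed.

Lemma expWM n m x : expW n x * expW m x = expW (n + m) x.
Proof.
rewrite /expW mulrACA -expi2piD.
have -> : cind period x * cind period x = cind period x :> R[i].
  by rewrite /cind -rmorphM/= indicE; case: (_ \in _); rewrite ?mulr1 ?mulr0.
by congr (_ * expi2pi _); rewrite -mulrDl -mulrDl intrD.
Qed.
Lemma expWJ n x : (expW n x)^* = expW (- n) x.
Proof.
rewrite /expW rmorphM/= -expi2piN; congr (_ * expi2pi _).
  by apply: ceqP; rewrite !ReImE/= ?oppr0.
by rewrite mulrNz mulNr mulNr.
Qed.

Lemma integral_period (f F : R -> R) : (forall x : R, is_derive x (1:R) F (f x)) ->
  continuous f -> F (c + a) = F c -> \int[mu]_(x in period) f x = 0.
Proof.
move=> dF cf Fp.
have ab : c < c + a by rewrite ltrDl.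
have cF : continuous F.
  move=> x; apply: differentiable_continuous; apply/derivable1_diffP.
  by have [] := dF x.
rewrite /Rintegral integral_itv_bndo_bndc; last first.
  by apply/measurable_EFinP; apply: measurable_funTS; exact: continuous_measurable_fun.
rewrite (@continuous_FTC2 R f F c (c + a))//.
- by rewrite Fp subee.
- by apply: continuous_subspaceT.
- split.
  + by move=> x _; have [] := dF x.
  + by apply: cvg_at_right_filter; exact: cF.
  + by apply: cvg_at_left_filter; exact: cF.
- by move=> x _; rewrite derive1E; have [_ ->] := dF x.
Qed.

Lemma expi2pi_period (k : int) : expi2pi (k%:~R * (c + a) / a) = expi2pi (k%:~R * c / a).
Proof.
rewrite (_ : k%:~R * (c + a) / a = k%:~R * c / a + k%:~R); last first.
  by field; rewrite gt_eqF.
by rewrite expi2piD expi2pi_int mulr1.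
Qed.

Lemma cintegral_expW n : n != 0 -> cintegral mu (expW n) = 0.
Proof.
move=> n0; pose b : R := 2 * pi * (n%:~R / a).
have b0 : b != 0.
  rewrite /b; apply: mulf_neq0; first by rewrite mulf_neq0// gt_eqF// pi_gt0.
  by rewrite mulf_neq0 ?invr_neq0 ?intr_eq0// gt_eqF.
have bE x : 2 * pi * (n%:~R * x / a) = b * x by rewrite /b; ring.
have := expi2pi_period n; rewrite /expi2pi !bE => -[ec es].
have dL x : is_derive (x : R) (1 : R) (fun x : R => b * x) b.
  by apply: is_derive_eq; rewrite /GRing.scale/= mulr1.
have dS (x : R) : is_derive x (1 : R) (fun x : R => b^-1 * sin (b * x)) (cos (b * x)).
  have h := is_derive1_comp (is_derive_sin (b * x)) (dL x).
  have h2 := is_deriveZ b^-1 h.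
  by apply: is_derive_eq h2 _; rewrite /GRing.scale/= mulrCA mulVf// mulr1.
have dC (x : R) : is_derive x (1 : R) (fun x : R => - b^-1 * cos (b * x)) (sin (b * x)).
  have h := is_derive1_comp (is_derive_cos (b * x)) (dL x).
  have h2 := is_deriveZ (- b^-1) h.
  by apply: is_derive_eq h2 _; rewrite /GRing.scale/=; field.
have cL : continuous (fun x : R => b * x) by move=> x; apply: cvgM => //; exact: cvg_cst.
have I1 : \int[mu]_(x in period) cos (b * x) = 0.
  apply: (integral_period dS); last by rewrite es.
  by move=> x; apply: continuous_comp; [exact: cL|exact: continuous_cos].
have I2 : \int[mu]_(x in period) sin (b * x) = 0.
  apply: (integral_period dC); last by rewrite ec.
  by move=> x; apply: continuous_comp; [exact: cL|exact: continuous_sin].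
have E (f : R -> R) : \int[mu]_x (\1_period x * f x) = \int[mu]_(x in period) f x.
  rewrite [RHS]Rintegral_mkcond; apply: eq_Rintegral => x _.
  by rewrite /patch indicE; case: ifP; rewrite ?mul1r ?mul0r.
rewrite /cintegral; apply: ceqP => /=.
  rewrite -[RHS]I1 -E; apply: eq_Rintegral => x _.
  by rewrite bE mul0r subr0.
rewrite -[RHS]I2 -E; apply: eq_Rintegral => x _.
by rewrite bE mul0r addr0.
Qed.

Lemma expW_orth n m : n != m -> fcoef mu expW (expW n) m = 0.
Proof.
move=> nm; rewrite /fcoef; under eq_fun do rewrite expWJ expWM.
by rewrite cintegral_expW// subr_eq0.
Qed.

Let cat := complete_at mu a expW.
Let cD f g := complete_atD measurable_period lebesgue_period a0 cmeasurable_expW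
  sqc_expW expW_orth (f := f) (g := g).
Let cZ k f := complete_atZ measurable_period lebesgue_period a0 cmeasurable_expW
  sqc_expW expW_orth k (f := f).
Let cB f g := complete_atB measurable_period lebesgue_period a0 cmeasurable_expW
  sqc_expW expW_orth (f := f) (g := g).
Let cE n : cat (expW n) := complete_at_e measurable_period lebesgue_period a0
  cmeasurable_expW sqc_expW expW_orth n.

(** The algebra generated by the exponentials cut off to one period; [cind period] is its unit. Its
    closure under products is what allows polynomials to be composed with [hump]. *)
Inductive trig_poly : (T -> R[i]) -> Prop :=
| trig_expW n : trig_poly (expW n)
| trigD f g : trig_poly f -> trig_poly g -> trig_poly (fun x => f x + g x)
| trigZ k f : trig_poly f -> trig_poly (fun x => k * f x).

Lemma trigM f g : trig_poly f -> trig_poly g -> trig_poly (fun x => f x * g x).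
Proof.
move=> pf; elim: pf g => [n|f1 f2 _ h1 _ h2|k f1 _ h1] g pg.
- elim: pg => [m|g1 g2 _ h1 _ h2|k g1 _ h1].
  + by under eq_fun do rewrite expWM; exact: trig_expW.
  + by under eq_fun do rewrite mulrDr; exact: trigD.
  + by under eq_fun do rewrite mulrCA; exact: trigZ.
- by under eq_fun do rewrite mulrDl; apply: trigD; [exact: h1|exact: h2].
- by under eq_fun do rewrite -mulrA; apply: trigZ; exact: h1.
Qed.
Lemma trig_one : trig_poly (cind period).
Proof.
have := trig_expW 0; congr trig_poly; apply/funext => x.
by rewrite /expW mul0r mul0r expi2pi0 mulr1.
Qed.
Lemma trigX f n : trig_poly f -> trig_poly (fun x => cind period x * f x ^+ n).
Proof.
move=> pf; elim: n => [|n IH].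
  by under eq_fun do rewrite expr0 mulr1; exact: trig_one.
by under eq_fun do rewrite exprS mulrCA; exact: trigM.
Qed.
Lemma trig_complete f : trig_poly f -> cat f.
Proof. by elim=> [n|f1 f2 _ h1 _ h2|k f1 _ h1]; [exact: cE|exact: cD|exact: cZ]. Qed.

(** This is cos^2 (pi (x - x0) / a): a trigonometric polynomial of degree 1 with values in [0, 1],
    the range on which [bump] is controlled. *)
Definition hump x0 (x : R) : R := (1 + cos (2 * pi * ((x - x0) / a))) / 2.

Lemma hump_itv x0 x : 0 <= hump x0 x <= 1.
Proof.
have h1 := cos_le1 (2 * pi * ((x - x0) / a)).
have h2 := cos_geN1 (2 * pi * ((x - x0) / a)).
by rewrite /hump; apply/andP; split; lra.
Qed.

Lemma trig_hump x0 : trig_poly (fun x => cind period x * (hump x0 x)%:C%C).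
Proof.
have -> : (fun x : T => cind period x * (hump x0 x)%:C%C) =
  (fun x => 2^-1 * cind period x + (4^-1 * expi2pi (- (x0 / a)) * expW 1 x
            + 4^-1 * expi2pi (x0 / a) * expW (-1) x)).
  apply/funext => x; rewrite /hump /expW.
  have -> : 4^-1 * expi2pi (- (x0 / a)) * (cind period x * expi2pi (1%:~R * x / a)) =
     cind period x * (4^-1 * expi2pi ((x - x0) / a)).
    have -> : (x - x0) / a = - (x0 / a) + (1%:~R * x / a) by rewrite mul1r mulrBl addrC.
    by rewrite expi2piD; ring.
  have -> : 4^-1 * expi2pi (x0 / a) * (cind period x * expi2pi ((-1)%:~R * x / a)) =
     cind period x * (4^-1 * (expi2pi ((x - x0) / a))^*).
    rewrite -expi2piN.
    have -> : - ((x - x0) / a) = (x0 / a) + ((-1)%:~R * x / a).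
      by rewrite (_ : (-1)%:~R = -1 :> R)//; ring.
    by rewrite expi2piD; ring.
  have -> : 2^-1 = ((2^-1)%:C%C : R[i]) by rewrite fmorphV rmorph_nat.
  have -> : 4^-1 = ((4^-1)%:C%C : R[i]) by rewrite fmorphV rmorph_nat.
  by apply: ceqP; rewrite /cind /expi2pi !ReImE/=; field.
apply: trigD; first by apply: trigZ; exact: trig_one.
by apply: trigD; apply: trigZ; exact: trig_expW.
Qed.

(* The superlevel sets of [hump x0] on the circle are the arcs centered at [x0];
   here the arc is [[c, t]]. *)
Lemma hump_arc t x : c < t < c + a -> period x ->
  (hump ((c + t) / 2) x < hump ((c + t) / 2) t) = (t < x).
Proof.
move=> /andP[ct ta]; rewrite /period /= in_itv/= => /andP[cx xa].
pose s := 2 * pi / a.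
have s0 : 0 < s by rewrite divr_gt0// mulr_gt0// pi_gt0.
have sa : s * a = 2 * pi by rewrite /s mulfVK// gt_eqF.
set x0 := (c + t) / 2.
have E y : 2 * pi * ((y - x0) / a) = s * (y - x0) by rewrite /s; ring.
have -> : (hump x0 x < hump x0 t) = (cos (s * (x - x0)) < cos (s * (t - x0))).
  by rewrite /hump !E ltr_pM2r// ltrD2l.
have p0 := pi_gt0 R.
have th0 : 0 < s * (t - x0) by rewrite mulr_gt0// /x0; lra.
have th1 : s * (t - x0) < pi.
  have : s * (t - x0) < s * (a / 2) by rewrite ltr_pM2l// /x0; lra.
  by rewrite mulrA sa; lra.
have thI : s * (t - x0) \in `[0, pi] by rewrite in_itv/= !ltW.
have -> : (t < x) = (s * (t - x0) < s * (x - x0)) by rewrite ltr_pM2l// ltrD2r.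
have x1 : - (s * (t - x0)) <= s * (x - x0).
  by rewrite -mulrN ler_pM2l// /x0; lra.
have x2 : s * (x - x0) < 2 * pi - s * (t - x0).
  by rewrite -sa -mulrBr ltr_pM2l// /x0; lra.
move: thI th0 th1 x1 x2; set th := s * (t - x0); set ph := s * (x - x0).
move=> thI th0 th1 x1 x2.
(* Cosine decreases on [0, pi]. To the left of t the comparison uses |ph| <= th; to the right, an
   angle beyond pi is reflected to 2 pi - ph, which still exceeds th by [x2]. *)
have [ph1|ph1] := lerP ph th.
  apply/negbTE; rewrite -leNgt.
  rewrite -(cos_norm ph).
  have nI : `|ph| \in `[0, pi].
    by rewrite in_itv/= normr_ge0/= ler_norml; apply/andP; split; lra.
  by rewrite leNgt ltr_cos// -leNgt ler_norml; apply/andP; split.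
apply/idP; have [ph2|ph2] := lerP ph pi.
  by rewrite ltr_cos// in_itv/= ph2 andbT; lra.
have -> : cos ph = cos (2 * pi - ph).
  by rewrite -[RHS]cosN opprB -(cosD2pi (ph - 2 * pi)) mulr_natl subrK.
by rewrite ltr_cos//; [lra|rewrite in_itv/=; apply/andP; split; lra].
Qed.

(** The trigonometric polynomials [bump tau k] of the hump, with threshold tau its value at t, stay
    between 0 and 1 and converge on the period to the indicator of the set where the hump is below
    tau. By [hump_arc] that set is the part of the period to the right of t. *)
Lemma complete_ray t : c < t < c + a -> cat (cind (period `&` `]t, +oo[)).
Proof.
move=> tI; have /andP[ct ta] := tI.
set x0 := (c + t) / 2; set tau := hump x0 t.
(* [cvg_bump] needs a threshold strictly between 0 and 1. It is positive since the hump is smaller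
   still halfway from t to c + a, and below 1 since t differs from the center x0. *)
have tau01 : 0 < tau < 1.
  have h1 : hump x0 ((t + (c + a)) / 2) < tau.
    rewrite hump_arc//; first by rewrite /x0; lra.
    by rewrite /period/= in_itv/=; apply/andP; split; lra.
  have h2 : hump x0 x0 = 1 by rewrite /hump subrr mul0r mulr0 cos0; field.
  apply/andP; split.
    by apply: le_lt_trans h1; have /andP[] := hump_itv x0 ((t + (c + a)) / 2).
  suff : cos (2 * pi * ((t - x0) / a)) < 1 by rewrite /tau /hump; lra.
  have E : 2 * pi * ((t - x0) / a) = (t - c) * pi / a by rewrite /x0; field; rewrite gt_eqF.
  have p0 := pi_gt0 R.
  have h0 : 0 < (t - c) * pi / a by rewrite divr_gt0// mulr_gt0// subr_gt0.
  have h3 : (t - c) * pi / a <= pi.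
    by rewrite ler_pdivrMr// mulrC ler_pM2l//; lra.
  by rewrite E -cos0 ltr_cos ?in_itv/= ?lexx ?h3 ?(ltW h0) ?(ltW p0).
have mray : measurable (period `&` `]t, +oo[) by apply: measurableI; exact: measurable_itv.
have E k (x : T) : sqc (cind (period `&` `]t, +oo[) x - cind period x * (bump tau k (hump x0 x))%:C%C) =
    \1_period x * ((hump x0 x < tau)%R%:R - bump tau k (hump x0 x)) ^+ 2.
  have [xW|xW] := pselect (period x); last first.
    by rewrite !cindF//; [rewrite mul0r subr0 sqc0 indicE memNset// mul0r|case].
  rewrite /cind indicI indicE mem_set//= mul1r indicE mem_set// !mul1r -rmorphB sqcR.
  rewrite /tau hump_arc//; congr (((_ : bool)%:R - _) ^+ 2).
  by apply/idP/idP; [move/set_mem|move=> ?; apply/mem_set]; rewrite /= in_itv/= andbT.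
apply: (complete_at_cvg measurable_period lebesgue_period a0 cmeasurable_expW
  sqc_expW expW_orth (h_ := fun k x => cind period x * (bump tau k (hump x0 x))%:C%C)
  (G := fun x => \1_period x)).
- apply: (L2m_indic mray); last by move=> x; rewrite sqc_cind.
    apply: le_lt_trans (_ : (_ <= mu period)%E) _; last by rewrite lebesgue_period ltry.
    by apply: le_measure; rewrite ?inE//; exact: measurable_period.
  exact: cmeasurable_cind.
- move=> k; apply: trig_complete.
  have pk : trig_poly (fun x => cind period x * (1 - hump x0 x ^+ k)%:C%C).
    have := trigX k (trig_hump x0) => /(@trigZ (-1)) /(trigD trig_one).
    congr trig_poly; apply/funext => x; rewrite exprMn.
    have cc n : cind period x * cind period x ^+ n = cind period x :> R[i].
      rewrite -exprS /cind -rmorphXn/=; congr (_%:C)%C.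
      by rewrite indicE; case: (_ \in _); rewrite ?expr1n// expr0n.
    by rewrite [cind period x * (_ * _)]mulrA cc rmorphB rmorphXn/= rmorph1 mulrBr mulr1 mulN1r.
  have := trigX (bump_exp tau k) pk; congr trig_poly; apply/funext => x.
  rewrite exprMn mulrA.
  have -> : cind period x * cind period x ^+ bump_exp tau k = cind period x :> R[i].
    rewrite -exprS /cind -rmorphXn/=; congr (_%:C)%C.
    by rewrite indicE; case: (_ \in _); rewrite ?expr1n// expr0n.
  by rewrite -rmorphXn.
- move=> x; under eq_fun do rewrite E.
  have cv := cvg_bump tau01 (hump_itv x0 x).
  have cv1 : ((hump x0 x < tau)%R%:R : R) - bump tau k (hump x0 x) @[k --> \oo] -->
      ((hump x0 x < tau)%R%:R : R) - (hump x0 x < tau)%R%:R.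
    by apply: cvgB => //; exact: cvg_cst.
  have := cvgM (cvg_cst (\1_period x : R)) (cvgM cv1 cv1).
  by rewrite subrr !mulr0; exact.
- move=> k x; rewrite E -[leRHS]mulr1 ler_wpM2l//.
  have /andP[b0 b1] := bump_itv tau k (hump_itv x0 x).
  by case: (hump x0 x < tau)%R; rewrite /= ?mulr1n ?mulr0n expr2; nra.
- exact: integrable_period.
Qed.

(** Dynkin induction from the rays ]t, +oo[, which are stable under intersection and generate the
    Borel sets. Complements are differences with the indicator of the period, and countable disjoint
    unions are dominated limits of finite sums. *)
Lemma complete_indicator A : measurable A -> cat (cind (period `&` A)).
Proof.
have one : cat (cind period) by apply: trig_complete; exact: trig_one.
have fin B : measurable B -> L2m mu (cind (period `&` B)).
  move=> mB; have mW := measurable_period.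
  apply: (@L2m_indic _ _ _ _ _ (period `&` B)); first exact: measurableI.
  - apply: le_lt_trans (_ : (_ <= mu period)%E) _; last by rewrite lebesgue_period ltry.
    by apply: le_measure; rewrite ?inE//; exact: measurableI.
  - by apply: cmeasurable_cind; exact: measurableI.
  - by move=> x; rewrite sqc_cind.
pose G0 : set (set T) := @RGenOInfty.G R.
have mE : @measurable _ T = <<s G0 >> by exact: RGenOInfty.measurableE.
move=> mA; have {mA} : <<s G0 >> A by rewrite -mE.
move: A; apply: (@dynkin_induction _ T G0 (fun A => cat (cind (period `&` A)))).
- exact: mE.
- move=> _ _ [x ->] [y ->]; exists (Num.max x y).
  by apply/seteqP; split => z /=; rewrite !in_itv/= !andbT ?gt_max; [move=> [-> ->]|move/andP].
- by rewrite setIT.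
- move=> _ [t ->]; have [tc|tc] := ltrP t c.
    rewrite (_ : _ `&` _ = period)//; apply/seteqP; split => [x []//|x xW]; split => //.
    by move: xW; rewrite /period/= !in_itv/= andbT => /andP[/(lt_le_trans tc)].
  have [ta|ta] := lerP (c + a) t.
    rewrite (_ : _ `&` _ = set0); last first.
      apply/seteqP; split => [x []|//]; rewrite /period/= !in_itv/= andbT.
      by move=> /andP[_ xa] tx; have := lt_trans tx xa; rewrite ltNge ta.
    have := complete_at0 measurable_period lebesgue_period a0 cmeasurable_expW
      sqc_expW expW_orth; congr complete_at; apply/funext => x.
    by rewrite cindF.
  (* For t = c the ray misses only the point c of the period, so its indicator is at L^2 distance 0
     from the indicator of the period. *)
  have [->|tc'] := eqVneq t c; last by apply: complete_ray; rewrite lt_neqAle eq_sym tc' tc.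
  apply: (complete_at_closed measurable_period lebesgue_period a0 cmeasurable_expW
    sqc_expW expW_orth); first by apply: fin; exact: measurable_itv.
  move=> eps eps0; exists (cind period) => //.
  rewrite (_ : nrm2 mu _ = mu [set c]); first by rewrite lebesgue_measure_set1.
  apply: nrm2_indic; first exact: measurable_set1.
  move=> x; rewrite indicE.
  have -> : (x \in [set c]) = (x == c) by apply/idP/eqP => [/set_mem|->]//; exact/mem_set.
  have [->|xc] := eqVneq x c.
    rewrite cindF; last by rewrite /= in_itv/= ltxx => -[].
    rewrite cindT; last by rewrite /period/= in_itv/= lexx ltrDl.
    by rewrite sub0r sqcN sqc1.
  have [xW|xW] := pselect (period x); last by rewrite !cindF ?subrr ?sqc0//; case.
  rewrite !cindT ?subrr ?sqc0//; split => //.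
  move: xW; rewrite /period/= !in_itv/= andbT => /andP[].
  by rewrite le_eqVlt eq_sym (negbTE xc).
- move=> S mS cS; have := cB one cS; congr complete_at; apply/funext => x.
  have [xW|xW] := pselect (period x); last by rewrite !cindF ?subrr//; case.
  rewrite (cindT xW); have [xS|xS] := pselect (S x).
    rewrite [cind (period `&` S) x]cindT; last by split.
    by rewrite subrr cindF// => -[].
  rewrite [cind (period `&` S) x]cindF; last by case.
  by rewrite subr0 cindT.
- move=> F mF tF cF.
  have mU : measurable (\bigcup_n F n) by exact: bigcupT_measurable.
  pose U k := \big[setU/set0]_(i < k) F i.
  have mUk k : measurable (U k) by exact: bigsetU_measurable.
  have UE k x : cind (period `&` U k) x = \sum_(i < k) cind (period `&` F i) x :> R[i].
    elim: k => [|k IH]; first by rewrite /U !big_ord0 cindF// => -[].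
    rewrite big_ord_recr/= -IH.
    have UkP j : U j x <-> exists2 i, (i < j)%N & F i x.
      by rewrite /U -bigcup_mkord; split=> -[i ? ?]; exists i.
    have [xW|xW] := pselect (period x); last first.
      by rewrite !cindF ?addr0//; case.
    have [Fx|Fx] := pselect (F k x).
      rewrite [LHS]cindT; last by split => //; apply/UkP; exists k.
      rewrite [X in X + _]cindF; last first.
        move=> [_] /UkP [i ik Fi]; have ek : i = k by apply: (tF i k) => //; exists x.
        by move: ik; rewrite ek ltnn.
      by rewrite add0r cindT.
    rewrite [X in _ + X]cindF ?addr0; last by case.
    have [Ux|Ux] := pselect (U k x).
      rewrite !cindT//; split => //; apply/UkP; move/UkP: Ux => [i ik Fi].
      by exists i => //; exact: ltnW.
    rewrite !cindF//; first by case.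
    move=> [_ Ux1]; have [i ik Fi] := (UkP k.+1).1 Ux1.
    move: ik; rewrite ltnS leq_eqVlt => /orP[/eqP ik|ik]; first by apply: Fx; rewrite -ik.
    by apply: Ux; apply/UkP; exists i.
  apply: (complete_at_cvg measurable_period lebesgue_period a0 cmeasurable_expW
    sqc_expW expW_orth (h_ := fun k => cind (period `&` U k))
    (G := fun x => \1_period x)).
  + by apply: fin.
  + move=> k; rewrite (_ : cind _ = fun x => \sum_(i < k) cind (period `&` F i) x); last first.
      by apply/funext => x; exact: UE.
    by apply: (complete_at_sum measurable_period lebesgue_period a0 cmeasurable_expW
      sqc_expW expW_orth) => i _; exact: cF.
  + move=> x; have [[n _ Fnx]|nF] := pselect ((\bigcup_n F n) x).
      apply: cvg_near_cst; exists n.+1 => // k /= nk.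
      have [xW|xW] := pselect (period x); last by rewrite !cindF ?subrr ?sqc0//; case.
      rewrite !cindT ?subrr ?sqc0//; split => //; last by exists n.
      by rewrite /U -bigcup_mkord; exists n.
    apply: cvg_near_cst; exists 0%N => // k _.
    rewrite !cindF ?subrr ?sqc0//; last by case.
    by move=> [_]; rewrite /U -bigcup_mkord => -[i _ Fi]; apply: nF; exists i.
  + move=> k x; have [xW|xW] := pselect (period x); last first.
      by rewrite !cindF ?subrr ?sqc0//; case.
    rewrite indicE mem_set// -rmorphB sqcR !indicE.
    by case: (_ \in _); case: (_ \in _);
      rewrite /= ?subrr ?subr0 ?sub0r ?sqrrN ?expr1n ?expr0n/=.
  + exact: integrable_period.
Qed.

Lemma parseval_circle : parseval_system mu period a expW.
Proof.
apply: parseval_of_indicators.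
- exact: measurable_period.
- exact: lebesgue_period.
- exact: a0.
- exact: cmeasurable_expW.
- exact: sqc_expW.
- exact: expW_orth.
- exact: complete_indicator.
Qed.
End circle.

(** * Fourier series on a cube *)

Section vec_measurability.
Context {R : realType} (d : nat) disp (T : measurableType disp).

Lemma measurable_vec (f : T -> vec R d) :
  (forall i, measurable_fun setT (fun x => tnth (f x) i : measurableTypeR R)) ->
  measurable_fun setT f.
Proof. by move=> h; apply/measurable_fun_tnthP. Qed.

Lemma measurable_vec_tnth (f : T -> vec R d) i : measurable_fun setT f ->
  measurable_fun setT (fun x => tnth (f x) i : measurableTypeR R).
Proof. by move=> /measurable_fun_tnthP; exact. Qed.

Lemma measurable_vadd (f g : T -> vec R d) : measurable_fun setT f ->
  measurable_fun setT g -> measurable_fun setT (fun x => vadd (f x) (g x)).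
Proof.
move=> mf mg; apply: measurable_vec => i; under eq_fun do rewrite tnth_mktuple.
by apply: measurable_funD; exact: measurable_vec_tnth.
Qed.
Lemma measurable_vscale (a : R) (f : T -> vec R d) : measurable_fun setT f ->
  measurable_fun setT (fun x => vscale a (f x)).
Proof.
move=> mf; apply: measurable_vec => i; under eq_fun do rewrite tnth_mktuple.
by apply: measurable_funM => //; exact: measurable_vec_tnth.
Qed.
Lemma measurable_vdot (f g : T -> vec R d) : measurable_fun setT f ->
  measurable_fun setT g ->
  measurable_fun setT (fun x => vdot (f x) (g x) : measurableTypeR R).
Proof.
move=> mf mg; apply: measurable_sum => i.
by apply: measurable_funM; exact: measurable_vec_tnth.
Qed.
End vec_measurability.

Section vec_algebra.
Context {R : realType} (d : nat).
Implicit Types x y z : vec R d.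

Lemma vec_ext x y : (forall i, tnth x i = tnth y i) -> x = y.
Proof. exact: eq_from_tnth. Qed.
Lemma vdotDr x y z : vdot x (vadd y z) = vdot x y + vdot x z.
Proof.
by rewrite /vdot -big_split; apply: eq_bigr => i _; rewrite tnth_mktuple mulrDr.
Qed.
Lemma vdotDl x y z : vdot (vadd x y) z = vdot x z + vdot y z.
Proof.
by rewrite /vdot -big_split; apply: eq_bigr => i _; rewrite tnth_mktuple mulrDl.
Qed.
Lemma vdotZr a x y : vdot x (vscale a y) = a * vdot x y.
Proof.
by rewrite /vdot mulr_sumr; apply: eq_bigr => i _; rewrite tnth_mktuple mulrCA.
Qed.
Lemma vdotZl a x y : vdot (vscale a x) y = a * vdot x y.
Proof.
by rewrite /vdot mulr_sumr; apply: eq_bigr => i _; rewrite tnth_mktuple mulrA.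
Qed.
Lemma vdotNr x y : vdot x (vopp y) = - vdot x y.
Proof.
by rewrite /vdot -sumrN; apply: eq_bigr => i _; rewrite tnth_mktuple mulrN.
Qed.
Lemma vdotC x y : vdot x y = vdot y x.
Proof. by apply: eq_bigr => i _; rewrite mulrC. Qed.

Lemma measurable_cube (c : vec R d) l : measurable (cube c l).
Proof.
rewrite (_ : cube c l = \bigcap_(i in [set: 'I_d]) ((@tnth d _)^~ i @^-1`
    `[tnth c i, tnth c i + l[%classic)).
  apply: fin_bigcap_measurable => // i _.
  by rewrite -[X in measurable X]setTI; exact: measurable_tnth.
apply/seteqP; split => x /= h i; first by move=> _; rewrite /= in_itv/=; exact: h.
by have := h i Logic.I; rewrite /= in_itv.
Qed.
End vec_algebra.

Lemma tnth_beheadE (U : Type) n (t : n.+1.-tuple U) i :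
  tnth [tuple of behead t] i = tnth t (lift ord0 i).
Proof. by rewrite [in RHS](tuple_eta t) tnthS. Qed.

Section cube_basis.
Context {R : realType}.

Definition expC d (c : vec R d) (l : R) (k : d.-tuple int) (x : vec R d) : R[i] :=
  cind (cube c l) x * expi2pi (vdot (vint R k) x / l).

Definition vsplit d (t : vec R d.+1) : measurableTypeR R * vec R d :=
  (thead t, [tuple of behead t]).

Lemma vconsK d : cancel (@vcons R d) (@vsplit d).
Proof. by move=> [x y]; rewrite /vsplit /vcons theadE; congr pair; apply/val_inj. Qed.
Lemma measurable_vsplit d : measurable_fun setT (@vsplit d).
Proof.
apply/measurable_fun_pairP; split; first exact: measurable_tnth.
exact: measurable_behead.
Qed.
Lemma lebesgue_vcons d A : measurable A ->
  lebesgue R d.+1 A = pushforward (@lebesgue_measure R \x lebesgue R d)%E (@vcons R d) A.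
Proof. by []. Qed.

Lemma tnth_vconsS d z i : tnth (@vcons R d z) (lift ord0 i) = tnth z.2 i.
Proof. by rewrite /vcons/= tnthS. Qed.

Lemma cube_vsplit d (c : vec R d.+1) l :
  cube c l = @vsplit d @^-1` (period (thead c) l `*` cube [tuple of behead c] l).
Proof.
apply/seteqP; split => x.
  move=> h; split; first by have := h ord0; rewrite /period/= in_itv.
  by move=> i; rewrite !tnth_beheadE; exact: h.
move=> [h1 h2] i; case: (unliftP ord0 i) => [j|] ->.
  by rewrite -!tnth_beheadE; exact: h2.
by move: h1; rewrite /period/= in_itv.
Qed.

Lemma vdot_vcons d (x y : vec R d.+1) :
  vdot x y = thead x * thead y + vdot [tuple of behead x] [tuple of behead y].
Proof.
rewrite /vdot big_ord_recl; congr (_ + _); apply: eq_bigr => i _.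
by rewrite !tnth_beheadE.
Qed.

Lemma vint_cons d (k : d.+1.-tuple int) :
  vint R k = [tuple of (thead k)%:~R :: vint R [tuple of behead k]].
Proof.
apply: eq_from_tnth => i; rewrite tnth_mktuple; case: (unliftP ord0 i) => [j|] ->.
  by rewrite tnthS tnth_mktuple tnth_beheadE.
by [].
Qed.

Lemma parseval_cube0 (c : vec R 0) l : parseval_system (lebesgue R 0) (cube c l) 1 (expC c l).
Proof.
have E k x : expC c l k x = 1.
  rewrite /expC cindT; last by case.
  by rewrite /vdot big_ord0 mul0r expi2pi0 mul1r.
split => //.
- exact: measurable_cube.
- by rewrite /= diracE mem_set//; case.
- by move=> k; rewrite (_ : expC c l k = fun=> 1); [exact: cmeasurable_cst|apply/funext].
- by move=> k x; rewrite E sqc1 indicE mem_set//; case.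
move=> h [mh _] _; rewrite mul1e.
have -> : nrm2 (lebesgue R 0) h = (sqc (h [tuple]))%:E.
  by rewrite /nrm2 /= integral_dirac//= ?diracE ?mem_set ?mul1e//; exact: emeasurable_sqc.
rewrite /fsum (_ : [set: 0.-tuple int] = [set [tuple]]); last first.
  by apply/seteqP; split => // x _; exact: (tuple0 x).
rewrite esum_set1 ?lee_fin ?sqc_ge0//; congr (sqc _)%:E.
rewrite /fcoef; under eq_fun do rewrite E rmorph1 mulr1.
rewrite /cintegral /Rintegral /= !integral_dirac//=.
- by apply: ceqP; rewrite /= indicE mem_set// mul1r.
- by apply/measurable_EFinP; case: mh.
- by apply/measurable_EFinP; case: mh.
Qed.

(** Induction on d: each further coordinate is a tensor factor [parseval_circle], and the product is
    carried to tuples by [vcons]. *)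
Lemma parseval_cube d (c : vec R d) l : 0 < l ->
  parseval_system (lebesgue R d) (cube c l) (l ^+ d) (expC c l).
Proof.
move=> l0; elim: d => [|d IH] in c *; first by rewrite expr0; exact: parseval_cube0.
have P := parseval_tensor (parseval_circle (thead c) l0) (IH [tuple of behead c]).
pose u (k : d.+1.-tuple int) : int * d.-tuple int := (thead k, [tuple of behead k]).
have ub : bijective u.
  exists (fun z : int * d.-tuple int => [tuple of z.1 :: z.2]) => [k|[z1 z2]].
    by rewrite /u/= [RHS]tuple_eta; apply/val_inj.
  by rewrite /u/= theadE; congr pair; apply/val_inj.
have := parseval_transport (@measurable_vcons R d) (@measurable_vsplit d)
  (@vconsK d) (@lebesgue_vcons d) ub P.
rewrite -cube_vsplit exprS.
have -> // : (fun (j : d.+1.-tuple int) (y : vec R d.+1) =>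
    expW (thead c) l (u j).1 (@vsplit d y).1 *
    expC [tuple of behead c] l (u j).2 (@vsplit d y).2) = expC c l.
apply/funext => k; apply/funext => x; rewrite /expW /expC mulrACA -expi2piD.
congr (_ * expi2pi _).
  rewrite cube_vsplit.
  have [h1|h1] := pselect (period (thead c) l (@vsplit d x).1); last first.
    by rewrite (cindF h1) mul0r cindF// => -[].
  have [h2|h2] := pselect (cube [tuple of behead c] l (@vsplit d x).2); last first.
    by rewrite (cindF h2) mulr0 cindF// => -[].
  by rewrite (cindT h1) (cindT h2) mul1r cindT.
by rewrite vdot_vcons vint_cons theadE mulrDl; congr (_ * _ / _ + vdot _ _ / _);
  apply/val_inj.
Qed.
End cube_basis.

(** * Integrals under dilations and translations *)

Section affine.
Context {R : realType}.
Local Notation leb := (@lebesgue_measure R).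

(** Multiplied by a, the pushforward of Lebesgue measure under x |-> a x + b gives each interval ]u,
    w] its length; uniqueness of Lebesgue measure does the rest. *)
Lemma integral_affine1 (a b : R) (f : measurableTypeR R -> \bar R) : 0 < a ->
  measurable_fun setT f -> (forall x, (0 <= f x)%E) ->
  (\int[leb]_x f (a * x + b)%R = (a^-1)%:E * \int[leb]_x f x)%E.
Proof.
move=> a0 mf f0.
pose phi (x : measurableTypeR R) : measurableTypeR R := a * x + b.
have mphi : measurable_fun setT phi.
  by apply: measurable_funD => //; apply: measurable_funM.
pose mu := mscale (NngNum (ltW a0)) (pushforward leb phi).
pose phim := isMeasurableFun.Build _ _ _ _ phi mphi.
pose phiM : {mfun _ >-> _} := HB.pack phi phim.
have E A : measurable A -> leb A = mscale (NngNum (ltW a0)) (pushforward leb phiM) A.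
  apply: lebesgue_measure_unique => _ [[u w] _ <-].
  have pE : phi @^-1` `]u, w] = `](u - b) / a, (w - b) / a]%classic.
    apply/seteqP; split => x /=; rewrite !in_itv/= /phi.
      by rewrite ltr_pdivrMr// ler_pdivlMr// ltrBlDr lerBrDr ![x * a]mulrC.
    by rewrite ltr_pdivrMr// ler_pdivlMr// ltrBlDr lerBrDr ![x * a]mulrC.
  rewrite -[RHS]/(a%:E * leb (phi @^-1` `]u, w]))%E pE.
  rewrite !lebesgue_measure_itv/= !lte_fin.
  rewrite ltr_pM2r ?invr_gt0// ltrD2r; case: ifP => // _; last by rewrite mule0.
  by rewrite -!EFinB -EFinM; congr EFin; field; rewrite gt_eqF.
rewrite [in RHS](eq_measure_integral (mscale (NngNum (ltW a0)) (pushforward leb phiM))); last first.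
  by move=> A mA _; exact: E.
rewrite ge0_integral_mscale// ge0_integral_pushforward//= muleA -EFinM mulVf ?gt_eqF//.
by rewrite mul1e.
Qed.

Lemma integral_vcons d (f : vec R d.+1 -> \bar R) : measurable_fun setT f ->
  (forall x, (0 <= f x)%E) ->
  (\int[lebesgue R d.+1]_x f x =
   \int[leb]_s \int[lebesgue R d]_y f (vcons (s, y)))%E.
Proof.
move=> mf f0; rewrite (ge0_integral_transport (@measurable_vcons R d) (@lebesgue_vcons R d))//.
rewrite fubini_tonelli1//; exact: (measurableT_comp mf (@measurable_vcons R d)).
Qed.

Lemma measurable_integral_vcons d (f : vec R d.+1 -> \bar R) : measurable_fun setT f ->
  (forall x, (0 <= f x)%E) ->
  measurable_fun setT (fun s => \int[lebesgue R d]_y f (vcons (s, y)))%E.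
Proof.
move=> mf f0; apply: (@measurable_fun_fubini_tonelli_F _ _ _ _ R (lebesgue R d)
  (fun z => f (vcons z))) => //.
exact: (measurableT_comp mf (@measurable_vcons R d)).
Qed.

Lemma integral_affine d (a : R) (v : vec R d) (f : vec R d -> \bar R) : 0 < a ->
  measurable_fun setT f -> (forall x, (0 <= f x)%E) ->
  (\int[lebesgue R d]_x f (vadd (vscale a x) v) =
   (a^-1 ^+ d)%:E * \int[lebesgue R d]_x f x)%E.
Proof.
move=> a0; elim: d => [|d IH] in v f *; move=> mf f0.
  rewrite expr0 mul1e; apply: eq_integral => x _; congr f.
  by rewrite tuple0 [RHS]tuple0.
have maff n (w : vec R n) : measurable_fun setT (fun x => vadd (vscale a x) w).
  by apply: measurable_vadd => //; exact: measurable_vscale.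
rewrite !integral_vcons//; last exact: (measurableT_comp mf (maff _ v)).
have E s y : vadd (vscale a (vcons (s, y))) v =
    vcons (a * s + thead v, vadd (vscale a y) [tuple of behead v]).
  apply: eq_from_tnth => i; rewrite !tnth_mktuple; case: (unliftP ord0 i) => [j|] -> //.
  by rewrite !tnth_vconsS/= !tnth_mktuple tnth_beheadE.
under eq_integral => s _.
  under eq_integral => y _ do rewrite E.
  rewrite (IH [tuple of behead v] (fun y => f (vcons (a * s + thead v, y))))//; last first.
    apply: (measurableT_comp mf); apply: (measurableT_comp (@measurable_vcons R d)).
    exact: measurable_pair1.
  over.
have mI := measurable_integral_vcons mf f0.
rewrite (integral_affine1 (thead v)
  (f := fun s => (a^-1 ^+ d)%:E * \int[lebesgue R d]_y f (vcons (s, y)))%E)//; last 2 first.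
- exact: measurable_funeM.
- move=> s; apply: mule_ge0; first by rewrite lee_fin exprn_ge0// invr_ge0 ltW.
  exact: integral_ge0.
rewrite ge0_integralZl//; last 2 first.
- by move=> s _; exact: integral_ge0.
- by rewrite lee_fin exprn_ge0// invr_ge0 ltW.
by rewrite muleA -EFinM exprS.
Qed.
End affine.

(** * Tilings by cubes *)

Section esum_more.
Context {R : realType}.
Local Open Scope ereal_scope.

Lemma esum_unique (I : choiceType) (a : I -> \bar R) i0 : 0 <= a i0 ->
  (forall i, i <> i0 -> a i = 0) -> \esum_(i in [set: I]) a i = a i0.
Proof.
move=> a0 h; rewrite -(esum_set1 a0) [RHS]esum_mkcond.
apply: eq_esum => i _; case: ifPn => //; rewrite notin_setE => ni.
by apply: h => ii0; apply: ni.
Qed.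

Lemma esum_fintype (I : finType) (a : I -> \bar R) : (forall i, 0 <= a i) ->
  \esum_(i in [set: I]) a i = \sum_i a i.
Proof.
move=> a0; rewrite (_ : [set: I] = [set` enum I]); last first.
  by apply/seteqP; split => // i _ /=; rewrite mem_enum.
rewrite esum_fset//; rewrite -fsbig_seq ?enum_uniq//.
by rewrite big_enum.
Qed.
End esum_more.

Section tiling.
Context {R : realType} (d : nat).
Implicit Types (x v : vec R d).

Lemma vaddE x v i : tnth (vadd x v) i = tnth x i + tnth v i.
Proof. by rewrite tnth_mktuple. Qed.
Lemma voppE x i : tnth (vopp x) i = - tnth x i.
Proof. by rewrite tnth_mktuple. Qed.
Lemma vscaleE a x i : tnth (vscale a x) i = a * tnth x i.
Proof. by rewrite tnth_mktuple. Qed.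
Lemma vintE (k : d.-tuple int) i : tnth (vint R k) i = (tnth k i)%:~R.
Proof. by rewrite tnth_mktuple. Qed.
Lemma vordE n (r : d.-tuple 'I_n) i : tnth (vord R r) i = (tnth r i : nat)%:R.
Proof. by rewrite tnth_mktuple. Qed.

Lemma vaddK x v : vadd (vadd x v) (vopp v) = x.
Proof. by apply: vec_ext => i; rewrite !vaddE voppE addrK. Qed.

Lemma integral_translate (v : vec R d) (f : vec R d -> \bar R) :
  measurable_fun setT f -> (forall x, (0 <= f x)%E) ->
  (\int[lebesgue R d]_x f (vadd x v) = \int[lebesgue R d]_x f x)%E.
Proof.
move=> mf f0; have := integral_affine v (@ltr01 R) mf f0.
rewrite invr1 expr1n mul1e => <-; apply: eq_integral => x _; congr (f (vadd _ _)).
by apply: vec_ext => i; rewrite vscaleE mul1r.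
Qed.

(** The first condition keeps every translate D0 + v i inside D, and the second puts each point of D
    in exactly one of them. The indicator of D is then the sum of the indicators of the translates,
    and each term is translated back to D0. *)
Lemma integral_tiling (D D0 : set (vec R d)) (I : countType) (v : I -> vec R d)
    (F : vec R d -> R) : measurable D -> measurable D0 ->
  (forall x i, D0 (vadd x (vopp (v i))) -> D x) ->
  (forall x, D x -> exists i, D0 (vadd x (vopp (v i))) /\
     forall j, D0 (vadd x (vopp (v j))) -> j = i) ->
  measurable_fun setT (F : vec R d -> measurableTypeR R) -> (forall x, 0 <= F x) ->
  (\int[lebesgue R d]_x (\1_D x * F x)%:E =
   \esum_(i in [set: I]) \int[lebesgue R d]_x (\1_D0 x * F (vadd x (v i)))%:E)%E.
Proof.
move=> mD mD0 h1 h2 mF F0.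
have mG i : measurable_fun setT (fun x => (\1_D0 (vadd x (vopp (v i))) * F x)%:E).
  apply/measurable_EFinP; apply: measurable_funM => //.
  apply: measurableT_comp (_ : measurable_fun setT (fun x : vec R d => vadd x (vopp (v i)))).
    exact: measurable_indic.
  by apply: measurable_vadd.
have G0 i x : (0 <= (\1_D0 (vadd x (vopp (v i))) * F x)%:E)%E.
  by rewrite lee_fin mulr_ge0.
transitivity (\int[lebesgue R d]_x
    \esum_(i in [set: I]) (\1_D0 (vadd x (vopp (v i))) * F x)%:E)%E.
  apply: eq_integral => x _; have [Dx|nDx] := pselect (D x).
    have [i [Di ui]] := h2 x Dx.
    rewrite (@esum_unique _ _ _ i)//; last first.
      by move=> j ji; rewrite indicE memNset ?mul0r// => /ui.
    by rewrite !indicE !mem_set.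
  rewrite indicE memNset// mul0r esum1// => i _.
  by rewrite indicE memNset ?mul0r// => /h1.
rewrite integral_esum//; apply: eq_esum => i _.
rewrite -(integral_translate (v i) (mG i))//; apply: eq_integral => x _.
by rewrite vaddK.
Qed.
End tiling.

Lemma floor_unique {R : realType} (u : R) (m : int) :
  m%:~R <= u < m%:~R + 1 -> m = Num.floor u.
Proof. by move=> h; apply/esym/floor_def; rewrite intrD. Qed.

Lemma floor_bounds {R : realType} (u : R) :
  (Num.floor u)%:~R <= u < (Num.floor u)%:~R + 1.
Proof. by have := floor_itv u; rewrite intrD. Qed.

Section tiling_cubes.
Context {R : realType} (d : nat).

(** The translates are by - a k, to match the samples f(x - a k) of the Zak series; this is why the
    tile index is minus a floor. *)
Lemma nrm2_unfold (c : vec R d) (a : R) (f : vec R d -> R[i]) : 0 < a -> cmeasurable f ->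
  nrm2 (lebesgue R d) f = (\esum_(k in [set: d.-tuple int])
    \int[lebesgue R d]_x (\1_(cube c a) x *
       sqc (f (vadd x (vopp (vscale a (vint R k))))))%:E)%E.
Proof.
move=> a0 mf; transitivity (\int[lebesgue R d]_x (\1_[set: vec R d] x * sqc (f x))%:E)%E.
  by apply: eq_integral => x _; rewrite indicT mul1r.
have key x (k : d.-tuple int) :
    cube c a (vadd x (vopp (vopp (vscale a (vint R k))))) <->
    forall i, tnth k i = - Num.floor ((tnth x i - tnth c i) / a).
  split=> h i.
    apply: oppr_inj; rewrite opprK; apply: floor_unique; rewrite mulrNz.
    have := h i; rewrite !vaddE !voppE vscaleE vintE opprK.
    rewrite ler_pdivlMr// ltr_pdivrMr// mulrDl mul1r mulNr (mulrC _ a).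
    by move=> /andP[? ?]; apply/andP; split; lra.
  rewrite !vaddE !voppE vscaleE vintE opprK h mulrNz.
  have := floor_bounds ((tnth x i - tnth c i) / a).
  set w := (_ / a); have aw : a * w = tnth x i - tnth c i by rewrite mulrC divfK// gt_eqF.
  rewrite -(ler_pM2l a0) -(ltr_pM2l a0) aw mulrDr mulr1.
  by move=> /andP[? ?]; apply/andP; split; lra.
apply: integral_tiling => //.
- exact: measurable_cube.
- move=> x _; exists [tuple - Num.floor ((tnth x i - tnth c i) / a) | i < d]; split.
    by apply/key => i; rewrite tnth_mktuple.
  by move=> j /key h; apply: eq_from_tnth => i; rewrite h tnth_mktuple.
- exact: measurable_sqc.
- by move=> x; exact: sqc_ge0.
Qed.

Lemma integral_subcubes (c : vec R d) (l : R) (p : nat) (h : vec R d -> R[i]) :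
  0 < l -> (0 < p)%N -> cmeasurable h ->
  (\int[lebesgue R d]_x (\1_(cube c l) x * sqc (h x))%:E =
   \sum_(s : d.-tuple 'I_p) \int[lebesgue R d]_x (\1_(cube c (l / p%:R)) x *
       sqc (h (vadd x (vscale (l / p%:R) (vord R s)))))%:E)%E.
Proof.
move=> l0 p0 mh; set a := l / p%:R.
have p0' : 0 < p%:R :> R by rewrite ltr0n.
have a0 : 0 < a by rewrite divr_gt0.
have lE : l = a * p%:R by rewrite /a divfK// gt_eqF.
have key x (k : d.-tuple 'I_p) :
    cube c a (vadd x (vopp (vscale a (vord R k)))) <->
    forall i, ((tnth k i : nat) : int) = Num.floor ((tnth x i - tnth c i) / a).
  split=> hk i.
    apply: floor_unique.
    have := hk i; rewrite !vaddE !voppE vscaleE vordE -pmulrn.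
    rewrite ler_pdivlMr// ltr_pdivrMr// mulrDl mul1r (mulrC _ a).
    by move=> /andP[? ?]; apply/andP; split; lra.
  rewrite !vaddE !voppE vscaleE vordE pmulrn hk.
  have := floor_bounds ((tnth x i - tnth c i) / a).
  set w := (_ / a); have aw : a * w = tnth x i - tnth c i by rewrite mulrC divfK// gt_eqF.
  rewrite -(ler_pM2l a0) -(ltr_pM2l a0) aw mulrDr mulr1.
  by move=> /andP[? ?]; apply/andP; split; lra.
rewrite -esum_fintype; last first.
  by move=> s; apply: integral_ge0 => x _; rewrite lee_fin mulr_ge0// sqc_ge0.
apply: integral_tiling => //.
- exact: measurable_cube.
- exact: measurable_cube.
- move=> x s hs i; have := hs i; rewrite !vaddE !voppE vscaleE vordE lE.
  have sp : (tnth s i : nat)%:R + 1 <= p%:R :> R by rewrite natr1 ler_nat ltn_ord.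
  have s0 : 0 <= (tnth s i : nat)%:R :> R by [].
  move=> /andP[h1 h2]; apply/andP; split; nra.
- move=> x Dx.
  have fl i : (Num.trunc ((tnth x i - tnth c i) / a) < p)%N.
    have := Dx i => /andP[h1 h2].
    rewrite truncn_lt_nat; last by rewrite divr_ge0 ?subr_ge0// ltW.
    by rewrite ltr_pdivrMr// mulrC -lE ltrBlDl.
  exists [tuple Ordinal (fl i) | i < d]; split.
    apply/key => i; have /andP[h1 _] := Dx i.
    have u0 : 0 <= (tnth x i - tnth c i) / a by rewrite divr_ge0 ?subr_ge0// ltW.
    by rewrite tnth_mktuple/= truncn_floor u0 gez0_abs// floor_ge0.
  move=> j /key hj; apply: eq_from_tnth => i; apply/val_inj; rewrite tnth_mktuple/=.
  apply/eqP; rewrite -eqz_nat hj; apply/eqP.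
  have /andP[h1 _] := Dx i.
  have u0 : 0 <= (tnth x i - tnth c i) / a by rewrite divr_ge0 ?subr_ge0// ltW.
  by rewrite truncn_floor u0 gez0_abs// floor_ge0.
- exact: measurable_sqc.
- by move=> x; exact: sqc_ge0.
Qed.

Lemma measure_affine (a : R) (v : vec R d) (A : set (vec R d)) :
  0 < a -> measurable A ->
  lebesgue R d ((fun x => vadd (vscale a x) v) @^-1` A) = ((a^-1 ^+ d)%:E * lebesgue R d A)%E.
Proof.
move=> a0 mA; have maff : measurable_fun setT (fun x : vec R d => vadd (vscale a x) v).
  by apply: measurable_vadd => //; exact: measurable_vscale.
have mpA : measurable ((fun x => vadd (vscale a x) v) @^-1` A).
  by rewrite -[X in measurable X]setTI; exact: maff.
rewrite -[X in lebesgue R d X = _]setIT -[X in (_ * lebesgue R d X)%E]setIT.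
rewrite -!integral_indic//.
rewrite -(integral_affine v a0 (f := fun x => (\1_A x)%:E))//.
by apply/measurable_EFinP; exact: measurable_indic.
Qed.

Lemma ae_affine (a : R) (v : vec R d) (P : vec R d -> Prop) : 0 < a ->
  {ae lebesgue R d, forall x, P x} ->
  {ae lebesgue R d, forall x, P (vadd (vscale a x) v)}.
Proof.
move=> a0 [N [mN N0 sN]].
exists ((fun x => vadd (vscale a x) v) @^-1` N); split.
- rewrite -[X in measurable X]setTI; apply: measurable_vadd => //.
  exact: measurable_vscale.
- by rewrite (measure_affine v a0 mN) N0 mule0.
- by move=> x nP; apply: sN.
Qed.

Lemma ae_translate (v : vec R d) (P : vec R d -> Prop) :
  {ae lebesgue R d, forall x, P x} -> {ae lebesgue R d, forall x, P (vadd x v)}.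
Proof.
move=> /(ae_affine v (@ltr01 R)); apply: filterS => x.
congr (P (vadd _ _)); apply: vec_ext => i; by rewrite vscaleE mul1r.
Qed.

End tiling_cubes.

(** * Existence of the Zak transform *)

Section parseval_consequences.
Context {R : realType} disp (T : measurableType disp) (mu : {measure set T -> \bar R}).
Variables (W : set T) (v : R) (I : countType) (e : I -> T -> R[i]).
Hypothesis P : parseval_system mu W v e.

Let v0 := ps_gt0 P.
Let mW := ps_measurable P.
Let muW := ps_measure P.
Let me := ps_cmeasurable P.
Let e1 := ps_sqc P.

Lemma ps_L2m_e i : L2m mu (e i).
Proof. exact: (L2m_e mW muW me e1). Qed.

Lemma ps_eW i x : ~ W x -> e i x = 0.
Proof.
move=> nW; have := e1 i x; rewrite indicE memNset// /sqc => /eqP.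
rewrite paddr_eq0 ?sqr_ge0// !sqrf_eq0 => /andP[/eqP h1 /eqP h2].
exact: ceqP.
Qed.

(* Parseval's identity for [e i] itself already forces orthogonality, since the
   [i]-th term exhausts the sum. *)
Lemma ps_orth i j : i != j -> fcoef mu e (e i) j = 0.
Proof.
move=> ij; have := ps_eq P (ps_L2m_e i) (@ps_eW i).
rewrite (nrm2_e mW muW e1) -EFinM => hs.
have := @ge_esum_seq R I (fun k => (sqc (fcoef mu e (e i) k))%:E) [:: i; j].
rewrite !big_cons big_nil adde0 -/(fsum mu e (e i)) hs (fcoef_ee mW muW e1) sqcR.
have h0 (k : I) : (0 <= (sqc (fcoef mu e (e i) k))%:E)%E by rewrite lee_fin sqc_ge0.
move=> /(_ h0); rewrite /= inE ij => /(_ isT).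
rewrite -EFinD lee_fin -expr2 gerDl => h; have := sqc_ge0 (fcoef mu e (e i) j).
move=> h'; have /eqP : sqc (fcoef mu e (e i) j) = 0 by apply/eqP; rewrite eq_le h h'.
rewrite paddr_eq0 ?sqr_ge0// !sqrf_eq0 => /andP[/eqP h1 /eqP h2].
exact: ceqP.
Qed.

Lemma fcoef_lincomb (u : I -> R[i]) (s : seq I) j : uniq s ->
  fcoef mu e (fun x => \sum_(k <- s) u k * e k x) j =
  (if j \in s then u j else 0) * v%:C%C.
Proof.
have L k : L2m mu (fun x => u k * e k x) by apply: L2mZ; exact: ps_L2m_e.
elim: s => [_|k s IH /= /andP[ks us]].
  rewrite mul0r /fcoef; under eq_fun do rewrite big_nil mul0r.
  by rewrite /cintegral !Rintegral_cst//= !mul0r.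
under eq_fun do rewrite big_cons.
rewrite (fcoefD mW muW me e1)//; last exact: L2m_sum.
rewrite (fcoefZ mW muW me e1); last exact: ps_L2m_e.
rewrite IH// inE; have [jk|jk] := eqVneq j k.
  by rewrite jk (negbTE ks) mul0r addr0 (fcoef_ee mW muW e1).
by rewrite ps_orth ?mulr0 ?add0r// eq_sym.
Qed.

(** [(+)] is exclusive or: common terms cancel, so the distance between two partial sums is carried
    by the symmetric difference of their index lists. *)
Lemma nrm2_lincombB (u : I -> R[i]) (s t : seq I) : uniq s -> uniq t ->
  nrm2 mu (fun x => \sum_(k <- s) u k * e k x - \sum_(k <- t) u k * e k x) =
  (v%:E * \esum_(k in [set: I]) (((k \in s) (+) (k \in t))%:R * sqc (u k))%:E)%E.
Proof.
move=> us ut; set h := (X in nrm2 _ X).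
have Ls w : L2m mu (fun x => \sum_(k <- w) u k * e k x).
  by apply: L2m_sum => k; apply: L2mZ; exact: ps_L2m_e.
have Lh : L2m mu h by exact: L2mB.
have hW x : ~ W x -> h x = 0.
  by move=> nW; rewrite /h !big1 ?subrr// => k _; rewrite ps_eW// mulr0.
have := ps_eq P Lh hW; rewrite /fsum.
under eq_esum => k _.
  rewrite (fcoefB mW muW me e1)// !fcoef_lincomb// -mulrBl sqcM sqcR.
  have -> : sqc ((if k \in s then u k else 0) - (if k \in t then u k else 0)) * v ^+ 2
     = v ^+ 2 * (((k \in s) (+) (k \in t))%:R * sqc (u k)).
    rewrite [LHS]mulrC; congr (_ * _); case: (k \in s); case: (k \in t);
      by rewrite /= ?subrr ?subr0 ?sub0r ?sqcN ?sqc0 ?mul1r ?mul0r.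
  rewrite EFinM.
  over.
rewrite ge0_esumZ ?sqr_ge0//; last first.
  by move=> k; rewrite lee_fin mulr_ge0// sqc_ge0.
move=> /(congr1 (fun z => (v^-1%:E * z)%E)).
by rewrite !muleA -!EFinM mulVf ?gt_eqF// mul1e expr2 mulrA mulVf ?gt_eqF// mul1r => ->.
Qed.

Lemma ps_coef_le h i : L2m mu h -> (forall x, ~ W x -> h x = 0) ->
  ((sqc (fcoef mu e h i))%:E <= v%:E * nrm2 mu h)%E.
Proof.
move=> hi hW; rewrite -(ps_eq P)//.
have := @ge_esum_seq R I (fun k => (sqc (fcoef mu e h k))%:E) [:: i].
by rewrite big_cons big_nil adde0; apply => // k; rewrite lee_fin sqc_ge0.
Qed.
End parseval_consequences.

(** * Initial segments of a countable type and tails of summable families *)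

Section initial_segments.
Context (I : countType).

Definition seg n : seq I := pmap (@pickle_inv I) (iota 0 n).

Lemma mem_seg n i : (i \in seg n) = (choice.pickle i < n)%N.
Proof.
rewrite /seg mem_pmap; apply/mapP/idP => [[m]|h].
  rewrite mem_iota add0n /= => mn im.
  by have := @pickle_invK I m; rewrite /ocancel -im /= => ->.
by exists (choice.pickle i); rewrite ?mem_iota ?add0n ?pickleK_inv.
Qed.
Lemma uniq_seg n : uniq (seg n).
Proof.
rewrite /seg; apply: (pmap_uniq (g := choice.pickle)); last exact: iota_uniq.
exact: pickle_invK.
Qed.
Lemma big_seg (V : nmodType) n (F : I -> V) :
  \sum_(i <- seg n) F i = \sum_(m < n) oapp F 0 (pickle_inv m).
Proof.
rewrite -(big_mkord xpredT (fun m => oapp F 0 (@pickle_inv I m))) /seg /index_iota subn0.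
elim: (iota 0 n) => [|m s IH]; first by rewrite !big_nil.
by rewrite /= big_cons -IH; case: (pickle_inv m) => [i|]/=; rewrite ?big_cons ?add0r.
Qed.

Context {R : realType}.
Definition tail (w : I -> R) n : \bar R :=
  \esum_(i in [set: I]) ((n <= choice.pickle i)%N%:R * w i)%:E.

Lemma tail_ge0 w n : (forall i, 0 <= w i) -> (0 <= tail w n)%E.
Proof. by move=> w0; apply: esum_ge0 => i _; rewrite lee_fin mulr_ge0. Qed.

Lemma tail_nincr w m n : (forall i, 0 <= w i) -> (m <= n)%N -> (tail w n <= tail w m)%E.
Proof.
move=> w0 mn; apply: le_esum => i _; rewrite lee_fin ler_wpM2r// ler_nat.
by case: (leqP n _) => // /(leq_trans mn) ->.
Qed.

(** Some finite subset has a sum within eps of the total; taking n beyond all its codes removes that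
    subset from the tail. *)
Lemma tail_cvg w eps : (forall i, 0 <= w i) -> (tail w 0 < +oo)%E -> 0 < eps ->
  exists n, (tail w n < eps%:E)%E.
Proof.
move=> w0 wf eps0; have tf : tail w 0 \is a fin_num by rewrite ge0_fin_numE// tail_ge0.
have [_ [X [finX _] <-] hX] := @ub_ereal_sup_adherent R _ eps eps0 tf.
pose n := (\max_(i <- fset_set X) choice.pickle i).+1.
exists n.
have E : tail w 0 = (tail w n + \esum_(i in [set: I]) ((choice.pickle i < n)%N%:R * w i)%:E)%E.
  rewrite /tail -esumD; last 2 first.
  - by move=> i _; rewrite lee_fin mulr_ge0.
  - by move=> i _; rewrite lee_fin mulr_ge0.
  apply: eq_esum => i _; rewrite -EFinD -mulrDl -natrD; congr (_%:R * _)%:E.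
  by rewrite leq0n; case: leqP.
have hF : (\sum_(i \in X) ((0 <= choice.pickle i)%N%:R * w i)%:E <=
    \esum_(i in [set: I]) ((choice.pickle i < n)%N%:R * w i)%:E)%E.
  apply: esum_ge; exists X; first by split.
  apply: lee_fsum => // i Xi; rewrite lee_fin leq0n.
  suff -> : (choice.pickle i < n)%N by [].
  by rewrite ltnS; apply: leq_bigmax_seq => //; rewrite in_fset_set// mem_set.
move: hX; rewrite -/(esum _ _) -/(tail w 0) => hX.
have t1 : tail w n \is a fin_num.
  by rewrite ge0_fin_numE ?tail_ge0//; apply: le_lt_trans wf; exact: tail_nincr.
have t2 : \esum_(i in [set: I]) ((choice.pickle i < n)%N%:R * w i)%:E \is a fin_num.
  rewrite ge0_fin_numE; last by apply: esum_ge0 => i _; rewrite lee_fin mulr_ge0.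
  apply: le_lt_trans wf; apply: le_esum => i _; rewrite lee_fin ler_wpM2r// leq0n.
  by case: (_ < _)%N.
move: E hX hF => ->; move: (fineK t1) (fineK t2) => <- <-.
move: (fine _) (fine _) => a b hX hF.
have h := lt_le_trans hX hF.
have : b + a - eps < a by rewrite -lte_fin; exact: h.
by rewrite lte_fin; lra.
Qed.
End initial_segments.

Section telescoping.
Context {R : realType}.

Lemma cvgn_bounded_variation (r : nat -> R) (M : R) :
  (forall n, \sum_(i < n) `|r i.+1 - r i| <= M) -> cvgn r.
Proof.
move=> hM.
have c1 : cvgn (series (fun i => `|r i.+1 - r i|)).
  apply: nondecreasing_is_cvgn.
    apply/nondecreasing_seqP => n; rewrite /series/= big_nat_recr//=.
    by rewrite lerDl.
  by exists M => _ [n _ <-]; rewrite /series/= big_mkord.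
have c2 : cvgn (series (fun i => r i.+1 - r i)) by exact: normed_cvg.
have E : r = (fun n => r 0%N + series (fun i => r i.+1 - r i) n).
  by apply/funext => n; rewrite /series/= telescope_sumr// addrC subrK.
by rewrite E; apply: is_cvgD => //; exact: is_cvg_cst.
Qed.
End telescoping.

Section fatou_nrm2.
Context {R : realType} disp (T : measurableType disp) (mu : {measure set T -> \bar R}).

Lemma limn_einf_le (u : (\bar R)^nat) M : (forall n, u n <= M)%E -> (limn_einf u <= M)%E.
Proof.
move=> h; rewrite limn_einf_lim; apply: lime_le; first exact: is_cvg_einfs.
by apply: nearW => n; apply: le_trans (h n); apply: ereal_inf_lbound; exists n => /=.
Qed.

Lemma nrm2_fatou (h_ : nat -> T -> R[i]) (h : T -> R[i]) M :
  (forall j, cmeasurable (h_ j)) -> cmeasurable h ->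
  (forall j, (nrm2 mu (h_ j) <= M)%E) ->
  {ae mu, forall x, (cRe (h_ j x) @[j --> \oo] --> cRe (h x)) /\
                    (cIm (h_ j x) @[j --> \oo] --> cIm (h x))} ->
  (nrm2 mu h <= M)%E.
Proof.
move=> mh_ mh hM cvh.
apply: le_trans (limn_einf_le hM).
apply: le_trans (fatou mu measurableT _ _); last 2 first.
- by move=> j; exact: emeasurable_sqc.
- by move=> j x _; rewrite lee_fin sqc_ge0.
have me : measurable_fun setT (fun x => limn_einf (fun j => (sqc (h_ j x))%:E)).
  rewrite /limn_einf; apply: measurableT_comp => //.
  apply: measurable_fun_limn_esup => j; apply: measurableT_comp => //.
  exact: emeasurable_sqc.
apply: ae_ge0_le_integral => //.
- by move=> x _; rewrite lee_fin sqc_ge0.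
- exact: emeasurable_sqc.
- move=> x _; rewrite limn_einf_lim; apply: lime_ge; first exact: is_cvg_einfs.
  apply: nearW => n; apply: le_ereal_inf_tmp => _ [k _ <-].
  by rewrite lee_fin sqc_ge0.
- apply: filterS cvh => x [c1 c2] _.
  have c : (sqc (h_ j x))%:E @[j --> \oo] --> (sqc (h x))%:E.
    apply: cvg_EFin; first exact: nearW.
    by apply: cvgD; apply: cvgM.
  by rewrite (is_cvg_limn_einfE _) ?(cvg_lim _ c)//; apply/cvg_ex; eexists; exact: c.
Qed.
End fatou_nrm2.

(** * Convergence of Zak series for fixed coefficients *)

Section zak_series.
Context {R : realType} (d : nat) (a : R) (a0 : 0 < a).
Local Notation K := (d.-tuple int).
Local Notation leb := (lebesgue R d).

Definition zexp (k : K) (xi : vec R d) : R[i] := expi2pi (a * vdot (vint R k) xi).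
Definition zsample (f : vec R d -> R[i]) (x : vec R d) (k : K) : R[i] :=
  f (vadd x (vopp (vscale a (vint R k)))).

Lemma cind_zexp c k xi : cind (cube c a^-1) xi * zexp k xi = expC c a^-1 k xi.
Proof. by rewrite /expC invrK (mulrC _ a). Qed.

Lemma cmeasurable_zexp k : cmeasurable (zexp k).
Proof.
apply: cmeasurable_expi2pi; apply: measurable_funM => //.
apply: (@measurable_vdot _ _ _ _ (fun=> _) id); first exact: measurable_cst.
exact: measurable_id.
Qed.

Let ai0 : 0 < a^-1. Proof. by rewrite invr_gt0. Qed.
Let vol : R := a^-1 ^+ d.
Let vol0 : 0 < vol. Proof. by rewrite exprn_gt0. Qed.

Section fixed_coefficients.
Variable u : K -> R[i].
Let w k := sqc (u k).
Let w0 k : 0 <= w k. Proof. exact: sqc_ge0. Qed.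

Definition zpart (s : seq K) xi := \sum_(k <- s) u k * zexp k xi.

Lemma cmeasurable_zpart s : cmeasurable (zpart s).
Proof.
apply: cmeasurable_sum => k; apply: cmeasurableM; first exact: cmeasurable_cst.
exact: cmeasurable_zexp.
Qed.

Lemma cind_zpart c s xi :
  cind (cube c a^-1) xi * zpart s xi = \sum_(k <- s) u k * expC c a^-1 k xi.
Proof. by rewrite mulr_sumr; apply: eq_bigr => k _; rewrite mulrCA cind_zexp. Qed.

(** An index that lies in only one of the lists has code at least m or at least n, so the symmetric
    difference is dominated by the two tails. *)
Lemma nrm2_zpartB c (s t : seq K) m n : uniq s -> uniq t ->
  (forall k, (choice.pickle k < m)%N -> k \in s) ->
  (forall k, (choice.pickle k < n)%N -> k \in t) ->
  (nrm2 leb (fun xi => cind (cube c a^-1) xi * (zpart s xi - zpart t xi))%R <=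
   vol%:E * (tail w m + tail w n))%E.
Proof.
move=> us ut hs ht.
have -> : (fun xi => cind (cube c a^-1) xi * (zpart s xi - zpart t xi)) =
   (fun xi => \sum_(k <- s) u k * expC c a^-1 k xi - \sum_(k <- t) u k * expC c a^-1 k xi).
  by apply/funext => xi; rewrite mulrBr !cind_zpart.
rewrite (nrm2_lincombB (parseval_cube c ai0))// lee_pmul2l// /tail -esumD; last 2 first.
- by move=> i _; rewrite lee_fin mulr_ge0.
- by move=> i _; rewrite lee_fin mulr_ge0.
apply: le_esum => k _; rewrite -EFinD lee_fin -mulrDl ler_wpM2r ?sqc_ge0//.
have [ks|ks] := boolP (k \in s); have [kt|kt] := boolP (k \in t); rewrite /= ?addr_ge0//.
  rewrite [(n <= _)%N](_ : _ = true) ?lerDr// leqNgt.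
  by apply: contraNN kt; exact: ht.
rewrite [(m <= _)%N](_ : _ = true) ?lerDl// leqNgt.
by apply: contraNN ks; exact: hs.
Qed.

Variable n_ : nat -> nat.
Hypothesis nd_n : forall j, (n_ j <= n_ j.+1)%N.
Hypothesis tail_n : forall j, (tail w (n_ j) < (2^-1 ^+ j * 2^-1 ^+ j)%:E)%E.

(** Tails below 4^-j make consecutive partial sums differ by O(2^-j) in L^2 of the cell. The total
    variation of the sequence is then dominated by an integrable function, hence finite almost
    everywhere, and bounded variation implies convergence. *)
Lemma zpart_cvg c : {ae leb, forall xi, cube c a^-1 xi ->
  cvgn (fun j => cRe (zpart (seg K (n_ j)) xi)) /\
  cvgn (fun j => cIm (zpart (seg K (n_ j)) xi))}.
Proof.
pose W := cube c a^-1.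
pose de j xi := cind W xi * (zpart (seg K (n_ j.+1)) xi - zpart (seg K (n_ j)) xi).
have mW : measurable W by exact: measurable_cube.
have lW : leb W = vol%:E := ps_measure (parseval_cube c ai0).
have mde j : cmeasurable (de j).
  apply: cmeasurableM; first exact: cmeasurable_cind.
  by apply: cmeasurableB; exact: cmeasurable_zpart.
have h0 j : 0 <= (2^-1 : R) ^+ j by rewrite exprn_ge0.
have g0 j : 0 < (2 : R) ^+ j by rewrite exprn_gt0.
have hg j : (2^-1 : R) ^+ j * 2 ^+ j = 1 by rewrite -exprMn mulVf ?expr1n.
have nde j : (nrm2 leb (de j) <= (2%:R * vol * (2^-1 ^+ j * 2^-1 ^+ j))%:E)%E.
  have := nrm2_zpartB c (m := n_ j.+1) (n := n_ j) (uniq_seg K (n_ j.+1)) (uniq_seg K (n_ j)).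
  move=> /(_ (fun k => _) (fun k => _))H; apply: le_trans (H _ _) _.
  - by move=> k; rewrite mem_seg.
  - by move=> k; rewrite mem_seg.
  rewrite (mulrC 2%:R) -mulrA EFinM lee_pmul2l// mulr_natl mulr2n EFinD.
  apply: leeD; last exact/ltW.
  by apply: le_trans (ltW (tail_n j)); exact: tail_nincr.
(* The weighted inequality t <= 2^-j + 2^j t^2 bounds an increment of size t by [ph j]. Both parts
   have integral O(2^-j), the second because the squared norm of the increment is O(4^-j). *)
pose ph j (xi : vec R d) : \bar R := (2^-1 ^+ j * \1_W xi + 2 ^+ j * sqc (de j xi))%:E.
have ph0 j xi : (0 <= ph j xi)%E.
  by rewrite lee_fin addr_ge0// mulr_ge0 ?sqc_ge0// ltW.
have mph j : measurable_fun setT (ph j).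
  apply/measurable_EFinP; apply: measurable_funD; apply: measurable_funM => //.
  exact: measurable_sqc.
pose Ph xi := (\sum_(j <oo) ph j xi)%E.
have mPh : measurable_fun setT Ph.
  by apply: ge0_emeasurable_sum => j.
have Ph0 xi : (0 <= Ph xi)%E by exact: nneseries_ge0.
have iph j : (\int[leb]_xi ph j xi <= (2^-1 ^+ j * (3%:R * vol))%:E)%E.
  rewrite /ph; under eq_integral do rewrite EFinD !EFinM.
  have m1 : measurable_fun setT (fun xi => ((2^-1 : R) ^+ j)%:E * (\1_W xi)%:E)%E.
    by apply: measurable_funeM; apply/measurable_EFinP; exact: measurable_indic.
  have m2 : measurable_fun setT (fun xi => ((2 : R) ^+ j)%:E * (sqc (de j xi))%:E)%E.
    by apply: measurable_funeM; exact: emeasurable_sqc.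
  rewrite ge0_integralD//; last by move=> x _; rewrite mule_ge0 ?lee_fin ?sqc_ge0// ltW.
  have -> : (\int[leb]_x (((2 : R) ^+ j)%:E * (sqc (de j x))%:E) =
      ((2 : R) ^+ j)%:E * nrm2 leb (de j))%E.
    apply: ge0_integralZl => //.
    - exact: emeasurable_sqc.
    - by move=> x _; rewrite lee_fin sqc_ge0.
  have -> : (\int[leb]_x (((2^-1 : R) ^+ j)%:E * (\1_W x)%:E) =
      ((2^-1 : R) ^+ j)%:E * leb W)%E.
    rewrite ge0_integralZl//; first by rewrite integral_indic// setIT.
    by apply/measurable_EFinP; exact: measurable_indic.
  apply: (@le_trans _ _ ((2^-1 ^+ j)%:E * vol%:E +
     (2 ^+ j)%:E * (2%:R * vol * (2^-1 ^+ j * 2^-1 ^+ j))%:E)%E).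
    apply: leeD; first by rewrite lee_pmul2l ?lee_fin ?exprn_gt0//; move: lW => /= ->.
    by rewrite lee_pmul2l// nde.
  rewrite -!EFinM -EFinD lee_fin.
  have -> : 2 ^+ j * (2%:R * vol * (2^-1 ^+ j * 2^-1 ^+ j)) = 2%:R * vol * 2^-1 ^+ j.
    have := hg j; move: (2^-1 ^+ j) (2 ^+ j) => y z yz.
    by transitivity (2%:R * vol * y * (y * z)); [ring|rewrite yz mulr1].
  by rewrite le_eqVlt; apply/orP; left; apply/eqP; ring.
have iPh : leb.-integrable setT Ph.
  apply/integrableP; split => //; under eq_integral do rewrite gee0_abs//.
  rewrite integral_nneseries//.
  apply: (@le_lt_trans _ _ (6%:R * vol)%:E); last exact: ltry.
  apply: lime_le.
    by apply: is_cvg_nneseries => j _ _; exact: integral_ge0.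
  apply: nearW => n.
  apply: (@le_trans _ _ (\sum_(0 <= j < n) (2^-1 ^+ j * (3%:R * vol))%:E)%E).
    by apply: lee_sum => j _; exact: iph.
  rewrite sumEFin lee_fin -mulr_suml.
  have -> : \sum_(0 <= j < n) (2^-1 : R) ^+ j = 2 - 2 * 2^-1 ^+ n.
    elim: n => [|n IH]; first by rewrite big_nil expr0; lra.
    by rewrite big_nat_recr//= IH exprS; field.
  have := h0 n; move: (2^-1 ^+ n) => z z0.
  have := mulr_ge0 z0 (ltW vol0); lra.
apply: filterS (integrable_ae measurableT iPh) => xi /(_ Logic.I) fPh xiW.
have part (F : R[i] -> R) : (forall z w, F (z - w) = F z - F w) ->
    (forall z, F z ^+ 2 <= sqc z) ->
    cvgn (fun j => F (zpart (seg K (n_ j)) xi)).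
  move=> FB Fs; apply: (@cvgn_bounded_variation _ _ (fine (Ph xi))) => n.
  rewrite -lee_fin fineK// -sumEFin.
  apply: le_trans (nneseries_lim_ge (P := xpredT) (u_ := fun j => ph j xi) n _) => //.
  rewrite big_mkord; apply: lee_sum => j _; rewrite lee_fin -FB.
  rewrite indicE mem_set// mulr1.
  have -> : de j xi = zpart (seg K (n_ j.+1)) xi - zpart (seg K (n_ j)) xi.
    by rewrite /de cindT// mul1r.
  move: (_ - _) => z; have := Fs z; rewrite -(real_normK (num_real (F z))).
  set t := `|F z| => tz.
  apply: (@le_trans _ _ (2^-1 ^+ j + 2 ^+ j * t ^+ 2)); last first.
    by rewrite lerD2l ler_pM2l.
  have := hg j; have := h0 j; have := g0 j; move: (2^-1 ^+ j) (2 ^+ j) => x y y0 x0 xy.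
  rewrite -(ler_pM2l y0) mulrDr (mulrC y x) xy.
  have := sqr_ge0 (y * t - 2^-1); rewrite !expr2; nra.
split; apply: part.
- by move=> z z'; rewrite ReD ReN.
- by move=> z; rewrite lerDl sqr_ge0.
- by move=> z z'; rewrite ImD ImN.
- by move=> z; rewrite lerDr sqr_ge0.
Qed.

(** Fatou's lemma along the subsequence: the j-th partial sum is at squared distance at most vol
    (tail m + 4^-j) from [zpart s]. The sequence is started late enough for the second term to stay
    below eps. *)
Lemma zpart_limit c (Z : vec R d -> R[i]) : cmeasurable Z ->
  {ae leb, forall xi, cube c a^-1 xi ->
    (cRe (zpart (seg K (n_ j)) xi) @[j --> \oo] --> cRe (Z xi)) /\
    (cIm (zpart (seg K (n_ j)) xi) @[j --> \oo] --> cIm (Z xi))} ->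
  forall (s : seq K) m, uniq s -> (forall k, (choice.pickle k < m)%N -> k \in s) ->
  (nrm2 leb (fun xi => cind (cube c a^-1) xi * (Z xi - zpart s xi))%R <=
   vol%:E * tail w m)%E.
Proof.
move=> mZ cvZ s m us hs.
have mW := @measurable_cube R d c a^-1.
apply/lee_addgt0Pr => eps eps0.
have [j0 hj0] : exists j0 : nat, forall j, (j0 <= j)%N ->
    vol * (2^-1 ^+ j * 2^-1 ^+ j) <= eps.
  have c1 : vol * (2^-1 ^+ j * 2^-1 ^+ j) @[j --> \oo] --> vol * (0 * 0).
    have ch : (2^-1 : R) ^+ j @[j --> \oo] --> 0.
      by apply: cvg_expr; rewrite ger0_norm//; lra.
    by apply: cvgM; [exact: cvg_cst|exact: cvgM].
  rewrite !mulr0 in c1; have /cvgr0Pnorm_lt /(_ eps eps0) [j0 _ hj] := c1.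
  by exists j0 => j /hj /= /ltW; apply: le_trans; exact: ler_norm.
apply: (@nrm2_fatou _ _ _ _ (fun j xi => cind (cube c a^-1) xi *
   (zpart (seg K (n_ (j + j0)%N)) xi - zpart s xi))).
- move=> j; apply: cmeasurableM; first exact: cmeasurable_cind.
  by apply: cmeasurableB; exact: cmeasurable_zpart.
- apply: cmeasurableM; first exact: cmeasurable_cind.
  by apply: cmeasurableB => //; exact: cmeasurable_zpart.
- move=> j; apply: le_trans (nrm2_zpartB c (n := m) (m := n_ (j + j0)) (uniq_seg K _) us _ hs) _.
    by move=> k; rewrite mem_seg.
  have tf : (0 <= tail w m)%E by exact: tail_ge0.
  rewrite ge0_muleDr ?tail_ge0// addeC; apply: leeD => //.
  apply: le_trans (_ : (vol%:E * (2^-1 ^+ (j + j0) * 2^-1 ^+ (j + j0))%:E <= _)%E).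
    by rewrite lee_pmul2l//; exact/ltW.
  by rewrite -EFinM lee_fin; apply: hj0; exact: leq_addl.
- apply: filterS cvZ => xi h.
  have [xiW|xiW] := pselect (cube c a^-1 xi); last first.
    by rewrite cindF// !mul0r; split; under eq_fun do rewrite mul0r; exact: cvg_cst.
  have [c1 c2] := h xiW; rewrite cindT// !mul1r; split.
    under eq_fun do rewrite mul1r ReD ReN; rewrite ReD ReN.
    by apply: cvgB; [rewrite (@cvg_shiftn j0 _ (fun j => cRe (zpart (seg K (n_ j)) xi)))|exact: cvg_cst].
  under eq_fun do rewrite mul1r ImD ImN; rewrite ImD ImN.
  by apply: cvgB; [rewrite (@cvg_shiftn j0 _ (fun j => cIm (zpart (seg K (n_ j)) xi)))|exact: cvg_cst].
Qed.
End fixed_coefficients.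
End zak_series.

Lemma ae_forall_count {R : realType} disp (T : measurableType disp)
    (mu : {measure set T -> \bar R}) (I : countType) (P : I -> T -> Prop) :
  (forall i, {ae mu, forall x, P i x}) -> {ae mu, forall x, forall i, P i x}.
Proof.
move=> h; have h' n : {ae mu, forall x, if pickle_inv n is Some i then P i x else True}.
  by case: (pickle_inv n) => [i|]; [exact: h|exact: aeW].
apply: filterS (ae_foralln h') => x hx i; have := hx (choice.pickle i).
by rewrite pickleK_inv.
Qed.

Section norms.
Context {R : realType} (d : nat).
Local Notation leb := (lebesgue R d).

Lemma sqnorm_onE (D : set (vec R d)) (h : vec R d -> R[i]) : measurable D ->
  sqnorm_on D h = nrm2 leb (fun x => cind D x * h x).
Proof.
move=> mD; rewrite /sqnorm_on integral_mkcond; apply: eq_integral => x _.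
rewrite /patch sqcM sqc_cind indicE; case: ifP => _; last by rewrite mul0r.
by rewrite mul1r normc_sqr.
Qed.
Lemma sqnormE (h : vec R d -> R[i]) : sqnorm h = nrm2 leb h.
Proof. by rewrite /sqnorm /sqnorm_on; apply: eq_integral => x _; rewrite normc_sqr. Qed.
Lemma L2_L2m (h : vec R d -> R[i]) : L2 h <-> L2m leb h.
Proof. by rewrite /L2 /L2m sqnormE. Qed.

Lemma measurable_shift (v : vec R d) : measurable_fun setT (fun x => vadd x v).
Proof. exact: measurable_vadd. Qed.

Lemma cmeasurable_zsample (a : R) (f : vec R d -> R[i]) k : cmeasurable f ->
  cmeasurable (fun x => zsample a f x k).
Proof. by move=> mf; exact: (cmeasurable_comp mf (measurable_shift _)). Qed.
End norms.

Section zak_existence.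
Context {R : realType} (d : nat) (a : R) (a0 : 0 < a).
Local Notation K := (d.-tuple int).
Local Notation leb := (lebesgue R d).
Variable f : vec R d -> R[i].
Hypothesis f2 : L2 f.

Let mf : cmeasurable f. Proof. by case: f2. Qed.
Let w x k : R := sqc (zsample a f x k).
Let w0 x k : 0 <= w x k. Proof. exact: sqc_ge0. Qed.

Let mT n : measurable_fun setT (fun x => tail (w x) n).
Proof.
apply: emeasurable_esum => k => [|x]; last by rewrite lee_fin mulr_ge0.
apply/measurable_EFinP; apply: measurable_funM => //.
exact: measurable_sqc (cmeasurable_zsample a k mf).
Qed.

Lemma cube_cover (x : vec R d) : exists k : K, cube (vscale a (vint R k)) a x.
Proof.
exists [tuple Num.floor (tnth x i / a) | i < d] => i.
rewrite vscaleE vintE tnth_mktuple.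
have := floor_bounds (tnth x i / a).
set y := (tnth x i / a); have aw : a * y = tnth x i by rewrite mulrC divfK// gt_eqF.
by rewrite -(ler_pM2l a0) -(ltr_pM2l a0) aw mulrDr mulr1.
Qed.

(** Over a cube of side a, the sum of the |f(x - a k)|^2 integrates to |f|^2, so it is finite almost
    everywhere there; countably many such cubes cover the space. *)
Lemma ae_tail_fin : {ae leb, forall x, (tail (w x) 0 < +oo)%E}.
Proof.
have h (k0 : K) : {ae leb, forall x, cube (vscale a (vint R k0)) a x -> (tail (w x) 0 < +oo)%E}.
  pose c := vscale a (vint R k0); have mc := @measurable_cube R d c a.
  pose g k x : \bar R := (\1_(cube c a) x * w x k)%:E.
  have g0 k x : (0 <= g k x)%E by rewrite lee_fin mulr_ge0.
  have mg k : measurable_fun setT (g k).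
    apply/measurable_EFinP; apply: measurable_funM; first exact: measurable_indic.
    exact: measurable_sqc (cmeasurable_zsample a k mf).
  have : leb.-integrable setT (fun x => \esum_(k in [set: K]) g k x)%E.
    apply/integrableP; split; first exact: emeasurable_esum.
    under eq_integral do rewrite gee0_abs ?esum_ge0//.
    rewrite integral_esum// -(nrm2_unfold c a0 mf).
    by case: f2 => _; rewrite sqnormE.
  move=> /(integrable_ae measurableT); apply: filterS => x /(_ Logic.I) fx xc.
  have : (\esum_(k in [set: K]) g k x < +oo)%E by rewrite ltey_eq fx.
  congr (_ < _)%E; apply: eq_esum => k _.
  by rewrite /g indicE mem_set.
apply: filterS (ae_forall_count h) => x hx.
by have [k] := cube_cover x; exact: hx.
Qed.

Let thr j : R := 2^-1 ^+ j * 2^-1 ^+ j.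
Let thr0 j : 0 < thr j. Proof. by rewrite mulr_gt0// exprn_gt0. Qed.
Let thr_nincr j : thr j.+1 <= thr j.
Proof.
have := thr0 j; rewrite /thr !exprS; move: (2^-1 ^+ j) => y yy; nra.
Qed.

(* The truncation of the Zak series depends on x, so that consecutive partial
   sums are geometrically close in L^2 of the frequency cell. *)
Definition zak_level j x : nat :=
  match pselect (exists n, (tail (w x) n < (thr j)%:E)%E) with
  | left h => ex_minn h
  | right _ => 0%N
  end.

Lemma zak_levelP x j : (tail (w x) 0 < +oo)%E ->
  (tail (w x) (zak_level j x) < (thr j)%:E)%E /\
  (forall n, (tail (w x) n < (thr j)%:E)%E -> (zak_level j x <= n)%N).
Proof.
move=> fx; rewrite /zak_level; case: pselect => [h|]; last first.
  by case; exact: tail_cvg.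
by case: ex_minnP.
Qed.

Lemma zak_level_nd x j : (tail (w x) 0 < +oo)%E -> (zak_level j x <= zak_level j.+1 x)%N.
Proof.
move=> fx; have [_ h] := zak_levelP j fx; have [h' _] := zak_levelP j.+1 fx.
by apply: h; apply: lt_le_trans h' _; rewrite lee_fin.
Qed.

(** The value 0 is taken where the samples are not square-summable; there [zak_level] carries no
    information. *)
Definition zak_approx j (z : vec R d * vec R d) : R[i] :=
  if (tail (w z.1) 0 < +oo)%E then
    zpart a (zsample a f z.1) (seg K (zak_level j z.1)) z.2 else 0.

(** The number of terms varies with x, so the n-th term is multiplied by the indicator of the
    measurable set [A n] where the tail at n is still at least the threshold, that is, where n is
    below the level. The truncated sums [h m] become stationary at each point. *)
Lemma cmeasurable_zak_approx j : cmeasurable (zak_approx j).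
Proof.
pose A n : set (vec R d) := [set x | (tail (w x) 0 < +oo)%E] `&`
    [set x | ((thr j)%:E <= tail (w x) n)%E].
have mA n : measurable (A n).
  apply: measurableI.
    by rewrite -[X in measurable X]setTI; exact: emeasurable_fun_infty_o.
  by rewrite -[X in measurable X]setTI; exact: emeasurable_fun_c_infty.
pose t k (z : vec R d * vec R d) := zsample a f z.1 k * zexp a k z.2.
pose h m (z : vec R d * vec R d) : R[i] :=
  \sum_(n < m) cind (A n) z.1 * oapp (t^~ z) 0 (pickle_inv n).
have mt k : cmeasurable (t k).
  apply: cmeasurableM.
    by apply: cmeasurable_comp (cmeasurable_zsample a k mf) _; exact: measurable_fst.
  by apply: cmeasurable_comp (cmeasurable_zexp a k) _; exact: measurable_snd.
have mh m : cmeasurable (h m).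
  apply: cmeasurable_sum => n; apply: cmeasurableM.
    by apply: cmeasurable_comp (cmeasurable_cind (mA n)) _; exact: measurable_fst.
  by case: (pickle_inv n) => [k|]/=; [exact: mt|exact: cmeasurable_cst].
have hE z m : (zak_level j z.1 <= m)%N -> h m z = zak_approx j z.
  move=> lm; rewrite /zak_approx; case: ifPn => fx; last first.
    by rewrite /h big1// => n _; rewrite cindF ?mul0r// => -[h1]; rewrite h1 in fx.
  have [l1 l2] := zak_levelP j fx.
  rewrite /zpart big_seg /h -!(big_mkord xpredT
    (fun n => cind (A n) z.1 * oapp (t^~ z) 0 (pickle_inv n))).
  rewrite -(big_mkord xpredT
    (fun n => oapp (fun k => zsample a f z.1 k * zexp a k z.2) 0 (pickle_inv n))).
  rewrite (big_cat_nat _ (n := zak_level j z.1))//=.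
  rewrite [X in _ + X](_ : _ = 0) ?addr0; last first.
    rewrite big_nat_cond big1// => n /andP[/andP[ln _] _].
    rewrite cindF ?mul0r// => -[_] /=.
    rewrite leNgt; apply/negP; rewrite negbK; apply: le_lt_trans l1.
    exact: tail_nincr.
  apply: eq_big_nat => n /andP[_ nl]; rewrite cindT ?mul1r//.
  by split => //; rewrite /= leNgt; apply/negP => /l2; rewrite leqNgt nl.
split.
  apply: (@measurable_fun_cvg _ _ _ setT (fun m z => cRe (h m z))).
    by move=> m; case: (mh m).
  move=> z _; apply: cvg_near_cst; exists (zak_level j z.1) => // m lm.
  by rewrite hE.
apply: (@measurable_fun_cvg _ _ _ setT (fun m z => cIm (h m z))).
  by move=> m; case: (mh m).
move=> z _; apply: cvg_near_cst; exists (zak_level j z.1) => // m lm.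
by rewrite hE.
Qed.

(** An upper limit is defined and measurable everywhere, and it is the limit wherever the sequence
    converges. *)
Definition zak_rep (z : vec R d * vec R d) : R[i] :=
  ((fine (limn_esup (fun j => (cRe (zak_approx j z))%:E))) +i*
   (fine (limn_esup (fun j => (cIm (zak_approx j z))%:E))))%C.

Lemma cmeasurable_zak_rep : cmeasurable zak_rep.
Proof.
have mj := cmeasurable_zak_approx; split => /=.
  apply: (measurableT_comp (fine_measurable _)) => //.
  by apply: measurable_fun_limn_esup => j; apply/measurable_EFinP; case: (mj j).
apply: (measurableT_comp (fine_measurable _)) => //.
by apply: measurable_fun_limn_esup => j; apply/measurable_EFinP; case: (mj j).
Qed.

Lemma fine_limn_esup (r : nat -> R) : cvgn r ->
  r j @[j --> \oo] --> fine (limn_esup (fun j => (r j)%:E)).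
Proof.
move=> /cvg_ex[l rl]; have rl' : (r j)%:E @[j --> \oo] --> l%:E.
  by apply: cvg_EFin rl; exact: nearW.
rewrite is_cvg_limn_esupE; last by apply/cvg_ex; exists l%:E.
by rewrite (cvg_lim _ rl').
Qed.

Theorem zak_rep_is_zak : is_zak a f zak_rep.
Proof.
split; first exact: cmeasurable_zak_rep.
apply: filterS ae_tail_fin => x fx c eps eps0.
have vol0 : 0 < a^-1 ^+ d by rewrite exprn_gt0// invr_gt0.
have [|m hm] := @tail_cvg K R (w x) (eps / a^-1 ^+ d) (w0 x) fx; first by rewrite divr_gt0.
have cvZ : {ae leb, forall xi, cube c a^-1 xi ->
    (cRe (zpart a (zsample a f x) (seg K (zak_level j x)) xi) @[j --> \oo] -->
       cRe (zak_rep (x, xi))) /\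
    (cIm (zpart a (zsample a f x) (seg K (zak_level j x)) xi) @[j --> \oo] -->
       cIm (zak_rep (x, xi)))}.
  apply: filterS (@zpart_cvg R d a a0 (zsample a f x) (zak_level ^~ x) _ _ c).
  - move=> xi hxi xic; have [c1 c2] := hxi xic.
    have E j : zak_approx j (x, xi) = zpart a (zsample a f x) (seg K (zak_level j x)) xi.
      by rewrite /zak_approx /= fx.
    split; rewrite /zak_rep /=.
      by under [X in limn_esup X]eq_fun do rewrite E; exact: fine_limn_esup.
    by under [X in limn_esup X]eq_fun do rewrite E; exact: fine_limn_esup.
  - by move=> j; exact: zak_level_nd.
  - by move=> j; have [] := zak_levelP j fx.
(* Every finite F that contains the first m codes satisfies the same bound vol * tail m < eps; this
   gives unconditional convergence. *)
exists [fset k in seg K m]%fset => F /fsubsetP FS.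
rewrite sqnorm_onE; last exact: measurable_cube.
have := @zpart_limit R d a a0 (zsample a f x) (zak_level ^~ x) _ c
  (fun xi => zak_rep (x, xi)) _ cvZ (enum_fset F) m (fset_uniq F).
move=> H; apply: le_lt_trans (H _ _ _) _.
- by move=> j; have [] := zak_levelP j fx.
- exact: cmeasurable_pair1 cmeasurable_zak_rep.
- by move=> k km; apply: FS; rewrite in_fset/= mem_seg.
have tf : tail (w x) m \is a fin_num.
  rewrite ge0_fin_numE; last exact: tail_ge0.
  by apply: lt_trans hm _; rewrite ltry.
move: hm; rewrite -/(w x) -(fineK tf) -EFinM !lte_fin ltr_pdivlMr//.
by rewrite mulrC.
Qed.
End zak_existence.

(** * Fourier coefficients of the Zak transform *)

Section zak_coefficients.
Context {R : realType} (d : nat) (a : R) (a0 : 0 < a).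
Local Notation K := (d.-tuple int).
Local Notation leb := (lebesgue R d).

Lemma zak_is_zak (f : vec R d -> R[i]) : L2 f -> is_zak a f (zak a f).
Proof.
by move=> f2; apply: xgetPex; exists (zak_rep a f); exact: zak_rep_is_zak.
Qed.

(** A Fourier coefficient is continuous in L^2: the discrepancy D is a coefficient of Z minus a
    partial sum, hence bounded by an error that can be made arbitrarily small. *)
Lemma is_zak_coef (f : vec R d -> R[i]) Z : is_zak a f Z ->
  {ae leb, forall x, forall c : vec R d,
     L2m leb (fun xi => cind (cube c a^-1) xi * Z (x, xi)) /\
     forall k, fcoef leb (expC c a^-1) (fun xi => cind (cube c a^-1) xi * Z (x, xi)) k =
               zsample a f x k * (a^-1 ^+ d)%:C%C}.
Proof.
move=> [mZ hZ]; apply: filterS hZ => x hx c.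
have ai0 : 0 < a^-1 by rewrite invr_gt0.
set W := cube c a^-1; set vol := a^-1 ^+ d.
have vol0 : 0 < vol by rewrite exprn_gt0.
have P := parseval_cube c ai0.
have mW := ps_measurable P.
have mZx : cmeasurable (fun xi => Z (x, xi)) by exact: cmeasurable_pair1.
pose S (F : {fset K}) xi := \sum_(k <- F) zsample a f x k * expC c a^-1 k xi.
have SE F xi : cind W xi * zak_sum a f F x xi = S F xi by exact: cind_zpart.
have LS F : L2m leb (S F).
  by apply: L2m_sum => k; apply: L2mZ; exact: (ps_L2m_e P).
have key eps : 0 < eps -> exists F0 : {fset K}, forall F, (F0 `<=` F)%fset ->
    L2m leb (fun xi => cind W xi * Z (x, xi) - S F xi) /\
    (nrm2 leb (fun xi => cind W xi * Z (x, xi) - S F xi)%R < eps%:E)%E.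
  move=> eps0; have [F0 hF0] := hx c eps eps0; exists F0 => F FF0.
  have := hF0 F FF0; rewrite sqnorm_onE//.
  under [X in nrm2 _ X]eq_fun do rewrite mulrBr SE.
  move=> h; split => //; split; last by apply: lt_trans h _; rewrite ltry.
  apply: cmeasurableB; last by case: (LS F).
  by apply: cmeasurableM => //; exact: cmeasurable_cind.
have LZ : L2m leb (fun xi => cind W xi * Z (x, xi)).
  have [F0 /(_ F0 (fsubset_refl _)) [h _]] := key 1 ltr01.
  have := L2mD h (LS F0).
  by under eq_fun do rewrite subrK.
split => // k; apply/eqP; rewrite -subr_eq0; apply/eqP.
set D := (X in X = 0).
suff D0 : sqc D <= 0.
  have : sqc D == 0 by rewrite eq_le D0 sqc_ge0.
  rewrite paddr_eq0 ?sqr_ge0// !sqrf_eq0 => /andP[/eqP h1 /eqP h2].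
  exact: ceqP.
apply/ler_addgt0Pl => eps eps0; rewrite addr0.
have [|F0 hF0] := key (eps / vol); first by rewrite divr_gt0.
(* Once k belongs to F, the k-th coefficient of the partial sum is exactly the sample times the
   volume. *)
pose F := (F0 `|` [fset k])%fset.
have [LF hF] := hF0 F (fsubsetUl _ _).
have DE : D = fcoef leb (expC c a^-1) (fun xi => cind W xi * Z (x, xi) - S F xi) k.
  rewrite (fcoefB mW (ps_measure P) (ps_cmeasurable P) (ps_sqc P))//.
  congr (_ - _); have := fcoef_lincomb P (zsample a f x) k (fset_uniq F).
  have -> : k \in enum_fset F by rewrite -[_ \in _]/(k \in F) in_fsetU in_fset1 eqxx orbT.
  by move=> <-.
have := @ps_coef_le _ _ _ _ _ _ _ _ P _ k LF.
rewrite -DE => h; rewrite -lee_fin; apply: le_trans (h _) _.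
  move=> xi nW; rewrite cindF// mul0r sub0r /S big1 ?oppr0// => j _.
  by rewrite (ps_eW P)// mulr0.
rewrite (_ : eps = vol * (eps / vol)); last by rewrite mulrC divfK// gt_eqF.
by rewrite EFinM lee_pmul2l//; exact/ltW.
Qed.
End zak_coefficients.

(** * Fiberization of Gabor sums *)

Section zak_pairs.
Context {R : realType} (d : nat) (a : R) (a0 : 0 < a) (p : nat) (p0 : (0 < p)%N).
Variables (c0 c : vec R d).
Local Notation K := (d.-tuple int).
Local Notation leb := (lebesgue R d).
Local Notation leb2 := (leb \x leb)%E.
Local Notation b := a^-1.
Implicit Types (f g : vec R d -> R[i]) (Z W : vec R d * vec R d -> R[i]).

(* Z is the Zak transform of f over the single cell cube c0 a x cube c b; both
   cells are free, so that later the fibers can be localized anywhere. *)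
Definition zak_pair f Z := [/\ cmeasurable f, cmeasurable Z &
  {ae leb, forall x, cube c0 a x ->
     L2m leb (fun xi => cind (cube c b) xi * Z (x, xi)) /\
     forall k, fcoef leb (expC c b) (fun xi => cind (cube c b) xi * Z (x, xi)) k =
               zsample a f x k * (b ^+ d)%:C%C}].

Let b0 : 0 < b. Proof. by rewrite invr_gt0. Qed.
Let vol := b ^+ d.
Let vol0 : 0 < vol. Proof. by rewrite exprn_gt0. Qed.
Let P := parseval_cube c b0.

Lemma zak_pairD f Z g W (u : R[i]) : zak_pair f Z -> zak_pair g W ->
  zak_pair (fun x => f x + u * g x) (fun z => Z z + u * W z).
Proof.
move=> [mf mZ h1] [mg mW h2]; split.
- by apply: cmeasurableD => //; apply: cmeasurableM => //; exact: cmeasurable_cst.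
- by apply: cmeasurableD => //; apply: cmeasurableM => //; exact: cmeasurable_cst.
apply: filterS2 h1 h2 => x h1 h2 xc; have [L1 e1] := h1 xc; have [L2 e2] := h2 xc.
have E : (fun xi => cind (cube c b) xi * (Z (x, xi) + u * W (x, xi))) =
    (fun xi => cind (cube c b) xi * Z (x, xi) + u * (cind (cube c b) xi * W (x, xi))).
  by apply/funext => xi; rewrite mulrDr mulrCA.
rewrite E; split; first by apply: L2mD => //; exact: L2mZ.
move=> k; rewrite (fcoefD (ps_measurable P) (ps_measure P) (ps_cmeasurable P) (ps_sqc P))//;
  last exact: L2mZ.
rewrite (fcoefZ (ps_measurable P) (ps_measure P) (ps_cmeasurable P) (ps_sqc P))//.
by rewrite e1 e2 /zsample mulrDl mulrA.
Qed.

(** The Zak transform is unitary up to the volume of the frequency cell: Parseval in xi for almost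
    every x, then unfolding of the integral over x. *)
Lemma zak_pair_nrm2 f Z : zak_pair f Z ->
  nrm2 leb2 (fun z => cind (cube c0 a) z.1 * (cind (cube c b) z.2 * Z z)) =
  (vol%:E * nrm2 leb f)%E.
Proof.
move=> [mf mZ h]; have mC0 := @measurable_cube R d c0 a; have mC := @measurable_cube R d c b.
have mh : cmeasurable (fun z : vec R d * vec R d =>
    cind (cube c0 a) z.1 * (cind (cube c b) z.2 * Z z)).
  apply: cmeasurableM.
    by apply: cmeasurable_comp (cmeasurable_cind mC0) _; exact: measurable_fst.
  apply: cmeasurableM => //.
  by apply: cmeasurable_comp (cmeasurable_cind mC) _; exact: measurable_snd.
rewrite nrm2_fubini// (nrm2_unfold c0 a0 mf).
have mg k : measurable_fun setT (fun x => (\1_(cube c0 a) x * sqc (zsample a f x k))%:E).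
  apply/measurable_EFinP; apply: measurable_funM; first exact: measurable_indic.
  exact: measurable_sqc (cmeasurable_zsample a k mf).
have g0 k x : (0 <= (\1_(cube c0 a) x * sqc (zsample a f x k))%:E)%E.
  by rewrite lee_fin mulr_ge0// sqc_ge0.
rewrite -integral_esum// -ge0_integralZl//; last 3 first.
- exact: emeasurable_esum.
- by move=> x _; apply: esum_ge0 => k _; exact: g0.
- by rewrite lee_fin ltW.
apply: ge0_ae_eq_integral => //.
- exact: (emeasurable_nrm2_fubini leb mh).
- by apply: measurable_funeM; exact: emeasurable_esum.
- by move=> x _; exact: nrm2_ge0.
- move=> x _; apply: mule_ge0; first by rewrite lee_fin ltW.
  by apply: esum_ge0 => k _; exact: g0.
apply: filterS h => x hx _ /=.
rewrite nrm2Z; last first.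
  by apply: cmeasurableM; [exact: cmeasurable_cind|exact: cmeasurable_pair1].
rewrite sqc_cind; under [in RHS]eq_esum do rewrite EFinM.
rewrite ge0_esumZ//; last by move=> k; rewrite lee_fin sqc_ge0.
have [xc|xc] := pselect (cube c0 a x); last first.
  by rewrite indicE memNset//= !mul0e mule0.
rewrite indicE mem_set//= !mul1e; have [Lx ex] := hx xc.
have := ps_eq P Lx; rewrite /fsum; under eq_esum do rewrite ex sqcM sqcR mulrC EFinM.
rewrite ge0_esumZ ?sqr_ge0//; last by move=> k; rewrite lee_fin sqc_ge0.
move=> H; have hW : forall xi, ~ cube c b xi -> cind (cube c b) xi * Z (x, xi) = 0.
  by move=> xi nW; rewrite cindF// mul0r.
have := H hW; move=> /(congr1 (fun z => (vol^-1%:E * z)%E)).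
by rewrite !muleA -!EFinM mulVf ?gt_eqF// mul1e expr2 mulrA mulVf ?gt_eqF// mul1r => ->.
Qed.

Definition box : set (vec R d * vec R d) := cube c0 a `*` cube c (b / p%:R).
Definition vshift (s : d.-tuple 'I_p) (xi : vec R d) : vec R d :=
  vadd xi (vscale (b / p%:R) (vord R s)).
(* The cell cube c b of the frequency variable is cut into the p^d subcubes
   vshift s (cube c (b / p)); fiber Z lists the values of Z on them. *)
Definition fiber Z s (z : vec R d * vec R d) : R[i] := cind box z * Z (z.1, vshift s z.2).

Lemma measurable_box : measurable box.
Proof. by apply: measurableX; exact: measurable_cube. Qed.
Lemma measurable_vshift2 s :
  measurable_fun setT (fun z : vec R d * vec R d => (z.1, vshift s z.2)).
Proof.
apply/measurable_fun_pairP; split; first exact: measurable_fst.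
by apply: measurable_vadd => //; exact: measurable_snd.
Qed.
Lemma cmeasurable_fiber Z s : cmeasurable Z -> cmeasurable (fiber Z s).
Proof.
move=> mZ; apply: cmeasurableM; first by apply: cmeasurable_cind; exact: measurable_box.
exact: cmeasurable_comp mZ (measurable_vshift2 s).
Qed.

Lemma zak_pair_fiber f Z : zak_pair f Z ->
  (\sum_s nrm2 leb2 (fiber Z s) = vol%:E * nrm2 leb f)%E.
Proof.
move=> h; rewrite -(zak_pair_nrm2 h); have [mf mZ _] := h.
have mC0 := @measurable_cube R d c0 a; have mC := @measurable_cube R d c b.
have mC' := @measurable_cube R d c (b / p%:R).
have mh : cmeasurable (fun z : vec R d * vec R d =>
    cind (cube c0 a) z.1 * (cind (cube c b) z.2 * Z z)).
  apply: cmeasurableM.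
    by apply: cmeasurable_comp (cmeasurable_cind mC0) _; exact: measurable_fst.
  apply: cmeasurableM => //.
  by apply: cmeasurable_comp (cmeasurable_cind mC) _; exact: measurable_snd.
rewrite [RHS]nrm2_fubini//.
have mfib s : cmeasurable (fiber Z s) by exact: cmeasurable_fiber.
under eq_bigr do rewrite nrm2_fubini//.
rewrite -ge0_integral_sum//; last 2 first.
- by move=> s; exact: (emeasurable_nrm2_fubini leb (mfib s)).
- by move=> s x _; exact: nrm2_ge0.
apply: eq_integral => x _ /=.
rewrite nrm2Z; last by apply: cmeasurableM; [exact: cmeasurable_cind|exact: cmeasurable_pair1].
have E s : nrm2 leb (fun y => fiber Z s (x, y)) = ((\1_(cube c0 a) x)%:E *
   \int[leb]_y (\1_(cube c (b / p%:R)) y * sqc (Z (x, vshift s y)))%:E)%E.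
  rewrite -ge0_integralZl//; last 2 first.
  - apply/measurable_EFinP; apply: measurable_funM; first exact: measurable_indic.
    apply: measurable_sqc; apply: (@cmeasurable_comp _ _ _ _ _ (fun xi => Z (x, xi))).
      exact: cmeasurable_pair1.
    exact: measurable_vadd.
  - by move=> y _; rewrite lee_fin mulr_ge0// sqc_ge0.
  apply: eq_integral => y _; rewrite /fiber sqcM sqc_cind -EFinM mulrA /=; congr (_ * _)%:E.
  by rewrite !indicE in_setX/=; case: (_ \in _); case: (_ \in _); rewrite ?mulr1 ?mulr0 ?mul0r.
under eq_bigr do rewrite E.
rewrite -ge0_sume_distrr; last first.
  by move=> s _; apply: integral_ge0 => y _; rewrite lee_fin mulr_ge0// sqc_ge0.
rewrite sqc_cind; congr (_ * _)%E.
rewrite -(@integral_subcubes _ _ c b p (fun xi => Z (x, xi)))//; last exact: cmeasurable_pair1.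
by apply: eq_integral => y _; rewrite sqcM sqc_cind.
Qed.

Lemma L2m_fiber f Z s : zak_pair f Z -> L2m leb f -> L2m leb2 (fiber Z s).
Proof.
move=> h [mf ff]; have [_ mZ _] := h; split; first exact: cmeasurable_fiber.
apply: (@le_lt_trans _ _ (\sum_s nrm2 leb2 (fiber Z s))%E).
  by rewrite (bigD1 s)//= leeDl// sume_ge0// => i _; exact: nrm2_ge0.
by rewrite (zak_pair_fiber h) lte_mul_pinfty// lee_fin ltW.
Qed.

(** Polarization: [zak_pair_fiber] is applied to f + u g for u = 1, -1, i, -i, whose pairs come from
    [zak_pairD]. *)
Lemma zak_pair_inner f Z g W : zak_pair f Z -> zak_pair g W -> L2m leb f -> L2m leb g ->
  \sum_s cintegral leb2 (fun z => fiber Z s z * (fiber W s z)^*) =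
  vol%:C%C * cintegral leb (fun x => f x * (g x)^*).
Proof.
move=> hf hg Lf Lg.
have LF s := L2m_fiber s hf Lf; have LG s := L2m_fiber s hg Lg.
under eq_bigr => s _ do rewrite cintegral_polar//.
rewrite cintegral_polar//.
have key u : \sum_s fine (nrm2 leb2 (fun z => fiber Z s z + u * fiber W s z)) =
    vol * fine (nrm2 leb (fun x => f x + u * g x)).
  have hu := zak_pairD u hf hg; have Lu := L2mD Lf (L2mZ u Lg).
  apply: EFin_inj; rewrite EFinM (fineK (nrm2_fin Lu)) -(zak_pair_fiber hu) -sumEFin.
  apply: eq_bigr => s _; rewrite fineK; last by apply: nrm2_fin; apply: L2mD => //; exact: L2mZ.
  by congr nrm2; apply/funext => z; rewrite /fiber mulrDr mulrCA.
have F1 (T : Type) (h1 h2 : T -> R[i]) :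
    (fun z => h1 z + 1 * h2 z) = (fun z => h1 z + h2 z).
  by apply/funext => z; rewrite mul1r.
have FN u (T : Type) (h1 h2 : T -> R[i]) :
    (fun z => h1 z + - u * h2 z) = (fun z => h1 z - u * h2 z).
  by apply/funext => z; rewrite mulNr.
have FB (T : Type) (h1 h2 : T -> R[i]) :
    (fun z => h1 z - 1 * h2 z) = (fun z => h1 z - h2 z).
  by apply/funext => z; rewrite mul1r.
have key1 : \sum_s fine (nrm2 leb2 (fun z => fiber Z s z + fiber W s z)) =
    vol * fine (nrm2 leb (fun x => f x + g x)).
  by have := key 1; rewrite F1; under eq_bigr do rewrite F1.
have keyN u : \sum_s fine (nrm2 leb2 (fun z => fiber Z s z - u * fiber W s z)) =
    vol * fine (nrm2 leb (fun x => f x - u * g x)).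
  by have := key (- u); rewrite FN; under eq_bigr do rewrite FN.
have keyN1 : \sum_s fine (nrm2 leb2 (fun z => fiber Z s z - fiber W s z)) =
    vol * fine (nrm2 leb (fun x => f x - g x)).
  by have := keyN 1; rewrite FB; under eq_bigr do rewrite FB.
have sumC (I : finType) (x y : I -> R) : \sum_i (x i +i* y i)%C = ((\sum_i x i) +i* (\sum_i y i))%C.
  by apply: ceqP; rewrite /= ?raddf_sum//; elim/big_rec2: _ => // i ? ? _ <-.
rewrite sumC -!mulr_suml !sumrB key1 keyN1 key keyN.
by apply: ceqP; rewrite !ReImE/=; ring.
Qed.
End zak_pairs.

Lemma cintegrable_sum {R : realType} disp (T : measurableType disp)
    (mu : {measure set T -> \bar R}) (I : Type) (s : seq I) (F : I -> T -> R[i]) :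
  (forall i, cintegrable mu (F i)) ->
  cintegrable mu (fun x => \sum_(i <- s) F i x) /\
  cintegral mu (fun x => \sum_(i <- s) F i x) = \sum_(i <- s) cintegral mu (F i).
Proof.
move=> iF; elim: s => [|i s [IH1 IH2]].
  under eq_fun do rewrite big_nil; rewrite big_nil; split.
    by split; exact: integrable0.
  by rewrite /cintegral !Rintegral_cst//= !mul0r.
under eq_fun do rewrite big_cons; rewrite big_cons; split; first exact: cintegrableD.
by rewrite cintegralD// IH2.
Qed.

Section residues.
Context (d q : nat) (q0 : (0 < q)%N).
Local Notation K := (d.-tuple int).

(* Writing k = -(r + q m) with 0 <= r < q, the translate of g by a (p/q) k has
   Zak transform Zg (x + a (p/q) r, xi), up to the character p m: this is what
   turns Gabor coefficients into Fourier coefficients over box. *)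
Definition kidx (r : d.-tuple 'I_q) (m : K) : K :=
  [tuple - (((tnth r i : nat) : int) + q%:Z * tnth m i) | i < d].

Lemma kidx_bij : set_bij [set: d.-tuple 'I_q * (K * K)] [set: K * K]
  (fun t => (kidx t.1 t.2.2, t.2.1)).
Proof.
have qn0 : q%:Z != 0 by rewrite eqz_nat -lt0n.
split => //.
  move=> [r [l m]] [r' [l' m']] _ _ /= /pair_equal_spec[h ->].
  have h' i : ((tnth r i : nat) : int) + q%:Z * tnth m i =
              ((tnth r' i : nat) : int) + q%:Z * tnth m' i.
    by have := congr1 (fun t => tnth t i) h; rewrite !tnth_mktuple => /oppr_inj.
  have small (s : 'I_q) : 0 <= ((s : nat) : int) < `|q%:Z| by rewrite /= ltz_nat ltn_ord.
  have hm i : tnth m i = tnth m' i.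
    have := congr1 (fun z => (z %/ q%:Z)%Z) (h' i).
    by rewrite ![_ + q%:Z * _]addrC ![q%:Z * _]mulrC !divzMDl// !divz_small// !addr0.
  have hr i : tnth r i = tnth r' i.
    apply/val_inj/eqP; rewrite -eqz_nat.
    by have := h' i; rewrite hm => /addIr ->.
  by congr (_, (_, _)); exact: eq_from_tnth.
move=> [k l] _.
have lt i : (`|(- tnth k i) %% q%:Z|%Z < q)%N.
  by rewrite -ltz_nat gez0_abs ?modz_ge0// ltz_mod.
exists ([tuple Ordinal (lt i) | i < d], (l, [tuple ((- tnth k i) %/ q%:Z)%Z | i < d])) => //=.
congr pair; apply: eq_from_tnth => i; rewrite !tnth_mktuple /= gez0_abs ?modz_ge0//.
by rewrite addrC mulrC -divz_eq opprK.
Qed.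
End residues.

Section gabor_sum.
Context {R : realType} (d : nat) (a : R) (a0 : 0 < a) (p q : nat)
  (p0 : (0 < p)%N) (q0 : (0 < q)%N).
Variables (c0 c : vec R d).
Local Notation K := (d.-tuple int).
Local Notation leb := (lebesgue R d).
Local Notation leb2 := (leb \x leb)%E.
Local Notation b := a^-1.
(** With a = 1 / beta this is alpha, because alpha beta = p / q. *)
Let al : R := a * (p%:R / q%:R).
Let b0 : 0 < b. Proof. by rewrite invr_gt0. Qed.
Let pR0 : 0 < p%:R :> R. Proof. by rewrite ltr0n. Qed.
Let qR0 : 0 < q%:R :> R. Proof. by rewrite ltr0n. Qed.
Let bp0 : 0 < b / p%:R. Proof. by rewrite divr_gt0. Qed.
Let vol := b ^+ d.
Let vol0 : 0 < vol. Proof. by rewrite exprn_gt0. Qed.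
Let P := parseval_cube c b0.

Variables (g : vec R d -> R[i]) (Zg : vec R d * vec R d -> R[i]).
Hypotheses (mg : cmeasurable g) (g2 : L2m leb g) (hZ : is_zak a g Zg).

Definition gab (k l : K) := tfshift (vscale al (vint R k)) (vscale b (vint R l)) g.
Definition zshift (r : d.-tuple 'I_q) (z : vec R d * vec R d) : R[i] :=
  Zg (vadd z.1 (vscale al (vord R r)), z.2).
Definition pmul (m : K) : K := [tuple p%:Z * tnth m i | i < d].
Definition zgab r (l m : K) (z : vec R d * vec R d) : R[i] :=
  expi2pi (b * vdot (vint R l) z.1) * zexp a (pmul m) z.2 * zshift r z.

Lemma cmeasurable_zshift (r : d.-tuple 'I_q) : cmeasurable (zshift r).
Proof.
have [mZ _] := hZ; apply: cmeasurable_comp mZ _; apply/measurable_fun_pairP; split.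
  by apply: measurable_vadd => //; exact: measurable_fst.
exact: measurable_snd.
Qed.

Lemma cmeasurable_gab k l : cmeasurable (gab k l).
Proof.
apply: cmeasurableM; last by apply: cmeasurable_comp mg _; exact: measurable_vadd.
by apply: cmeasurable_expi2pi; apply: (@measurable_vdot _ _ _ _ (fun=> _) id).
Qed.

Lemma cmeasurable_zgab (r : d.-tuple 'I_q) l m : cmeasurable (zgab r l m).
Proof.
apply: cmeasurableM; last exact: cmeasurable_zshift.
apply: cmeasurableM.
  apply: cmeasurable_expi2pi; apply: measurable_funM => //.
  by apply: (@measurable_vdot _ _ _ _ (fun=> _) fst) => //; exact: measurable_fst.
by apply: cmeasurable_comp (cmeasurable_zexp a _) _; exact: measurable_snd.
Qed.

Lemma L2m_gab k l : L2m leb (gab k l).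
Proof.
split; first exact: cmeasurable_gab.
have -> : nrm2 leb (gab k l) =
    nrm2 leb (fun x => g (vadd x (vopp (vscale al (vint R k))))).
  by apply: eq_nrm2 => x; rewrite /gab /tfshift sqcM sqc_expi2pi mul1r.
rewrite /nrm2 (integral_translate _ (f := fun x => (sqc (g x))%:E)).
- by case: g2.
- exact: emeasurable_sqc.
- by move=> x; rewrite lee_fin sqc_ge0.
Qed.

Lemma expi2piDz (t : R) (n : int) : expi2pi (t + n%:~R) = expi2pi t.
Proof. by rewrite expi2piD expi2pi_int mulr1. Qed.

Lemma vdot_vint (l n : K) : vdot (vint R l) (vint R n) = (\sum_i tnth l i * tnth n i)%:~R.
Proof.
rewrite /vdot rmorph_sum; apply: eq_bigr => i _.
by rewrite !vintE -intrM.
Qed.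

(** Since a b = 1, the modulation gives all samples at x - a n the same phase. Since al q = a p,
    translating by al q m only moves the sample index from n to n - p m. *)
Lemma zsample_gab (r : d.-tuple 'I_q) l m x n : zsample a (gab (kidx r m) l) x n =
  expi2pi (b * vdot (vint R l) x) *
  zsample a g (vadd x (vscale al (vord R r))) [tuple tnth n i - tnth (pmul m) i | i < d].
Proof.
rewrite /zsample /gab /tfshift; congr (_ * g _).
  rewrite vdotZl vdotDr vdotNr vdotZr mulrDr mulrN mulrA mulVf ?gt_eqF// mul1r.
  by rewrite vdot_vint -mulrNz expi2piDz.
apply: vec_ext => i; rewrite !vaddE !voppE !vscaleE !vintE !vordE !tnth_mktuple.
rewrite mulrNz !intrD !intrM mulrNz intrM -!pmulrn /al; field.
by rewrite gt_eqF.
Qed.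

Lemma zak_pair_gab (r : d.-tuple 'I_q) l m : zak_pair a c0 c (gab (kidx r m) l) (zgab r l m).
Proof.
split; [exact: cmeasurable_gab|exact: cmeasurable_zgab|].
(* The Zak transform of g is read at x + al r, possibly outside [cube c0 a]; this is why g comes
   with the full [is_zak], while f only needs a [zak_pair]. *)
apply: filterS (ae_translate (vscale al (vord R r)) (is_zak_coef a0 hZ)) => x hx _.
have [L e] := hx c; set y := vadd x (vscale al (vord R r)).
have mz : cmeasurable (fun xi => zgab r l m (x, xi)).
  by apply: cmeasurable_pair1; exact: cmeasurable_zgab.
split.
  apply: L2m_le L; first by apply: cmeasurableM => //; apply: cmeasurable_cind; exact: measurable_cube.
  by move=> xi; rewrite !sqcM !sqc_expi2pi !mul1r.
move=> n; rewrite zsample_gab -mulrA -(e _).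
rewrite -(fcoefZ (ps_measurable P) (ps_measure P) (ps_cmeasurable P) (ps_sqc P))//.
congr cintegral; apply/funext => xi; rewrite /zgab /zshift /= -/y.
have <- : (expC c b n xi)^* * zexp a (pmul m) xi =
    (expC c b [tuple tnth n i - tnth (pmul m) i | i < d] xi)^*.
  rewrite -!cind_zexp !rmorphM/= -mulrA; congr (_ * _).
  rewrite /zexp -!expi2piN -expi2piD; congr expi2pi.
  have -> : vint R [tuple tnth n i - tnth (pmul m) i | i < d] =
      vadd (vint R n) (vopp (vint R (pmul m))).
    by apply: vec_ext => i; rewrite vaddE voppE !vintE tnth_mktuple intrD mulrNz.
  rewrite vdotDl [vdot (vopp _) _]vdotC vdotNr [vdot xi _]vdotC; ring.
by ring.
Qed.

Definition ebox (k : K * K) (z : vec R d * vec R d) : R[i] :=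
  expC c0 a k.1 z.1 * expC c (b / p%:R) k.2 z.2.

Lemma parseval_box : parseval_system leb2 (box a p c0 c) (a ^+ d * (b / p%:R) ^+ d) ebox.
Proof. exact: parseval_tensor (parseval_cube c0 a0) (parseval_cube c bp0). Qed.

(** The character with frequency [pmul m] has period b / p in each coordinate, so it takes the same
    value on all p^d subcubes and factors out as a basis function of the box. *)
Lemma fiber_zgab (r : d.-tuple 'I_q) l m (s : d.-tuple 'I_p) z : fiber a c0 c (zgab r l m) s z =
  ebox (l, m) z * fiber a c0 c (zshift r) s z.
Proof.
have [zb|zb] := pselect (box a p c0 c z); last by rewrite /fiber cindF// !mul0r mulr0.
have [z1 z2] := zb.
rewrite /fiber cindT// !mul1r /zgab /ebox /expC !cindT// !mul1r; congr (_ * _ * _).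
  by rewrite mulrC.
rewrite /zexp /vshift vdotDr.
have -> : vint R (pmul m) = vscale p%:R (vint R m).
  by apply: vec_ext => i; rewrite vscaleE !vintE tnth_mktuple intrM.
rewrite !vdotZl vdotZr.
have -> : vord R s = vint R [tuple ((tnth s i : nat) : int) | i < d].
  by apply: vec_ext => i; rewrite vordE vintE tnth_mktuple pmulrn.
rewrite vdot_vint -[RHS](expi2piDz _
  (\sum_i tnth m i * tnth [tuple ((tnth s i : nat) : int) | i < d] i)).
by congr expi2pi; field; rewrite !gt_eqF.
Qed.

(** Up to a factor of modulus 1 on the box this is a fiber of a time-frequency shift of g, which is
    square-integrable. *)
Lemma L2m_fiber_zshift (r : d.-tuple 'I_q) (s : d.-tuple 'I_p) :
  L2m leb2 (fiber a c0 c (zshift r) s).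
Proof.
pose o : K := [tuple 0 | i < d].
have L := L2m_fiber a0 p0 s (zak_pair_gab r o o) (L2m_gab _ _).
apply: L2m_le L; first exact: cmeasurable_fiber (cmeasurable_zshift r).
move=> z; rewrite fiber_zgab sqcM (ps_sqc parseval_box).
rewrite /fiber sqcM sqc_cind mulrA indicE.
by case: (_ \in _); rewrite ?mul1r// !mul0r.
Qed.

Variables (f : vec R d -> R[i]) (Zf : vec R d * vec R d -> R[i]).
Hypotheses (f2 : L2m leb f) (hf : zak_pair a c0 c f Zf).

Definition hbox r (z : vec R d * vec R d) : R[i] :=
  \sum_(s : d.-tuple 'I_p) fiber a c0 c Zf s z * (fiber a c0 c (zshift r) s z)^*.

Lemma gabor_coef (r : d.-tuple 'I_q) l m :
  vol%:C%C * inner f (gab (kidx r m) l) = fcoef leb2 ebox (hbox r) (l, m).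
Proof.
rewrite /inner -(zak_pair_inner a0 p0 hf (zak_pair_gab r l m) f2 (L2m_gab _ _)).
rewrite /fcoef /hbox.
have -> : (fun z => (\sum_(s : d.-tuple 'I_p) fiber a c0 c Zf s z *
      (fiber a c0 c (zshift r) s z)^*) * (ebox (l, m) z)^*)
    = (fun z => \sum_(s : d.-tuple 'I_p) fiber a c0 c Zf s z * (fiber a c0 c (zgab r l m) s z)^*).
  apply/funext => z; rewrite mulr_suml; apply: eq_bigr => s _.
  have cM (u v : R[i]) : (u * v)^* = u^* * v^* by exact: rmorphM.
  by rewrite fiber_zgab cM [in RHS]mulrCA mulrC.
suff F (s : d.-tuple 'I_p) : cintegrable leb2
  (fun z => fiber a c0 c Zf s z * (fiber a c0 c (zgab r l m) s z)^*).
  by have [_ ->] := cintegrable_sum (index_enum _) F.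
apply: L2mM_cintegrable; first exact: L2m_fiber hf f2.
by apply: L2mJ; apply: L2m_fiber (zak_pair_gab r l m) (L2m_gab _ _).
Qed.

Lemma hbox_supp r z : ~ box a p c0 c z -> hbox r z = 0.
Proof. by move=> nz; rewrite /hbox big1// => s _; rewrite /fiber cindF// !mul0r. Qed.

(** The factor vol^-2 undoes the vol in [gabor_coef]; the other factor is the volume of the box,
    from Parseval. The product equals a^(2d) / p^d. *)
Definition gconst : R := vol ^- 2 * (a ^+ d * (b / p%:R) ^+ d).

(** Each [hbox r] is a sum of products of two L^2 functions and so only integrable a priori. Its
    square-integrability comes from the pointwise upper bound in one direction and from the bounded
    fibers of the test functions in the other. *)
Lemma gabor_sum : (forall r, L2m leb2 (hbox r)) ->
  (\esum_(k in [set: K * K]) (sqc (inner f (gab k.1 k.2)))%:E =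
   gconst%:E * \sum_r nrm2 leb2 (hbox r))%E.
Proof.
move=> Lh; rewrite (reindex_esum _ _ _ _ (kidx_bij d q0)).
have -> : [set: d.-tuple 'I_q * (K * K)] = [set: d.-tuple 'I_q] `*`` (fun=> [set: K * K]).
  by apply/seteqP; split.
rewrite -(@esum_esum R _ _ setT (fun=> setT)
  (fun r k => (sqc (inner f (gab (kidx r k.2) k.1)))%:E)); last first.
  by move=> r k _ _; rewrite lee_fin sqc_ge0.
rewrite esum_fintype; last by move=> r; apply: esum_ge0 => k _; rewrite lee_fin sqc_ge0.
rewrite ge0_sume_distrr; last by move=> r _; exact: nrm2_ge0.
apply: eq_bigr => r _.
have E k : (sqc (inner f (gab (kidx r k.2) k.1)))%:E =
    ((vol ^- 2)%:E * (sqc (fcoef leb2 ebox (hbox r) k))%:E)%E.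
  case: k => l m /=; rewrite -gabor_coef sqcM sqcR -EFinM mulrA mulVf ?mul1r//.
  by rewrite expf_neq0// gt_eqF.
under eq_esum do rewrite E.
rewrite ge0_esumZ ?invr_ge0 ?sqr_ge0//; last by move=> k; rewrite lee_fin sqc_ge0.
rewrite -/(fsum leb2 ebox (hbox r)) (ps_eq parseval_box (Lh r)); last exact: hbox_supp.
by rewrite muleA -EFinM.
Qed.
End gabor_sum.

(** * Singular values as bounds of a quadratic form *)

Section gram.
Local Open Scope sesquilinear_scope.
Context {R : realType}.
Local Notation C := R[i].

Lemma mulcJ (z : C) : z * z^* = (sqc z)%:C%C.
Proof. by apply: ceqP; rewrite !ReImE /sqc/=; ring. Qed.

Lemma realcM (x y : R) : (x * y)%:C%C = x%:C%C * y%:C%C :> C.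
Proof. by rewrite rmorphM. Qed.

Definition rsq n (v : 'rV[C]_n) : R := \sum_i sqc (v 0 i).

Lemma rsqE n (v : 'rV[C]_n) : (v *m v^t*) 0 0 = (rsq v)%:C%C.
Proof.
by rewrite mxE /rsq rmorph_sum; apply: eq_bigr => i _; rewrite !mxE mulcJ.
Qed.

Lemma rsq_ge0 n (v : 'rV[C]_n) : 0 <= rsq v.
Proof. by apply: sumr_ge0 => i _; exact: sqc_ge0. Qed.

Lemma sqc_eq0 (z : C) : (sqc z == 0) = (z == 0).
Proof.
apply/idP/eqP => [|->]; last by rewrite sqc0.
by rewrite /sqc paddr_eq0 ?sqr_ge0// !sqrf_eq0 => /andP[/eqP h1 /eqP h2]; exact: ceqP.
Qed.

Lemma rsq_gt0 n (v : 'rV[C]_n) : v != 0 -> 0 < rsq v.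
Proof.
move=> v0; rewrite lt_def rsq_ge0 andbT; apply: contra v0.
rewrite psumr_eq0; last by move=> i _; exact: sqc_ge0.
move=> /allP h; apply/eqP/rowP => i; rewrite mxE; apply/eqP; rewrite -sqc_eq0.
by apply: h; rewrite mem_index_enum.
Qed.

Lemma trmxC_mul m n p (A : 'M[C]_(m, n)) (B : 'M[C]_(n, p)) :
  (A *m B)^t* = B^t* *m A^t*.
Proof. by rewrite trmx_mul map_mxM. Qed.

Lemma gram_rsq m n (Q : 'M[C]_(m, n)) (v : 'rV[C]_n) :
  (v *m (Q^t* *m Q) *m v^t*) 0 0 = (rsq (v *m Q^t*))%:C%C.
Proof. by rewrite -rsqE trmxC_mul trmxCK !mulmxA. Qed.

(** The form v |-> rsq (v *m Q^t* ) has Gram matrix Q^t* *m Q. Testing the bounds on an eigenvector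
    bounds its eigenvalue; conversely, a unitary diagonalization writes the form as a combination of
    squared moduli weighted by the eigenvalues. *)
Lemma singular_valuesP m n (Q : 'M[C]_(m, n)) (A B : R) : 0 <= A -> A <= B ->
  singular_values Q `<=` [set s%:C%C | s in `[Num.sqrt A, Num.sqrt B]] <->
  forall v : 'rV[C]_n, A * rsq v <= rsq (v *m Q^t*) <= B * rsq v.
Proof.
move=> A0 AB; split; last first.
  move=> h _ [a /eigenvalueP[v va v0] <-].
  have N0 := rsq_gt0 v0; have := h v.
  have : (v *m (Q^t* *m Q) *m v^t*) 0 0 = a * (rsq v)%:C%C.
    by rewrite va -scalemxAl mxE rsqE.
  rewrite gram_rsq => e /andP[h1 h2].
  pose t := rsq (v *m Q^t*) / rsq v.
  have ta : a = t%:C%C.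
    apply: (@mulIf _ ((rsq v)%:C%C)); first by rewrite (_ : 0 = 0%:C%C)// (inj_eq (@complexI R)) gt_eqF.
    by rewrite -e -realcM divfK// gt_eqF.
  have t1 : A <= t by rewrite ler_pdivlMr.
  have t2 : t <= B by rewrite ler_pdivrMr.
  have t0 : 0 <= t by exact: le_trans t1.
  exists (Num.sqrt t); first by rewrite /= in_itv/= !ler_wsqrtr.
  rewrite ta -{2}(sqr_sqrtr t0) expr2 realcM -expr2 sqrCK//.
  by rewrite (_ : 0 = 0%:C%C)// lecR sqrtr_ge0.
move=> h v; set M := Q^t* *m Q.
have herm : M \is hermsymmx.
  by apply/is_hermitianmxP; rewrite expr0 scale1r /M trmxC_mul trmxCK.
have /orthomx_spectralP hM := hermitian_normalmx herm.
set P := spectralmx M in hM; set D := spectral_diag M in hM.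
have PU : P \is unitarymx by exact: spectral_unitarymx.
have PM : P *m M = diag_mx D *m P.
  by rewrite {1}hM !mulmxA mulmxV ?mul1mx// unitarymx_unit.
(* The rows of P are nonzero eigenvectors, so the root of each diagonal entry is a singular value.
   Being the square of a real number in the interval, the entry is real and lies between A and B. *)
have ev i : exists2 t : R, A <= t <= B & D 0 i = t%:C%C.
  have : singular_values Q (sqrtC (D 0 i)).
    exists (D 0 i) => //; apply/eigenvalueP; exists (row i P).
      rewrite -/M -row_mul PM; apply/rowP => j; rewrite !mxE.
      by rewrite (bigD1 i)//= big1 ?addr0 ?mxE ?eqxx// => k ki; rewrite !mxE eq_sym (negbTE ki) mul0r.
    apply/eqP => r0; have /unitarymxP/matrixP/(_ i i) := PU.
    rewrite !mxE eqxx big1; first by move/eqP; rewrite eq_sym oner_eq0.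
    by move=> k _; have /rowP/(_ k) := r0; rewrite !mxE => ->; rewrite mul0r.
  move=> /h[s]; rewrite /= in_itv/= => /andP[s1 s2] e.
  have s0 : 0 <= s by exact: le_trans s1.
  exists (s ^+ 2).
    rewrite -{1}(sqr_sqrtr A0) ler_sqr ?nnegrE ?sqrtr_ge0// s1/=.
    by rewrite -[leRHS](sqr_sqrtr (le_trans A0 AB)) ler_sqr ?nnegrE ?sqrtr_ge0.
  by rewrite -[LHS](sqrtCK) -e expr2 -realcM -expr2.
pose w := v *m P^t*.
have wv : rsq w = rsq v.
  apply: (@complexI R); rewrite -!rsqE /w trmxC_mul trmxCK !mulmxA.
  by rewrite -[v *m _ *m _]mulmxA -(invmx_unitary PU) mulVmx ?mulmx1// unitarymx_unit.
have e : rsq (v *m Q^t*) = \sum_i cRe (D 0 i) * sqc (w 0 i).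
  apply: (@complexI R); rewrite -gram_rsq -/M hM (invmx_unitary PU) rmorph_sum.
  have -> : v *m (P^t* *m diag_mx D *m P) *m v^t* = w *m diag_mx D *m w^t*.
    by rewrite /w trmxC_mul trmxCK !mulmxA.
  rewrite mxE; apply: eq_bigr => i _; rewrite mul_mx_diag !mxE.
  by have [t _ ->] := ev i; rewrite /= realcM -mulcJ; ring.
rewrite e -wv /rsq !mulr_sumr; apply/andP; split; apply: ler_sum => i _;
  have [t /andP[t1 t2] ->] := ev i; apply: ler_wpM2r => //; exact: sqc_ge0.
Qed.
End gram.

(** The sections of a null set scale by a^-d, so it stays null. This connects xi with eta = beta
    xi. *)
Lemma ae_affine2 {R : realType} (d : nat) (a : R) (v : vec R d) (P : vec R d * vec R d -> Prop) :
  0 < a -> {ae (lebesgue R d \x lebesgue R d)%E, forall z, P z} ->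
  {ae (lebesgue R d \x lebesgue R d)%E, forall z, P (z.1, vadd (vscale a z.2) v)}.
Proof.
move=> a0 [N [mN N0 sN]].
pose phi (z : vec R d * vec R d) := (z.1, vadd (vscale a z.2) v).
have mphi : measurable_fun setT phi.
  apply/measurable_fun_pairP; split; first exact: measurable_fst.
  apply: measurable_vadd => //; apply: measurable_vscale; exact: measurable_snd.
have mN' : measurable (phi @^-1` N) by rewrite -[X in measurable X]setTI; exact: mphi.
exists (phi @^-1` N); split => //; last by move=> z nP; exact: sN.
have F (M : set (vec R d * vec R d)) :
    ((lebesgue R d \x lebesgue R d) M = \int[lebesgue R d]_x lebesgue R d (xsection M x))%E by [].
rewrite F; transitivity (\int[lebesgue R d]_x ((a^-1 ^+ d)%:E * lebesgue R d (xsection N x)))%E.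
  apply: eq_integral => x _; rewrite -(measure_affine v a0 (measurable_xsection x mN)).
  have -> : xsection (phi @^-1` N) x =
    (fun y => vadd (vscale a y) v) @^-1` xsection N x; last by [].
  by apply/seteqP; split => y /=; rewrite /xsection/= !inE.
rewrite ge0_integralZl//; first by rewrite -F N0 mule0.
  exact: measurable_fun_xsection.
by rewrite lee_fin exprn_ge0// invr_ge0 ltW.
Qed.

Lemma sum_nrm2_ae_le {R : realType} disp (T : measurableType disp)
    (mu : {measure set T -> \bar R}) (I J : finType) (F : I -> T -> R[i])
    (G : J -> T -> R[i]) (A B : R) : 0 <= A -> 0 <= B ->
  (forall i, cmeasurable (F i)) -> (forall j, cmeasurable (G j)) ->
  {ae mu, forall z, A * \sum_i sqc (F i z) <= B * \sum_j sqc (G j z)} ->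
  (A%:E * \sum_i nrm2 mu (F i) <= B%:E * \sum_j nrm2 mu (G j))%E.
Proof.
move=> A0 B0 mF mG h.
have E (L : finType) (H : L -> T -> R[i]) (c : R) : 0 <= c -> (forall i, cmeasurable (H i)) ->
    measurable_fun setT (fun z => (c * \sum_i sqc (H i z))%:E) /\
    (c%:E * \sum_i nrm2 mu (H i) = \int[mu]_z (c * \sum_i sqc (H i z))%:E)%E.
  move=> c0 mH; have mS : measurable_fun setT (fun z => (\sum_i sqc (H i z))%:E).
    apply/measurable_EFinP; apply: measurable_sum => i; exact: measurable_sqc.
  split; first by under eq_fun do rewrite EFinM; exact: measurable_funeM.
  under [RHS]eq_integral do rewrite EFinM.
  rewrite ge0_integralZl//; last first.
    by move=> z _; rewrite lee_fin sumr_ge0// => i _; exact: sqc_ge0.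
  congr (_ * _)%E; under [RHS]eq_integral do rewrite -sumEFin.
  rewrite ge0_integral_sum//; first by move=> i; exact: emeasurable_sqc.
  by move=> i z _; rewrite lee_fin sqc_ge0.
have [mF' ->] := E _ F A A0 mF; have [mG' ->] := E _ G B B0 mG.
apply: ae_ge0_le_integral => //.
- by move=> z _; rewrite lee_fin mulr_ge0// sumr_ge0// => i _; exact: sqc_ge0.
- by move=> z _; rewrite lee_fin mulr_ge0// sumr_ge0// => i _; exact: sqc_ge0.
- by apply: filterS h => z hz _; rewrite lee_fin.
Qed.

(** * Frame bounds and fiber bounds *)

Section frame_bounds.
Context {R : realType} (d : nat) (a : R) (a0 : 0 < a) (p q : nat)
  (p0 : (0 < p)%N) (q0 : (0 < q)%N).
Local Notation K := (d.-tuple int).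
Local Notation leb := (lebesgue R d).
Local Notation leb2 := (leb \x leb)%E.
Local Notation b := a^-1.
Variables (g : vec R d -> R[i]) (Zg : vec R d * vec R d -> R[i]).
Hypotheses (mg : cmeasurable g) (g2 : L2m leb g) (hZ : is_zak a g Zg).
Local Notation Ip := (d.-tuple 'I_p).
Local Notation Iq := (d.-tuple 'I_q).

Definition qrow (v : Ip -> R[i]) (r : Iq) (z : vec R d * vec R d) : R[i] :=
  \sum_s v s * (zshift a p Zg r (z.1, vshift a s z.2))^*.
Definition qform (v : Ip -> R[i]) z : R := \sum_r sqc (qrow v r z).

Variables (c0 c : vec R d).
Local Notation fib := (fiber a c0 c).

Lemma hbox_qrow Zf r z :
  hbox a p c0 c Zg Zf r z = cind (box a p c0 c) z * qrow (fun s => Zf (z.1, vshift a s z.2)) r z.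
Proof.
have [zb|zb] := pselect (box a p c0 c z); last by rewrite hbox_supp// cindF// mul0r.
by rewrite /hbox /qrow mulr_sumr; apply: eq_bigr => s _; rewrite /fiber cindT// !mul1r.
Qed.

Lemma cmeasurable_hbox Zf (r : Iq) : cmeasurable Zf -> cmeasurable (hbox a p c0 c Zg Zf r : _ -> R[i]).
Proof.
move=> mZf; apply: cmeasurable_sum => s; apply: cmeasurableM; first exact: cmeasurable_fiber.
by apply: cmeasurableJ; apply: cmeasurable_fiber; exact: cmeasurable_zshift hZ _.
Qed.

Lemma zak_pair_zak f Zf : cmeasurable f -> is_zak a f Zf -> zak_pair a c0 c f Zf.
Proof.
move=> mf zf; have [mZf _] := zf; split => //.
by apply: filterS (is_zak_coef a0 zf) => x hx _; exact: hx.
Qed.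

(** The factor [gconst] comes from the Gabor sum and b^d from the norm of f; together they simplify
    to (a / p)^d. *)
Definition fconst : R := gconst d a p * (b ^+ d).
Lemma fconst_gt0 : 0 < fconst.
Proof.
have bp : 0 < b / p%:R by rewrite divr_gt0 ?invr_gt0 ?ltr0n.
by rewrite /fconst /gconst !mulr_gt0 ?invr_gt0 ?exprn_gt0 ?invr_gt0.
Qed.

Lemma frame_of_bounds (A B : R) (f : vec R d -> R[i]) : 0 < A -> A <= B ->
  {ae leb2, forall z, forall v, A * \sum_s sqc (v s) <= qform v z <= B * \sum_s sqc (v s)} ->
  L2m leb f ->
  ((A * fconst)%:E * nrm2 leb f <=
     \esum_(k in [set: K * K]) (sqc (inner f (gab a p q g k.1 k.2)))%:E <=
     (B * fconst)%:E * nrm2 leb f)%E.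
Proof.
move=> A0 AB hAB f2; have [mf _] := f2; set Zf := zak a f.
have zf : is_zak a f Zf by apply: zak_is_zak => //; apply/L2_L2m.
have hf := zak_pair_zak mf zf; have [mZf _] := zf.
have B0 : 0 < B by exact: lt_le_trans AB.
have G0 : 0 <= gconst d a p.
  by rewrite -(pmulr_lge0 _ (exprn_gt0 d (_ : 0 < b))) ?invr_gt0// ltW// fconst_gt0.
have pt : {ae leb2, forall z,
    A * \sum_(s : Ip) sqc (fib Zf s z) <= 1 * \sum_(r : Iq) sqc (hbox a p c0 c Zg Zf r z) /\
    1 * \sum_(r : Iq) sqc (hbox a p c0 c Zg Zf r z) <= B * \sum_(s : Ip) sqc (fib Zf s z)}.
  apply: filterS hAB => z hz; rewrite mul1r.
  have [zb|zb] := pselect (box a p c0 c z); last first.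
    rewrite !big1 ?mulr0//.
      by move=> r _; rewrite hbox_supp// sqc0.
    by move=> s _; rewrite /fiber cindF// mul0r sqc0.
  (* Outside one null set the bounds hold for all v at once, so v may be the fiber of f at the very
     point z. *)
  have /andP[h1 h2] := hz (fun s => Zf (z.1, vshift a s z.2)).
  have -> : \sum_(r : Iq) sqc (hbox a p c0 c Zg Zf r z) =
      qform (fun s => Zf (z.1, vshift a s z.2)) z.
    by apply: eq_bigr => r _; rewrite hbox_qrow cindT// mul1r.
  have -> : \sum_(s : Ip) sqc (fib Zf s z) = \sum_(s : Ip) sqc (Zf (z.1, vshift a s z.2)).
    by apply: eq_bigr => s _; rewrite /fiber cindT// mul1r.
  by [].
have mh (r : Iq) : cmeasurable (hbox a p c0 c Zg Zf r : _ -> R[i]) by exact: cmeasurable_hbox.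
have mF (s : Ip) : cmeasurable (fib Zf s : _ -> R[i]) by exact: cmeasurable_fiber.
have lo : (A%:E * \sum_(s : Ip) nrm2 leb2 (fib Zf s) <=
    1%:E * \sum_(r : Iq) nrm2 leb2 (hbox a p c0 c Zg Zf r))%E.
  by apply: sum_nrm2_ae_le => //; [exact: ltW|apply: filterS pt => z []].
have hi : (1%:E * \sum_(r : Iq) nrm2 leb2 (hbox a p c0 c Zg Zf r) <=
    B%:E * \sum_(s : Ip) nrm2 leb2 (fib Zf s))%E.
  by apply: sum_nrm2_ae_le => //; [exact: ltW|apply: filterS pt => z []].
move: lo hi; rewrite mul1e (zak_pair_fiber a0 p0 hf) => lo hi.
have Lh (r : Iq) : L2m leb2 (hbox a p c0 c Zg Zf r).
  split => //; apply: (@le_lt_trans _ _ (\sum_(r : Iq) nrm2 leb2 (hbox a p c0 c Zg Zf r))%E).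
    by rewrite (bigD1 r)//= leeDl// sume_ge0// => i _; exact: nrm2_ge0.
  apply: le_lt_trans hi _; rewrite muleA -EFinM lte_mul_pinfty//; last by case: f2.
  by rewrite lee_fin mulr_ge0 ?exprn_ge0 ?invr_ge0 ?ltW.
rewrite (gabor_sum a0 p0 q0 mg g2 hZ f2 hf Lh).
have E X : ((X * fconst)%:E * nrm2 leb f =
    (gconst d a p)%:E * (X%:E * ((b ^+ d)%:E * nrm2 leb f)))%E.
  by rewrite !muleA -!EFinM /fconst mulrCA mulrA.
by rewrite !E !lee_wpmul2l.
Qed.
End frame_bounds.

(** On the part E of D where k < h, the assumed inequality and the pointwise one force the integrals
    of h and k to agree over every measurable subset. Integrability of k then gives h = k almost
    everywhere on E, so E is null. *)
Lemma ae_le_of_integrals {R : realType} disp (T : measurableType disp)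
    (mu : {measure set T -> \bar R}) (D : set T) (h k : T -> R) :
  measurable D -> measurable_fun setT h -> measurable_fun setT k ->
  (forall z, 0 <= h z) -> (forall z, 0 <= k z) ->
  (\int[mu]_(z in D) (k z)%:E < +oo)%E ->
  (forall E, E `<=` D -> measurable E ->
     (\int[mu]_(z in E) (h z)%:E <= \int[mu]_(z in E) (k z)%:E)%E) ->
  {ae mu, forall z, D z -> h z <= k z}.
Proof.
move=> mD mh mk h0 k0 kfin hE.
pose E := D `&` [set z | k z < h z].
have mE : measurable E.
  apply: measurableI => //; rewrite (_ : [set z | _] = (fun z => h z - k z) @^-1` `]0, +oo[).
    rewrite -[X in measurable X]setTI; apply: measurable_funB => //.
  by apply/seteqP; split => z /=; rewrite in_itv/= andbT subr_gt0.
have ED : E `<=` D by move=> z [].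
have mhE : measurable_fun setT (fun z => (h z)%:E) by exact/measurable_EFinP.
have mkE : measurable_fun setT (fun z => (k z)%:E) by exact/measurable_EFinP.
have hk F : F `<=` E -> measurable F ->
    (\int[mu]_(z in F) (k z)%:E = \int[mu]_(z in F) (h z)%:E)%E.
  move=> FE mF; apply/eqP; rewrite eq_le; apply/andP; split; last first.
    by apply: hE => //; exact: subset_trans ED.
  apply: ge0_le_integral => //.
  - by move=> z _; rewrite lee_fin.
  - exact: measurable_funTS.
  - exact: measurable_funTS.
  - by move=> z /FE[_]; rewrite lee_fin => /ltW.
have ik : mu.-integrable E (fun z => (k z)%:E).
  apply/integrableP; split; first exact: measurable_funTS.
  under eq_integral do rewrite gee0_abs ?lee_fin//.
  apply: le_lt_trans kfin; apply: ge0_subset_integral => //; first exact: measurable_funTS.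
  by move=> z _; rewrite lee_fin.
have := integral_ae_eq mE ik (measurable_funTS mhE) hk.
apply: filterS => z hz zD; rewrite leNgt; apply/negP => kh.
by have := hz (conj zD kh) => -[] e; rewrite e ltxx in kh.
Qed.

(** * Functions with prescribed fibers *)

Section test_functions.
Context {R : realType} (d : nat) (a : R) (a0 : 0 < a) (p : nat) (p0 : (0 < p)%N).
Variables (c0 c : vec R d).
Local Notation K := (d.-tuple int).
Local Notation leb := (lebesgue R d).
Local Notation leb2 := (leb \x leb)%E.
Local Notation b := a^-1.
Local Notation Ip := (d.-tuple 'I_p).
Let b0 : 0 < b. Proof. by rewrite invr_gt0. Qed.
Let bp0 : 0 < b / p%:R. Proof. by rewrite divr_gt0 ?ltr0n. Qed.
Let vol := b ^+ d.
Let vol0 : 0 < vol. Proof. by rewrite exprn_gt0. Qed.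
Let P := parseval_cube c b0.

Lemma finite_cubes (c1 c2 : vec R d) (l1 l2 : R) : 0 < l1 -> 0 < l2 ->
  (leb2 (cube c1 l1 `*` cube c2 l2) < +oo)%E.
Proof.
move=> l10 l20; rewrite product_measure1E; [|exact: measurable_cube|exact: measurable_cube].
rewrite (ps_measure (parseval_cube _ l10)) (ps_measure (parseval_cube _ l20)) -EFinM.
exact: ltry.
Qed.

Definition tile_index (y : vec R d) : K :=
  [tuple - Num.floor ((tnth y i - tnth c0 i) / a) | i < d].
Definition tile (n : K) : set (vec R d) := [set y | cube c0 a (vadd y (vscale a (vint R n)))].

Lemma tile_indexP n y : tile n y <-> tile_index y = n.
Proof.
have E i : tnth (vadd y (vscale a (vint R n))) i =
    tnth c0 i + a * ((tnth y i - tnth c0 i) / a + (tnth n i)%:~R).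
  rewrite vaddE vscaleE vintE mulrDr mulrA [a * _ * _]mulrAC mulfV ?gt_eqF// mul1r.
  by rewrite addrA subrKC.
have {}E i : (tnth c0 i <= tnth (vadd y (vscale a (vint R n))) i < tnth c0 i + a) =
   ((- tnth n i)%:~R <= (tnth y i - tnth c0 i) / a < (- tnth n i)%:~R + 1).
  rewrite E lerDl ltrD2l pmulr_rge0// -[X in _ < X]mulr1 ltr_pM2l// mulrNz.
  by congr andb; [rewrite -[RHS]subr_ge0 opprK|rewrite [- _ + 1]addrC ltrBrDr].
split=> [h|h i].
  apply: eq_from_tnth => i; rewrite tnth_mktuple.
  by have := h i; rewrite E => /floor_unique <-; rewrite opprK.
rewrite E -h tnth_mktuple opprK; exact: floor_bounds.
Qed.

Lemma measurable_tile n : measurable (tile n).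
Proof.
rewrite -[X in measurable X]setTI; apply: (measurable_shift (vscale a (vint R n))) => //.
exact: measurable_cube.
Qed.

Lemma cmeasurable_tiled (C : K -> vec R d -> R[i]) : (forall n, cmeasurable (C n)) ->
  cmeasurable (fun y => C (tile_index y) (vadd y (vscale a (vint R (tile_index y))))).
Proof.
move=> mC; pose G n y := C n (vadd y (vscale a (vint R n))).
have mG n : cmeasurable (G n) by apply: cmeasurable_comp (mC n) _; exact: measurable_shift.
pose E j := if choice.unpickle j is Some n then tile n else set0.
have mE j : measurable (E j).
  by rewrite /E; case: choice.unpickle => // n; exact: measurable_tile.
have ET : \bigcup_j E j = setT.
  apply/seteqP; split => // y _; exists (choice.pickle (tile_index y)) => //.
  by rewrite /E choice.pickleK; apply/tile_indexP.
have key (pr : R[i] -> R) : (forall n, measurable_fun setT (fun y => pr (G n y) : measurableTypeR R)) ->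
    measurable_fun setT (fun y => pr (G (tile_index y) y) : measurableTypeR R).
  move=> mpr; rewrite -ET; apply/measurable_fun_bigcup => // j.
  rewrite /E; case: choice.unpickle => [n|]; last exact: measurable_fun_set0.
  apply: (eq_measurable_fun (fun y => pr (G n y))).
    by move=> y; rewrite inE => /tile_indexP ->.
  by apply: (measurable_funS measurableT) => //; exact: mpr.
by split; apply: key => n; case: (mG n).
Qed.

Variables (E : set (vec R d * vec R d)) (v : Ip -> R[i]).
Hypotheses (mE : measurable E) (Ebox : E `<=` box a p c0 c).

Definition unshift (s : Ip) (z : vec R d * vec R d) :=
  (z.1, vadd z.2 (vopp (vscale (b / p%:R) (vord R s)))).
(* The quasi-periodic function whose fiber is v on E and 0 elsewhere; ftest
   recovers from its Fourier coefficients the function it is the Zak transform of. *)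
Definition ztest (z : vec R d * vec R d) : R[i] := \sum_s v s * cind E (unshift s z).
Definition cube2 (s : Ip) := cube c0 a `*` cube (vshift a s c) (b / p%:R).

Lemma measurable_unshift s : measurable_fun setT (unshift s).
Proof.
apply/measurable_fun_pairP; split; first exact: measurable_fst.
by apply: measurable_vadd => //; exact: measurable_snd.
Qed.

Lemma cmeasurable_ztest : cmeasurable ztest.
Proof.
apply: cmeasurable_sum => s; apply: cmeasurableM; first exact: cmeasurable_cst.
by apply: cmeasurable_comp (cmeasurable_cind mE) _; exact: measurable_unshift.
Qed.

Lemma L2m_ztest : L2m leb2 ztest.
Proof.
apply: L2m_sum => s; apply: L2mZ.
pose E' := unshift s @^-1` E.
have mE' : measurable E' by rewrite -[X in measurable X]setTI; exact: measurable_unshift.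
apply: (L2m_indic mE').
- apply: (@le_lt_trans _ _ (leb2 (cube2 s))).
    apply: le_measure; rewrite ?inE//; first by apply: measurableX; exact: measurable_cube.
    move=> z /= /Ebox[/= h1 h2]; split => // i.
    have := h2 i; rewrite /vshift !vaddE voppE !vscaleE lerBrDr ltrBlDr => /andP[-> h].
    by rewrite addrAC.
  exact: finite_cubes.
- by apply: cmeasurable_comp (cmeasurable_cind mE) _; exact: measurable_unshift.
- by move=> z; rewrite sqc_cind.
Qed.

(** The subcubes belonging to different s are disjoint: indices that differ in a coordinate move it
    by at least the side b / p. Hence only the s-th term of [ztest] survives on the s-th subcube. *)
Lemma fiber_ztest s z : fiber a c0 c ztest s z = v s * cind E z.
Proof.
have [zb|zb] := pselect (box a p c0 c z); last first.
  by rewrite /fiber cindF// mul0r cindF ?mulr0// => /Ebox.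
rewrite /fiber cindT// mul1r /ztest (bigD1 s)//= big1.
  rewrite addr0; congr (_ * cind E _); rewrite /unshift/= /vshift.
  rewrite [z in RHS]surjective_pairing; congr pair.
  by apply: vec_ext => i; rewrite !vaddE voppE addrK.
move=> s' s's; rewrite cindF ?mulr0// => /Ebox[/= _ h]; case: zb => _ h'.
move/eqP: s's; apply; apply: eq_from_tnth => i; apply/val_inj.
have := h i; have := h' i; rewrite /vshift !vaddE voppE !vscaleE !vordE.
set t := b / p%:R; move=> /andP[h1 h2] /andP[h3 h4].
have [ss|ss|//] := ltngtP (tnth s' i : nat) (tnth s i : nat).
  have : ((tnth s' i).+1%:R : R) <= (tnth s i)%:R by rewrite ler_nat.
  rewrite -(ler_pM2l bp0) -natr1 -/t mulrDr mulr1 => h5.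
  by exfalso; lra.
have : ((tnth s i).+1%:R : R) <= (tnth s' i)%:R by rewrite ler_nat.
rewrite -(ler_pM2l bp0) -natr1 -/t mulrDr mulr1 => h5; exfalso; lra.
Qed.

Definition ccoef (n : K) (x : vec R d) : R[i] :=
  fcoef leb (expC c b) (fun xi => cind (cube c b) xi * ztest (x, xi)) n * (vol^-1)%:C%C.
Definition ftest (y : vec R d) : R[i] :=
  ccoef (tile_index y) (vadd y (vscale a (vint R (tile_index y)))).

Lemma ztest0 x xi : ~ cube c0 a x -> ztest (x, xi) = 0.
Proof.
by move=> nx; rewrite /ztest big1// => s _; rewrite cindF ?mulr0// => /Ebox[].
Qed.

(** Fubini gives measurability of the coefficient as a function of x. The exponential is first cut
    to [cube c0 a] in x to be square-integrable, which is harmless as [ztest] vanishes off that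
    cube. *)
Lemma cmeasurable_ccoef n : cmeasurable (ccoef n).
Proof.
apply: cmeasurableM; last exact: cmeasurable_cst.
have mC0 := @measurable_cube R d c0 a; have mC := @measurable_cube R d c b.
pose e (z : vec R d * vec R d) := cind (cube c0 a) z.1 * expC c b n z.2.
have me : cmeasurable e.
  apply: cmeasurableM.
    by apply: cmeasurable_comp (cmeasurable_cind mC0) _; exact: measurable_fst.
  by apply: cmeasurable_comp (ps_cmeasurable P n) _; exact: measurable_snd.
have Le : L2m leb2 e.
  apply: (L2m_indic (A := cube c0 a `*` cube c b)) => //; first exact: measurableX.
    exact: finite_cubes.
  move=> z; rewrite sqcM sqc_cind (ps_sqc P) !indicE in_setX.
  by case: (_ \in _); case: (_ \in _); rewrite ?mulr1 ?mulr0.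
have LZ : L2m leb2 (fun z => cind (cube c b) z.2 * ztest z).
  apply: L2m_le L2m_ztest.
    apply: cmeasurableM; last exact: cmeasurable_ztest.
    by apply: cmeasurable_comp (cmeasurable_cind mC) _; exact: measurable_snd.
  move=> z; rewrite sqcM sqc_cind indicE; case: (_ \in _); rewrite ?mul1r// mul0r.
  exact: sqc_ge0.
have [[i1 i2] _] := cintegral_fubini (L2mM_cintegrable LZ (L2mJ Le)).
suff -> : (fun x => fcoef leb (expC c b) (fun xi => cind (cube c b) xi * ztest (x, xi)) n) =
    (fun x => cintegral leb (fun y => cind (cube c b) y * ztest (x, y) * (e (x, y))^*)).
  by split; apply/measurable_EFinP; [exact: measurable_int i1|exact: measurable_int i2].
apply/funext => x; congr cintegral; apply/funext => y; rewrite /e/=.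
have [xc|xc] := pselect (cube c0 a x); first by rewrite (cindT xc) mul1r.
by rewrite ztest0// mulr0 !mul0r.
Qed.

(** For x in [cube c0 a] the point x - a k lies in tile k, so the sample of [ftest] there is by
    construction the k-th coefficient of [ztest (x, .)] divided by the volume. *)
Lemma zak_pair_ftest : zak_pair a c0 c ftest ztest.
Proof.
split; [apply: cmeasurable_tiled; exact: cmeasurable_ccoef|exact: cmeasurable_ztest|].
apply: filterS (L2m_fubini L2m_ztest) => x Lx xc; split.
  apply: L2m_le Lx.
    apply: cmeasurableM; first by apply: cmeasurable_cind; exact: measurable_cube.
    by apply: cmeasurable_pair1; exact: cmeasurable_ztest.
  move=> z; rewrite sqcM sqc_cind indicE; case: (_ \in _); rewrite ?mul1r// mul0r.
  exact: sqc_ge0.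
move=> k; rewrite /zsample /ftest.
have Ex : vadd (vadd x (vopp (vscale a (vint R k)))) (vscale a (vint R k)) = x.
  by apply: vec_ext => i; rewrite !vaddE voppE subrK.
have -> : tile_index (vadd x (vopp (vscale a (vint R k)))) = k.
  by apply/tile_indexP; rewrite /tile/= Ex.
rewrite Ex /ccoef -mulrA -realcM mulVf ?gt_eqF//.
by rewrite mulr1.
Qed.

Lemma sum_fiber_ztest :
  (\sum_(s : Ip) nrm2 leb2 (fiber a c0 c ztest s) = (\sum_s sqc (v s))%:E * leb2 E)%E.
Proof.
rewrite -sumEFin ge0_sume_distrl; last by move=> s _; rewrite lee_fin sqc_ge0.
apply: eq_bigr => s _; have -> : fiber a c0 c ztest s = (fun z => v s * cind E z).
  by apply/funext => z; exact: fiber_ztest.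
rewrite nrm2Z; last exact: cmeasurable_cind.
by congr (_ * _)%E; apply: nrm2_indic => // z; rewrite sqc_cind.
Qed.

(** The identity [zak_pair_fiber] holds in the extended reals for any pair, so the finite norm of
    the prescribed fibers bounds the norm of the function. *)
Lemma L2m_ftest : L2m leb ftest.
Proof.
have h := zak_pair_ftest; have [mf _ _] := h; split => //.
have := zak_pair_fiber a0 p0 h; rewrite sum_fiber_ztest => e.
have : (vol%:E * nrm2 leb ftest < +oo)%E.
  rewrite -e lte_mul_pinfty//.
    by rewrite lee_fin sumr_ge0// => s _; exact: sqc_ge0.
  apply: (@le_lt_trans _ _ (leb2 (box a p c0 c))).
    by apply: le_measure; rewrite ?inE//; exact: measurable_box.
  exact: finite_cubes.
case: (nrm2 leb ftest) (nrm2_ge0 leb ftest) => //= [r _ _|_]; first exact: ltry.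
by rewrite gt0_muley ?lte_fin// ltxx.
Qed.
End test_functions.

(** * From the frame inequality to pointwise bounds *)

Section bounds_of_frame.
Context {R : realType} (d : nat) (a : R) (a0 : 0 < a) (p q : nat)
  (p0 : (0 < p)%N) (q0 : (0 < q)%N).
Local Notation K := (d.-tuple int).
Local Notation leb := (lebesgue R d).
Local Notation leb2 := (leb \x leb)%E.
Local Notation b := a^-1.
Local Notation Ip := (d.-tuple 'I_p).
Local Notation Iq := (d.-tuple 'I_q).
Variables (g : vec R d -> R[i]) (Zg : vec R d * vec R d -> R[i]).
Hypotheses (mg : cmeasurable g) (g2 : L2m leb g) (hZ : is_zak a g Zg).
Variables (A B : R).
Hypothesis (A0 : 0 < A) (B0 : 0 < B).
Hypothesis frame : forall f, L2m leb f ->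
  (A%:E * nrm2 leb f <=
     \esum_(k in [set: K * K]) (sqc (inner f (gab a p q g k.1 k.2)))%:E <=
     B%:E * nrm2 leb f)%E.
Local Notation qf := (qform a q Zg).
Local Notation kappa := (fconst d a p).
Let kappa0 : 0 < kappa := fconst_gt0 d a0 p0.
Let bp0 : 0 < b / p%:R. Proof. by rewrite divr_gt0 ?invr_gt0 ?ltr0n. Qed.
Let vol0 : 0 < b ^+ d. Proof. by rewrite exprn_gt0 ?invr_gt0. Qed.
Let G0 : 0 < gconst d a p.
Proof. by rewrite -(pmulr_lgt0 _ vol0); exact: kappa0. Qed.

Lemma qform_ge0 (v : Ip -> R[i]) z : 0 <= qf v z.
Proof. by apply: sumr_ge0 => r _; exact: sqc_ge0. Qed.

Lemma cmeasurable_qrow (v : Ip -> R[i]) (r : Iq) : cmeasurable (qrow a Zg v r).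
Proof.
apply: cmeasurable_sum => s; apply: cmeasurableM; first exact: cmeasurable_cst.
apply: cmeasurableJ.
exact: cmeasurable_comp (cmeasurable_zshift p hZ r) (measurable_vshift2 a s).
Qed.

Lemma measurable_qform (v : Ip -> R[i]) : measurable_fun setT (qf v : _ -> measurableTypeR R).
Proof. by apply: measurable_sum => r; apply: measurable_sqc; exact: cmeasurable_qrow. Qed.

Section fixed_box.
Variables (c0 c : vec R d).

Lemma hbox_ztest (E : set (vec R d * vec R d)) (v : Ip -> R[i]) (r : Iq) z :
  E `<=` box a p c0 c ->
  hbox a p c0 c Zg (ztest a E v) r z = cind E z * qrow a Zg v r z.
Proof.
move=> Eb; rewrite /hbox /qrow mulr_sumr; apply: eq_bigr => s _.
rewrite (fiber_ztest a0 p0 v Eb).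
have [zE|zE] := pselect (E z); last by rewrite cindF// mulr0 !mul0r.
by rewrite (cindT zE) mulr1 mul1r /fiber cindT ?mul1r//; exact: Eb.
Qed.

Lemma box_averages (E : set (vec R d * vec R d)) (v : Ip -> R[i]) :
  measurable E -> E `<=` box a p c0 c ->
  ((A / kappa * \sum_s sqc (v s))%:E * leb2 E <= \int[leb2]_(z in E) (qf v z)%:E <=
   (B / kappa * \sum_s sqc (v s))%:E * leb2 E)%E.
Proof.
move=> mE Eb.
have hf := zak_pair_ftest a0 p0 v mE Eb; have f2 := L2m_ftest a0 p0 v mE Eb.
set f := ftest a c0 c E v in hf f2.
have Lh (r : Iq) : L2m leb2 (hbox a p c0 c Zg (ztest a E v) r).
  apply: L2m_sum => s; apply: (@L2m_le _ _ _ _ _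
    (fun z => v s * (fiber a c0 c (zshift a p Zg r) s z)^*)).
  - apply: cmeasurableM; first by apply: cmeasurable_fiber; exact: cmeasurable_ztest.
    by apply: cmeasurableJ; apply: cmeasurable_fiber; exact: cmeasurable_zshift hZ _.
  - move=> z; rewrite (fiber_ztest a0 p0 v Eb) !sqcM sqc_cind indicE.
    case: (_ \in _); rewrite ?mulr1// mulr0 mul0r.
    by rewrite mulr_ge0// sqc_ge0.
  - by apply: L2mZ; apply: L2mJ; exact: (L2m_fiber_zshift a0 p0 q0 c0 c mg g2 hZ).
have S : (\sum_(r : Iq) nrm2 leb2 (hbox a p c0 c Zg (ztest a E v) r) =
    \int[leb2]_(z in E) (qf v z)%:E)%E.
  rewrite /nrm2 -ge0_integral_sum//; last 2 first.
  - by move=> r; apply: emeasurable_sqc; case: (Lh r).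
  - by move=> r z _; rewrite lee_fin sqc_ge0.
  rewrite [RHS]integral_mkcond; apply: eq_integral => z _; rewrite /patch sumEFin.
  under eq_bigr do rewrite hbox_ztest// sqcM sqc_cind.
  by rewrite -mulr_sumr indicE; case: (_ \in _); rewrite ?mul1r ?mul0r.
have := frame f2; rewrite (gabor_sum a0 p0 q0 mg g2 hZ f2 hf Lh) S.
have E1 X : ((X / kappa * \sum_s sqc (v s))%:E * leb2 E =
    ((gconst d a p)^-1)%:E * (X%:E * nrm2 leb f))%E.
  have := zak_pair_fiber a0 p0 hf; rewrite (sum_fiber_ztest a0 p0 v mE Eb) => e.
  rewrite EFinM -muleA e !muleA -!EFinM; congr (_%:E * _)%E.
  by rewrite /fconst; field; rewrite !gt_eqF.
have E2 I : I = (((gconst d a p)^-1)%:E * ((gconst d a p)%:E * I))%E.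
  by rewrite muleA -EFinM mulVf ?gt_eqF// mul1e.
rewrite !E1 => /andP[h1 h2]; rewrite [X in (_ <= X <= _)%E]E2.
by rewrite !lee_wpmul2l// lee_fin invr_ge0 ltW.
Qed.

Lemma box_bounds (v : Ip -> R[i]) : {ae leb2, forall z, box a p c0 c z ->
  A / kappa * \sum_s sqc (v s) <= qf v z <= B / kappa * \sum_s sqc (v s)}.
Proof.
have mb := measurable_box a p c0 c.
have N0 : 0 <= \sum_s sqc (v s) by apply: sumr_ge0 => s _; exact: sqc_ge0.
have a1 : 0 <= A / kappa * \sum_s sqc (v s) by rewrite mulr_ge0// divr_ge0// ltW.
have b1 : 0 <= B / kappa * \sum_s sqc (v s) by rewrite mulr_ge0// divr_ge0// ltW.
have fb : (leb2 (box a p c0 c) < +oo)%E by exact: finite_cubes.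
have lo : {ae leb2, forall z, box a p c0 c z -> A / kappa * \sum_s sqc (v s) <= qf v z}.
  apply: (ae_le_of_integrals mb _ (measurable_qform v)) => //.
  - by move=> z; exact: qform_ge0.
  (* The upper frame bound, averaged over the whole box, gives the integrability of the form
     required for the lower comparison. *)
  - have /andP[_ h] := box_averages v mb (@subset_refl _ _).
    by apply: le_lt_trans h _; rewrite lte_mul_pinfty.
  - move=> E Eb mE; rewrite integral_cst//.
    by have /andP[] := box_averages v mE Eb.
have hi : {ae leb2, forall z, box a p c0 c z -> qf v z <= B / kappa * \sum_s sqc (v s)}.
  apply: (ae_le_of_integrals mb (measurable_qform v)) => //.
  - by move=> z; exact: qform_ge0.
  - by rewrite integral_cst// lte_mul_pinfty.
  - move=> E Eb mE; rewrite integral_cst//.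
    by have /andP[] := box_averages v mE Eb.
by apply: filterS2 lo hi => z h1 h2 zb; rewrite h1//= h2.
Qed.
End fixed_box.

(** Finite functions into pairs of rationals form a countable type, so the exceptional null sets can
    be united. *)
Definition ratc (u : {ffun Ip -> rat * rat}) (s : Ip) : R[i] :=
  (ratr (u s).1 +i* ratr (u s).2)%C.

Lemma ae_rational_bounds : {ae leb2, forall z, forall u : {ffun Ip -> rat * rat},
  A / kappa * \sum_s sqc (ratc u s) <= qf (ratc u) z <= B / kappa * \sum_s sqc (ratc u s)}.
Proof.
(* Boxes with corners on the lattice a Z^d x (b / p) Z^d cover the whole space; this is where the
   freedom of c0 and c is used. *)
have h (t : K * K * {ffun Ip -> rat * rat}) := box_bounds (vscale a (vint R t.1.1))
  (vscale (b / p%:R) (vint R t.1.2)) (ratc t.2).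
apply: filterS (ae_forall_count h) => z hz u.
have [k1 h1] := cube_cover a0 z.1; have [k2 h2] := cube_cover bp0 z.2.
exact: (hz (k1, k2, u)).
Qed.
End bounds_of_frame.

(** * Passage from rational vectors to all vectors *)

Section density.
Context {R : realType}.

Lemma rat_seq (x : R) : exists u : nat -> rat, (ratr (u n) : R) @[n --> \oo] --> x.
Proof.
have h n : exists r : rat, x < ratr r < x + n.+1%:R^-1.
  have /rat_in_itvoo[r] : x < x + n.+1%:R^-1 by rewrite ltrDl invr_gt0 ltr0n.
  by rewrite in_itv/= => hr; exists r.
have [u hu] := choice h; exists u.
apply: (@squeeze_cvgr _ _ _ _ (fun=> x) (fun n => x + n.+1%:R^-1)).
- by apply: nearW => n; have /andP[/ltW -> /ltW ->] := hu n.
- exact: cvg_cst.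
- rewrite -[X in _ --> X]addr0; apply: cvgD; first exact: cvg_cst.
  exact: cvg_harmonic.
Qed.

Lemma cvgn_sum (I : Type) (r : seq I) (u : I -> nat -> R) (l : I -> R) :
  (forall i, u i n @[n --> \oo] --> l i) ->
  (\sum_(i <- r) u i n) @[n --> \oo] --> \sum_(i <- r) l i.
Proof.
move=> h; elim: r => [|i r IH].
  by under eq_fun do rewrite big_nil; rewrite big_nil; exact: cvg_cst.
by under eq_fun do rewrite big_cons; rewrite big_cons; exact: cvgD.
Qed.

Lemma cvg_sqc (w : nat -> R[i]) (l : R[i]) :
  (cRe (w n) @[n --> \oo] --> cRe l) -> (cIm (w n) @[n --> \oo] --> cIm l) ->
  sqc (w n) @[n --> \oo] --> sqc l.
Proof. by move=> h1 h2; apply: cvgD; rewrite !expr2; apply: cvgM. Qed.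

Lemma quadratic_bounds_extend (I J : finType) (Q : J -> I -> R[i]) (A B : R) :
  (forall u : {ffun I -> rat * rat}, let v s := (ratr (u s).1 +i* ratr (u s).2)%C in
     A * \sum_s sqc (v s) <= \sum_r sqc (\sum_s v s * (Q r s)^*) <= B * \sum_s sqc (v s)) ->
  forall v : I -> R[i],
     A * \sum_s sqc (v s) <= \sum_r sqc (\sum_s v s * (Q r s)^*) <= B * \sum_s sqc (v s).
Proof.
move=> h v.
have [x hx] := choice (fun s => rat_seq (cRe (v s))).
have [y hy] := choice (fun s => rat_seq (cIm (v s))).
pose u n := [ffun s => (x s n, y s n)]; pose w n s : R[i] := (ratr (x s n) +i* ratr (y s n))%C.
have hw n := h (u n).
have {}hw n : A * \sum_s sqc (w n s) <=
    \sum_r sqc (\sum_s w n s * (Q r s)^*) <= B * \sum_s sqc (w n s).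
  suff -> : w n = (fun s => (ratr (u n s).1 +i* ratr (u n s).2)%C) by exact: hw.
  by apply/funext => s; rewrite ffunE.
have c1 : (\sum_s sqc (w n s)) @[n --> \oo] --> \sum_s sqc (v s).
  by apply: cvgn_sum => s; apply: cvg_sqc; [exact: hx|exact: hy].
have ReS (F : I -> R[i]) : cRe (\sum_s F s) = \sum_s cRe (F s) by rewrite raddf_sum.
have ImS (F : I -> R[i]) : cIm (\sum_s F s) = \sum_s cIm (F s) by rewrite raddf_sum.
have c2 : (\sum_r sqc (\sum_s w n s * (Q r s)^*)) @[n --> \oo] -->
    \sum_r sqc (\sum_s v s * (Q r s)^*).
  apply: cvgn_sum => r; apply: cvg_sqc.
    under eq_fun do rewrite ReS; rewrite ReS; apply: cvgn_sum => s.
    under eq_fun do rewrite ReImE; rewrite ReImE; apply: cvgB; apply: cvgM;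
      by [exact: hx|exact: hy|exact: cvg_cst].
  under eq_fun do rewrite ImS; rewrite ImS; apply: cvgn_sum => s.
  under eq_fun do rewrite ReImE; rewrite ReImE; apply: cvgD; apply: cvgM;
    by [exact: hx|exact: hy|exact: cvg_cst].
have c3 X : (X * \sum_s sqc (w n s)) @[n --> \oo] --> X * \sum_s sqc (v s).
  by apply: cvgM => //; exact: cvg_cst.
apply/andP; split.
  by apply: (ler_cvg_to (c3 A) c2); apply: nearW => n; have /andP[] := hw n.
by apply: (ler_cvg_to c2 (c3 B)); apply: nearW => n; have /andP[] := hw n.
Qed.
End density.

Lemma sum_enum_val (V : nmodType) (T : finType) (F : T -> V) :
  \sum_(i < #|{: T}|) F (enum_val i) = \sum_x F x.
Proof. by rewrite -big_enum_val; apply: eq_bigl. Qed.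

(** * The matrix of the statement and the quadratic form *)

Section zak_matrices.
Context {R : realType} (d : nat) (beta : R) (beta0 : 0 < beta) (p q : nat)
  (p0 : (0 < p)%N) (q0 : (0 < q)%N).
Variable (g : vec R d -> R[i]).
Local Notation leb2 := (lebesgue R d \x lebesgue R d)%E.
Local Notation Ip := (d.-tuple 'I_p).
Local Notation a := beta^-1.

Lemma zak_matrixE x xi i j : zak_matrix g beta p q x xi i j =
  zshift a p (zak a g) (enum_val i) (x, vshift a (enum_val j) (vscale beta xi)).
Proof.
rewrite mxE /zshift /vshift invrK /=; congr (zak _ _ (vadd _ (vscale _ _), _)).
by rewrite invfM mulrCA mulrA.
Qed.

Lemma singular_values_qform x xi (A B : R) : 0 <= A -> A <= B ->
  singular_values (zak_matrix g beta p q x xi) `<=`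
    [set s%:C%C | s in `[Num.sqrt A, Num.sqrt B]] <->
  forall v : Ip -> R[i], A * \sum_s sqc (v s) <=
    qform a q (zak a g) v (x, vscale beta xi) <= B * \sum_s sqc (v s).
Proof.
move=> A0 AB; rewrite singular_valuesP//.
have E1 (w : Ip -> R[i]) (v : 'rV[R[i]]_(#|{: Ip}|)) :
    (forall j, v 0 j = w (enum_val j)) ->
    rsq v = \sum_s sqc (w s) /\
    rsq (v *m (zak_matrix g beta p q x xi ^t*)%sesqui) =
      qform a q (zak a g) w (x, vscale beta xi).
  move=> e; split.
    by rewrite -(sum_enum_val (fun s => sqc (w s))); apply: eq_bigr => j _; rewrite e.
  rewrite /qform -(sum_enum_val (fun r => sqc (qrow a (zak a g) w r _))).
  apply: eq_bigr => i _; congr sqc; rewrite mxE /qrow.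
  rewrite -(sum_enum_val (fun s => w s * _^*)); apply: eq_bigr => j _.
  by rewrite e mxE mxE zak_matrixE.
split=> h v.
  have [<- <-] := E1 v (\row_j v (enum_val j)) (fun j => mxE _ _ _ _).
  exact: h.
have [|-> ->] := E1 (fun s => v 0 (enum_rank s)) v; last exact: h.
by move=> j; rewrite enum_valK.
Qed.

(** The matrix at (x, xi) corresponds to the form at (x, beta xi); dilations of the second variable
    by beta and by 1 / beta preserve null sets, one for each direction. *)
Lemma ae_singular_values (A B : R) : 0 <= A -> A <= B ->
  {ae leb2, forall z : vec R d * vec R d,
     singular_values (zak_matrix g beta p q z.1 z.2) `<=`
       [set s%:C%C | s in `[Num.sqrt A, Num.sqrt B]]} <->
  {ae leb2, forall z, forall v : Ip -> R[i], A * \sum_s sqc (v s) <=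
     qform a q (zak a g) v z <= B * \sum_s sqc (v s)}.
Proof.
move=> A0 AB; pose o : vec R d := [tuple 0 | i < d].
have oE (x : vec R d) : vadd x o = x by apply: vec_ext => i; rewrite vaddE tnth_mktuple addr0.
split=> h.
  have a0 : 0 < a by rewrite invr_gt0.
  apply: filterS (ae_affine2 o a0 h) => z /(singular_values_qform _ _ A0 AB) hz v.
  have := hz v; suff -> : (z.1, vscale beta (vadd (vscale a z.2) o)) = z by [].
  rewrite [RHS]surjective_pairing; congr pair; rewrite oE.
  by apply: vec_ext => i; rewrite !vscaleE mulrA mulfV ?mul1r// gt_eqF.
apply: filterS (ae_affine2 o beta0 h) => z hz.
by apply/(singular_values_qform _ _ A0 AB) => v; have := hz v; rewrite oE.
Qed.
End zak_matrices.

Unset Implicit Arguments.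

Theorem theorem7p2 (R : realType) (d : nat) (g : vec R d -> R[i])
    (alpha beta : R) (p q : nat)
    (hg : L2 g) (halpha : 0 < alpha) (hbeta : 0 < beta)
    (hp : (0 < p)%N) (hq : (0 < q)%N) (hpq : (p <= q)%N)
    (hab : alpha * beta = p%:R / q%:R) :
  gabor_frame g alpha beta <->
  exists A B : R, [/\ 0 < A, A <= B &
    {ae (lebesgue R d \x lebesgue R d)%E, forall z : vec R d * vec R d,
      singular_values (zak_matrix g beta p q z.1 z.2) `<=`
      [set (s%:C)%C | s in `[Num.sqrt A, Num.sqrt B]]}].
Proof.
have a0 : 0 < beta^-1 by rewrite invr_gt0.
have [mg _] := hg; have g2 : L2m (lebesgue R d) g by apply/L2_L2m.
have hZ := zak_is_zak a0 hg; have k0 := fconst_gt0 d a0 hp.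
have S f : (\esum_(l in [set: d.-tuple int * d.-tuple int])
    ((Normc.normc (inner f (tfshift (vscale alpha (vint R l.1))
                                    (vscale beta (vint R l.2)) g))) ^+ 2)%:E =
    \esum_(k in [set: d.-tuple int * d.-tuple int])
    (sqc (inner f (gab beta^-1 p q g k.1 k.2)))%:E)%E.
  apply: eq_esum => k _; rewrite normc_sqr /gab invrK.
  by rewrite -hab mulrCA mulVf ?mulr1// gt_eqF.
split.
  move=> [A [B [A0 B0 frame]]].
  have frame' f : L2m (lebesgue R d) f -> (A%:E * nrm2 (lebesgue R d) f <=
      \esum_(k in [set: d.-tuple int * d.-tuple int])
      (sqc (inner f (gab beta^-1 p q g k.1 k.2)))%:E <= B%:E * nrm2 (lebesgue R d) f)%E.
    by move=> /L2_L2m /frame /=; rewrite S sqnormE.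
  (* The maximum makes the two endpoints ordered; it only weakens the upper bound. *)
  exists (A / fconst d beta^-1 p), (Num.max (A / fconst d beta^-1 p) (B / fconst d beta^-1 p)).
  have A1 : 0 < A / fconst d beta^-1 p by rewrite divr_gt0.
  have AB : A / fconst d beta^-1 p <= Num.max (A / fconst d beta^-1 p) (B / fconst d beta^-1 p).
    by rewrite le_max lexx.
  split=> //; apply/(ae_singular_values hbeta p q g (ltW A1) AB).
  apply: filterS (ae_rational_bounds a0 hp hq mg g2 hZ A0 B0 frame') => z hz v.
  have /andP[-> h] := quadratic_bounds_extend (Q := fun r s =>
    zshift beta^-1 p (zak beta^-1 g) r (z.1, vshift beta^-1 s z.2)) hz v.
  apply: le_trans h _; rewrite ler_wpM2r ?le_max ?lexx ?orbT//.
  by apply: sumr_ge0 => s _; exact: sqc_ge0.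
move=> [A [B [A0 AB /(ae_singular_values hbeta p q g (ltW A0) AB) h]]].
exists (A * fconst d beta^-1 p), (B * fconst d beta^-1 p); split.
- by rewrite mulr_gt0.
- by rewrite mulr_gt0//; exact: lt_le_trans AB.
move=> f /L2_L2m f2 /=; rewrite S sqnormE.
(* Any cell serves for this direction; both corners are put at the origin. *)
pose o : vec R d := [tuple 0 | i < d].
exact: (frame_of_bounds a0 hp hq mg g2 hZ o o A0 AB h f2).
Qed.
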